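(* Suppose that: (A-1) $y_n=p/n\to y\in(0,1)$ as $n\to\infty$ and $y<\min(t_0,1-t_0)$ for some $t_0\in(0,1)$; (A-2) the components $x_{ji}$ ($1\le j\le p$, $1\le i\le n$) of the vectors $\mathbf{x}_1,\dots,\mathbf{x}_n$ are i.i.d. with some continuous distribution satisfying $\operatorname{Var}[x_{11}]=1$, $\mathbb{E}[x_{11}^4]>1$ and $\mathbb{E}|x_{11}|^{4+\delta}<\infty$ for some $\delta>4$; (A-3) $\inf_n\lambda_{\min}(\boldsymbol{\Sigma}_1)>0$ and $\sup_n\lambda_{\max}(\boldsymbol{\Sigma}_1)<\infty$; and that $\mathbb{E}[x_{11}]=0$. Then, under $H_0:\boldsymbol{\Sigma}_1=\dots=\boldsymbol{\Sigma}_n$, the sequence $(\boldsymbol{\Lambda}_n)_{n\in\mathbb{N}}$ of processes $$\boldsymbol{\Lambda}_n=\Big(\frac{2\log\Lambda_{n,t}-\mu_{n,t}}{n}\Big)_{t\in[t_0,1-t_0]}$$ is asymptotically tight in the space $\ell^\infty([t_0,1-t_0])$.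
   Context: For each $n$ (with $p=p_n$) one observes independent $p$-dimensional vectors $\mathbf{y}_i=(y_{1i},\dots,y_{pi})^\top=\boldsymbol{\Sigma}_i^{1/2}\mathbf{x}_i$, $1\le i\le n$, where $\mathbf{x}_i=(x_{1i},\dots,x_{pi})^\top$ are i.i.d. random vectors and $\boldsymbol{\Sigma}_i=\boldsymbol{\Sigma}_{i,n}\in\mathbb{R}^{p\times p}$ are covariance matrices. The distribution of the entries $x_{ji}$ does not depend on $n$. The interval $[t_0,1-t_0]$ is assumed nonempty. All quantities are considered for $n$ large enough that they are well defined. Non-centered sample covariance matrices: $\hat{\boldsymbol{\Sigma}}_{i:j}=\frac{1}{j-i+1}\sum_{k=i}^j\mathbf{y}_k\mathbf{y}_k^\top$ for $1\le i\le j\le n$, $\hat{\boldsymbol{\Sigma}}=\hat{\boldsymbol{\Sigma}}_{1:n}$. With $|\cdot|$ the determinant, $$\Lambda_{n,t}=\frac{\big|\hat{\boldsymbol{\Sigma}}_{1:\lfloor nt\rfloor}\big|^{\frac12\lfloor nt\rfloor}\,\big|\hat{\boldsymbol{\Sigma}}_{(\lfloor nt\rfloor+1):n}\big|^{\frac12(n-\lfloor nt\rfloor)}}{\big|\hat{\boldsymbol{\Sigma}}\big|^{\frac12 n}}.$$ Kurtosis estimator: with $\overline{\mathbf{y}}=\frac1n\sum_{k=1}^n\mathbf{y}_k$ and $\hat{\boldsymbol{\Sigma}}^{\mathrm{cen}}=\frac{1}{n-1}\sum_{k=1}^n(\mathbf{y}_k-\overline{\mathbf{y}})(\mathbf{y}_k-\overline{\mathbf{y}})^\top$,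 $$\hat\tau_n=\operatorname{tr}\big((\hat{\boldsymbol{\Sigma}}^{\mathrm{cen}})^2\big)-\frac1n\big(\operatorname{tr}\hat{\boldsymbol{\Sigma}}^{\mathrm{cen}}\big)^2,\quad \hat\nu_n=\frac{1}{n-1}\sum_{i=1}^n\Big(\|\mathbf{y}_i-\overline{\mathbf{y}}\|_2^2-\frac1n\sum_{i'=1}^n\|\mathbf{y}_{i'}-\overline{\mathbf{y}}\|_2^2\Big)^2,$$ $$\hat\omega_n=\sum_{j=1}^p\Big\{\frac1n\sum_{i=1}^n\Big(y_{ji}-\frac1n\sum_{i'=1}^n y_{ji'}\Big)^2\Big\}^2,\qquad \hat\kappa_n=\max\Big\{3+\frac{\hat\nu_n-2\hat\tau_n}{\hat\omega_n},\,1\Big\}.$$ Centering: $$\mu_{n,t}=n\Big(n-p-\tfrac12\Big)\log\Big(1-\frac{p}{n}\Big)-\lfloor nt\rfloor\Big(\lfloor nt\rfloor-p-\tfrac12\Big)\log\Big(1-\frac{p}{\lfloor nt\rfloor}\Big)-(n-\lfloor nt\rfloor)\Big(n-\lfloor nt\rfloor-p-\tfrac12\Big)\log\Big(1-\frac{p}{n-\lfloor nt\rfloor}\Big)-\frac{(\hat\kappa_n-3)p}{2}.$$ $\ell^\infty([t_0,1-t_0])$ is the space of bounded real functions on $[t_0,1-t_0]$ with the supremum norm; asymptotic tightness is in the sense of van der Vaart and Wellner: for every $\varepsilon>0$ there is a compact $K\subset\ell^\infty([t_0,1-t_0])$ such that for every $\eta>0$, $\liminf_{n\to\infty}\mathbb{P}_*(\boldsymbol{\Lambda}_n\in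 K^\eta)\ge 1-\varepsilon$, where $K^\eta$ is the open $\eta$-neighbourhood of $K$ and $\mathbb{P}_*$ is inner probability. *)

(* Defs.v *)
From HB Require Import structures.
From mathcomp Require Import all_boot all_order all_algebra.
From mathcomp Require Import all_classical all_reals all_analysis.

Set Implicit Arguments.
Unset Strict Implicit.
Unset Printing Implicit Defensive.

Import Order.TTheory GRing.Theory Num.Theory.
Import numFieldNormedType.Exports.

Local Open Scope classical_set_scope.
Local Open Scope ring_scope.

Section linfty.
Context (I : Type) (R : realType).

Definition linfty_pred : {pred I -> R} :=
  mem [set f : I -> R | bounded_fun (f : I -> R^o)].

Lemma linfty_predP (f : I -> R) :
  reflect (exists M : R, forall i, `|f i| <= M) (f \in linfty_pred).
Proof.
apply: (iffP idP); rewrite inE /= /bounded_near.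
  move=> /pinfty_ex_gt0[M _ fM]; exists M => i; exact: fM.
move=> [M fM]; exists M; split; first exact: num_real.
by move=> x Mx i _; apply: le_trans (fM i) (ltW Mx).
Qed.

Lemma linfty_submod_closed : submod_closed linfty_pred.
Proof.
split; first by apply/linfty_predP; exists 0 => i /=; rewrite normr0.
move=> a f g /linfty_predP[M fM] /linfty_predP[N gN].
apply/linfty_predP; exists (`|a| * M + N) => i /=.
rewrite (le_trans (ler_normD _ _))// lerD// normrM.
by rewrite ler_wpM2l.
Qed.

HB.instance Definition _ :=
  GRing.isSubmodClosed.Build R (I -> R) linfty_pred linfty_submod_closed.

Record linfty : Type := Linfty {
  linfty_fun :> I -> R ;
  linfty_funP : linfty_fun \in linfty_pred }.

HB.instance Definition _ := [isSub for linfty_fun].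
HB.instance Definition _ := [Choice of linfty by <:].
HB.instance Definition _ := [SubChoice_isSubLmodule of linfty by <:].

(* For I empty, this is sup set0 = 0. *)
Definition linfty_norm (f : linfty) : R := sup (range (fun i => `|f i|)).

Lemma linfty_norm_ub (f : linfty) i : `|f i| <= linfty_norm f.
Proof.
apply: ub_le_sup; last by exists i.
have /linfty_predP[M fM] := linfty_funP f.
by exists M => _ [j _ <-].
Qed.

Lemma linfty_norm_le (f : linfty) (M : R) :
  0 <= M -> (forall i, `|f i| <= M) -> linfty_norm f <= M.
Proof.
move=> M0 fM; have [[x fx]|/set0P/negP/negPn/eqP f0] :=
  pselect (range (fun i => `|f i|) !=set0).
  by apply: ge_sup; [exists x | move=> _ [j _ <-]].
by rewrite /linfty_norm f0 sup0.
Qed.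

Lemma linfty_norm_ge0 (f : linfty) : 0 <= linfty_norm f.
Proof.
have [[_ [i _ _]]|/set0P/negP/negPn/eqP f0] :=
  pselect (range (fun i => `|f i|) !=set0).
  exact: le_trans (linfty_norm_ub f i).
by rewrite /linfty_norm f0 sup0.
Qed.

Lemma linfty_normD (f g : linfty) :
  linfty_norm (f + g) <= linfty_norm f + linfty_norm g.
Proof.
apply: linfty_norm_le => [|i]; first by rewrite addr_ge0// linfty_norm_ge0.
by rewrite (le_trans (ler_normD _ _))// lerD// linfty_norm_ub.
Qed.

Lemma linfty_normZ_le (a : R) (f : linfty) :
  linfty_norm (a *: f) <= `|a| * linfty_norm f.
Proof.
apply: linfty_norm_le => [|i]; first by rewrite mulr_ge0// linfty_norm_ge0.
by rewrite normrM ler_wpM2l// linfty_norm_ub.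
Qed.

Lemma linfty_norm0_eq0 (f : linfty) : linfty_norm f = 0 -> f = 0.
Proof.
move=> f0; apply/val_inj/funext => i /=; apply/normr0_eq0/le_anti.
by rewrite normr_ge0 andbT -f0 linfty_norm_ub.
Qed.

Lemma linfty_normZ (a : R) (f : linfty) :
  linfty_norm (a *: f) = `|a| * linfty_norm f.
Proof.
apply/le_anti; rewrite linfty_normZ_le /=.
have [->|a0] := eqVneq a 0; first by rewrite normr0 mul0r linfty_norm_ge0.
rewrite -[in leLHS](scale1r f) -(mulVf a0) -scalerA.
rewrite -ler_pdivlMl ?normr_gt0// -normfV.
exact: linfty_normZ_le.
Qed.

HB.instance Definition _ := Lmodule_isNormed.Build R linfty
  linfty_normD linfty_normZ linfty_norm0_eq0.

End linfty.

Definition inner_probability (R : realType) d (T : measurableType d)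
    (P : probability T R) (A : set T) : \bar R :=
  ereal_sup [set P B | B in [set B | measurable B /\ B `<=` A]].

Definition enlargement (R : realType) (E : normedModType R)
    (K : set E) (eta : R) : set E := \bigcup_(k in K) ball k eta.

Definition asymptotically_tight (R : realType) (E : normedModType R)
    (d : nat -> measure_display) (T : forall n, measurableType (d n))
    (P : forall n, probability (T n) R) (Z : forall n, T n -> E) : Prop :=
  forall eps : R, 0 < eps ->
  exists2 K : set E, compact K &
  forall eta : R, 0 < eta ->
  ((1 - eps)%:E <=
     limn_einf (fun n =>
       inner_probability (P n) (Z n @^-1` enlargement K eta)))%E.

(* X is indexed by I, but only the variables X i with D i are concerned. *)
Definition mutually_independent (R : realType) d (T : measurableType d)
    (P : probability T R) (I : choiceType) (D : set I)
    (X : I -> {RV P >-> R}) : Prop :=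
  forall (J : seq I) (B : I -> set R),
    uniq J -> (forall i, i \in J -> D i) -> (forall i, measurable (B i)) ->
    P (\bigcap_(i in [set` J]) X i @^-1` B i) =
    (\prod_(i <- J) P (X i @^-1` B i))%E.

Definition psd (R : realType) p (A : 'M[R]_p) : Prop :=
  A^T = A /\ forall v : 'cV[R]_p, 0 <= (v^T *m A *m v) 0 0.

(* The positive semidefinite square root of A is unique. *)
Definition psd_sqrt (R : realType) p (S A : 'M[R]_p) : Prop :=
  psd S /\ S *m S = A.

(* Extended-real valued, so that for p = 0 these are +oo and -oo and do not
   contribute to an infimum, respectively a supremum. *)
Definition lambda_min (R : realType) p (A : 'M[R]_p) : \bar R :=
  ereal_inf [set a%:E | a in [set a : R | eigenvalue A a]].

Definition lambda_max (R : realType) p (A : 'M[R]_p) : \bar R :=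
  ereal_sup [set a%:E | a in [set a : R | eigenvalue A a]].

(* Samples are indexed by nat, and only the indices 1, ..., n are used.
   The conventions ln x = 0 for x <= 0 and x / 0 = 0 make everything total. *)

Section statistics.
Context (R : realType) (p n : nat) (y : nat -> 'cV[R]_p).

Definition scov (i j : nat) : 'M[R]_p :=
  (j.+1 - i)%:R^-1 *: \sum_(i <= k < j.+1) (y k *m (y k)^T).

(* For t >= 0, Num.truncn is the floor. *)
Definition floor_nt (t : R) : nat := Num.truncn (n%:R * t).

Definition LR (t : R) : R :=
  let m := floor_nt t in
  (\det (scov 1 m)) `^ (m%:R / 2) * (\det (scov m.+1 n)) `^ ((n - m)%:R / 2)
  / (\det (scov 1 n)) `^ (n%:R / 2).

Definition smean : 'cV[R]_p := n%:R^-1 *: \sum_(1 <= k < n.+1) y k.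

Definition scov_cen : 'M[R]_p :=
  (n%:R - 1)^-1 *: \sum_(1 <= k < n.+1) ((y k - smean) *m (y k - smean)^T).

Definition sqnorm2 (v : 'cV[R]_p) : R := \sum_(j < p) v j 0 ^+ 2.

Definition tau_hat : R :=
  \tr (scov_cen *m scov_cen) - n%:R^-1 * (\tr scov_cen) ^+ 2.

Definition nu_hat : R :=
  (n%:R - 1)^-1 * \sum_(1 <= i < n.+1)
    (sqnorm2 (y i - smean)
     - n%:R^-1 * \sum_(1 <= i' < n.+1) sqnorm2 (y i' - smean)) ^+ 2.

Definition omega_hat : R :=
  \sum_(j < p) (n%:R^-1 * \sum_(1 <= i < n.+1)
    (y i j 0 - n%:R^-1 * \sum_(1 <= i' < n.+1) y i' j 0) ^+ 2) ^+ 2.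

Definition kappa_hat : R :=
  Num.max (3 + (nu_hat - 2 * tau_hat) / omega_hat) 1.

Definition centering (t : R) : R :=
  let N : R := n%:R in
  let m : R := (floor_nt t)%:R in
  let q : R := p%:R in
  N * (N - q - 1 / 2) * ln (1 - q / N)
  - m * (m - q - 1 / 2) * ln (1 - q / m)
  - (N - m) * (N - m - q - 1 / 2) * ln (1 - q / (N - m))
  - (kappa_hat - 3) * q / 2.

Definition LR_process_fun (t0 : R) (t : `[t0, 1 - t0]%classic) : R :=
  (2 * ln (LR (\val t)) - centering (\val t)) / n%:R.

(* The process depends on t only through the integer floor_nt t, which is
   bounded by floor_nt (1 - t0). *)
Lemma LR_process_bounded (t0 : R) : @LR_process_fun t0 \in @linfty_pred _ R.
Proof.
pose g m : R := (2 * ln ((\det (scov 1 m)) `^ (m%:R / 2)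
    * (\det (scov m.+1 n)) `^ ((n - m)%:R / 2)
    / (\det (scov 1 n)) `^ (n%:R / 2))
  - (let N : R := n%:R in let q : R := p%:R in let m : R := m%:R in
     N * (N - q - 1 / 2) * ln (1 - q / N)
     - m * (m - q - 1 / 2) * ln (1 - q / m)
     - (N - m) * (N - m - q - 1 / 2) * ln (1 - q / (N - m))
     - (kappa_hat - 3) * q / 2)) / n%:R.
apply/linfty_predP; exists (\sum_(m < (floor_nt (1 - t0)).+1) `|g m|) => t.
have mt : (floor_nt (\val t) < (floor_nt (1 - t0)).+1)%N.
  rewrite ltnS; apply: le_truncn; apply: ler_wpM2l => //.
  have := set_valP t; rewrite /= in_itv /= => /andP[_]; exact.
rewrite (bigD1 (Ordinal mt)) //= -[leLHS]addr0.
by apply: lerD; [exact: lexx | exact: sumr_ge0].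
Qed.

Definition LR_process (t0 : R) : linfty `[t0, 1 - t0]%classic R :=
  Linfty (LR_process_bounded t0).

End statistics.

(* Main.v *)
Require Import Defs.
From HB Require Import structures.
From mathcomp Require Import all_boot all_order all_algebra.
From mathcomp Require Import all_classical all_reals all_analysis.
From mathcomp Require Import measurable_realfun ring lra zify.
Set Implicit Arguments.
Unset Strict Implicit.
Unset Printing Implicit Defensive.
Import Order.TTheory GRing.Theory Num.Theory.
Import numFieldNormedType.Exports.
Local Open Scope classical_set_scope.
Local Open Scope ring_scope.

(* Under H0 the psd square roots coincide, so Sigma cancels from the likelihood
   ratio: with m = floor(nt), the process is (m/n) G_m + ((n-m)/n) G'_(n-m) - G_n
   up to a vanishing remainder and the kappa-hat term, where G_m is the
   centred log-determinant of the Gram matrix of the first m columns of the array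
   and G' is the same for the columns in reversed order.  Gram-Schmidt on
   the rows turns the determinant into a product of quadratic forms
   b_i^T P_i b_i, P_i being the projection orthogonal to the rows before i.  Once
   the logarithms are truncated and their conditional means subtracted, what
   remains is a martingale in i, and its difference between m and m' has fourth
   moment O((|m - m'| / n)^2).  Dyadic chaining gives a 1/8-Hoelder modulus
   uniformly in n; sets of equi-Hoelder, equibounded functions are compact in
   the sup norm.  The kurtosis estimator only needs to be O_P(1), as its term
   enters the process through the factor p/(2n) and is constant in t. *)

(** * Gram-Schmidt projections and determinants *)

(** The logarithm is truncated because nothing controls the moments of ln(1 + xi) near xi = -1.
    Truncation is inactive off an event of probability O(1/n), since the p normalised forms xi have
    fourth moments O(1/n^2). Fourth moments are used because chaining needs an exponent of r = |m -
    m'|/n above 1; the fourth moment of a quadratic form needs eighth moments of the entries, and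
    delta > 4 provides them. Subtracting conditional means leaves their own increments to control: a
    Lipschitz bound gives only sqrt(r/n) per row, too much for p rows, whereas the second-order
    expansion of the logarithm at centred forms gives sqrt(r)/n. Chaining bounds the fourth power of
    an increment by a random multiple of sqrt(r), hence the exponent 1/8. No abstract conditional
    expectation is formed: a function F(w, w') of the past and of the current row is integrated over
    w' with w frozen, which independence of disjoint blocks of entries justifies. *)

Section gram_schmidt.
Context (R : realFieldType) (n : nat).
Implicit Types (P Q B : 'M[R]_n) (b v : 'cV[R]_n).

Definition qform B v : R := (v^T *m B *m v) 0 0.

Definition frobenius2 B : R := \sum_i \sum_j B i j ^+ 2.

Definition projector P : Prop := P^T = P /\ P *m P = P.

(** Since [0^-1 = 0], a degenerate step, with [qform P b = 0], leaves [P] unchanged; no rank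
    condition on the rows is therefore assumed. *)
Definition gs_step P b : 'M[R]_n :=
  P - (qform P b)^-1 *: (P *m b *m (P *m b)^T).

Fixpoint gs_proj P (b : nat -> 'cV[R]_n) (i : nat) : 'M[R]_n :=
  if i is i'.+1 then gs_step (gs_proj P b i') (b i') else P.

Lemma frobenius2E B : frobenius2 B = \tr (B *m B^T).
Proof.
rewrite /frobenius2 /mxtrace; apply: eq_bigr => i _; rewrite mxE.
by apply: eq_bigr => j _; rewrite mxE expr2.
Qed.

Lemma frobenius2_ge0 B : 0 <= frobenius2 B.
Proof. by do 2 (apply: sumr_ge0 => ? _); rewrite sqr_ge0. Qed.

Lemma frobenius2Z (a : R) B : frobenius2 (a *: B) = a ^+ 2 * frobenius2 B.
Proof.
rewrite /frobenius2 mulr_sumr; apply: eq_bigr => i _.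
by rewrite mulr_sumr; apply: eq_bigr => j _; rewrite mxE exprMn.
Qed.

Lemma frobenius2D_le B Q :
  frobenius2 (B + Q) <= 2 * frobenius2 B + 2 * frobenius2 Q.
Proof.
rewrite /frobenius2 !mulr_sumr -big_split /=; apply: ler_sum => i _.
rewrite !mulr_sumr -big_split /=; apply: ler_sum => j _; rewrite mxE.
by have := sqr_ge0 (B i j - Q i j); lra.
Qed.

Lemma qformB P Q v : qform (P - Q) v = qform P v - qform Q v.
Proof. by rewrite /qform mulmxBr mulmxBl !mxE. Qed.

Lemma qformZ (a : R) P v : qform (a *: P) v = a * qform P v.
Proof. by rewrite /qform -scalemxAr -scalemxAl mxE. Qed.

Lemma qformE B v : qform B v = \sum_i \sum_j B i j * (v i 0 * v j 0).
Proof.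
rewrite /qform mxE exchange_big /=; apply: eq_bigr => j _.
rewrite mxE mulr_suml; apply: eq_bigr => i _; rewrite mxE.
by ring.
Qed.

Lemma qform_proj P b : projector P -> qform P b = ((P *m b)^T *m (P *m b)) 0 0.
Proof.
by move=> [PT PP]; rewrite /qform trmx_mul PT -mulmxA -[in LHS]PP !mulmxA.
Qed.

Lemma norm2_ge0 v : 0 <= (v^T *m v) 0 0.
Proof.
by rewrite mxE; apply: sumr_ge0 => i _; rewrite mxE -expr2 sqr_ge0.
Qed.

Lemma norm2_eq0 v : (v^T *m v) 0 0 = 0 -> v = 0.
Proof.
rewrite mxE => /eqP; rewrite psumr_eq0 => [/allP v0|i _]; last first.
  by rewrite mxE -expr2 sqr_ge0.
apply/colP => i; rewrite mxE; have := v0 i; rewrite mem_index_enum => /(_ isT).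
by rewrite mxE mulf_eq0 orbb => /eqP.
Qed.

Lemma qform_proj_ge0 P b : projector P -> 0 <= qform P b.
Proof. by move=> Pp; rewrite qform_proj// norm2_ge0. Qed.

Lemma qform_proj_eq0 P b : projector P -> qform P b = 0 -> P *m b = 0.
Proof. by move=> Pp; rewrite qform_proj// => /norm2_eq0. Qed.

Lemma mul_col_scalar (u : 'cV[R]_n) (v w : 'cV[R]_n) :
  u *m (v^T *m w) = (v^T *m w) 0 0 *: u.
Proof. by rewrite {1}[v^T *m w]mx11_scalar mul_mx_scalar. Qed.

Lemma gs_step_proj P b : projector P -> projector (gs_step P b).
Proof.
move=> Pp; have [PT PP] := Pp; split.
  by rewrite /gs_step linearB /= linearZ /= trmx_mul trmxK PT.
have := qform_proj b Pp; rewrite /gs_step.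
have Pu : P *m (P *m b) = P *m b by rewrite mulmxA PP.
move: (P *m b) Pu => u Pu qu.
have uP : u^T *m P = u^T by rewrite -{1}PT -trmx_mul Pu.
rewrite mulmxBl !mulmxBr PP -!scalemxAl -!scalemxAr -!mulmxA uP.
rewrite (mulmxA P) Pu (mulmxA u^T) (mulmxA u) mul_col_scalar -qu.
rewrite -scalemxAl !scalerA.
have [->|q0] := eqVneq (qform P b) 0.
  by rewrite invr0 !mul0r !scale0r !subr0.
by rewrite mulfVK// subrr subr0.
Qed.

Lemma gs_step_trace P b : projector P ->
  \tr (gs_step P b) = \tr P - (qform P b != 0)%:R.
Proof.
move=> Pp; rewrite /gs_step linearB /= linearZ /= mxtrace_mulC.
rewrite [\tr (_^T *m _)]/mxtrace big_ord1 -qform_proj//.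
by case: eqVneq => [->|q0]; rewrite ?mulr0// mulVf.
Qed.

Lemma gs_step_mul P b : projector P -> P *m gs_step P b = gs_step P b.
Proof.
by move=> [PT PP]; rewrite /gs_step mulmxBr PP -scalemxAr !mulmxA PP.
Qed.

Lemma gs_step_kill P b : projector P -> gs_step P b *m b = 0.
Proof.
move=> Pp; have [PT PP] := Pp; rewrite /gs_step mulmxBl -scalemxAl.
have [q0|q0] := eqVneq (qform P b) 0.
  by rewrite qform_proj_eq0// mul0mx mul0mx scaler0 subr0.
have -> : P *m b *m (P *m b)^T *m b = qform P b *: (P *m b).
  rewrite -mulmxA trmx_mul PT -[_ *m P *m b]mulmxA mul_col_scalar.
  by rewrite /qform mulmxA.
by rewrite scalerA mulVf// scale1r subrr.
Qed.

Lemma projector_tr_mul P Q : projector P -> projector Q -> Q *m P = P ->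
  P *m Q = P.
Proof. by move=> [PT _] [QT _] QP; rewrite -{1}PT -{1}QT -trmx_mul QP. Qed.

Lemma projectorB P Q : projector P -> projector Q -> Q *m P = P ->
  projector (Q - P).
Proof.
move=> Pp Qp QP; have PQ := projector_tr_mul Pp Qp QP.
have [[PT PP] [QT QQ]] := (Pp, Qp); split; first by rewrite linearB /= PT QT.
by rewrite mulmxBl !mulmxBr QQ QP PP PQ subrr subr0.
Qed.

(** [Q *m P = P] says that the range of [P] lies in that of [Q]. The range of [gs_step P b] is
    moreover orthogonal to [b], so the rank-one correction of [Q] vanishes on it. *)
Lemma gs_step_nested P Q b : projector P -> projector Q -> Q *m P = P ->
  gs_step Q b *m gs_step P b = gs_step P b.
Proof.
move=> Pp Qp QP; have [QT _] := Qp; have [GT _] := gs_step_proj b Pp.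
have QG : Q *m gs_step P b = gs_step P b.
  by rewrite -(gs_step_mul b Pp) mulmxA QP.
rewrite {1}/gs_step mulmxBl QG -scalemxAl -[_ *m _^T *m _]mulmxA.
rewrite trmx_mul QT -[_ *m Q *m _]mulmxA QG.
have -> : b^T *m gs_step P b = 0.
  by rewrite -GT -trmx_mul gs_step_kill// trmx0.
by rewrite mulmx0 scaler0 subr0.
Qed.

Lemma gs_proj_projector P (b : nat -> 'cV[R]_n) i : projector P ->
  projector (gs_proj P b i).
Proof. by move=> Pp; elim: i => //= i; exact: gs_step_proj. Qed.

Lemma gs_proj_nested P Q (b : nat -> 'cV[R]_n) i :
  projector P -> projector Q -> Q *m P = P ->
  gs_proj Q b i *m gs_proj P b i = gs_proj P b i.
Proof.
move=> Pp Qp QP; elim: i => //= i IH.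
by apply: gs_step_nested => //; exact: gs_proj_projector.
Qed.

(** The gap between the traces cannot grow: [Q - P] is a projector, so [qform P b <= qform Q b], and
    a step that lowers the trace of [P] by one also lowers that of [Q]. *)
Lemma gs_proj_traceB P Q (b : nat -> 'cV[R]_n) i :
  projector P -> projector Q -> Q *m P = P ->
  \tr (gs_proj Q b i) - \tr (gs_proj P b i) <= \tr Q - \tr P.
Proof.
move=> Pp Qp QP; elim: i => //= i; apply: le_trans.
have Pip := gs_proj_projector b i Pp; have Qip := gs_proj_projector b i Qp.
have QPi := gs_proj_nested b i Pp Qp QP.
rewrite !gs_step_trace//.
have := qform_proj_ge0 (b i) (projectorB Pip Qip QPi).
have := qform_proj_ge0 (b i) Pip; rewrite qformB.
by case: eqVneq => [->|Q0]; case: eqVneq => [|P0] //=; lra.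
Qed.

Lemma gs_proj_trace_le P (b : nat -> 'cV[R]_n) i :
  projector P -> \tr (gs_proj P b i) <= \tr P.
Proof.
move=> Pp; elim: i => //= i; apply: le_trans.
by rewrite gs_step_trace ?gerBl//; exact: gs_proj_projector.
Qed.

Lemma frobenius2_proj P : projector P -> frobenius2 P = \tr P.
Proof. by move=> [PT PP]; rewrite frobenius2E PT PP. Qed.

(** A difference of nested projectors is a projector, whose squared Frobenius norm is its trace. The
    bound does not depend on the vectors [b], hence is uniform in the randomness. *)
Lemma frobenius2_gs_projB P Q (b : nat -> 'cV[R]_n) i :
  projector P -> projector Q -> Q *m P = P ->
  frobenius2 (gs_proj Q b i - gs_proj P b i) <= \tr Q - \tr P.
Proof.
move=> Pp Qp QP; rewrite frobenius2_proj ?linearB /=.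
  exact: gs_proj_traceB.
by apply: projectorB; [exact: gs_proj_projector..|exact: gs_proj_nested].
Qed.

Lemma rank1_form (c : R) (u v w : 'cV[R]_n) :
  (u^T *m (c *: (w *m w^T)) *m v) 0 0 = c * (w^T *m u) 0 0 * (w^T *m v) 0 0.
Proof.
rewrite -scalemxAr -scalemxAl mxE mulmxA -mulmxA -mulrA; congr (_ * _).
have -> : (w^T *m u) 0 0 = (u^T *m w) 0 0.
  by rewrite -[u^T *m w]trmxK [RHS]mxE trmx_mul trmxK.
by rewrite mulmxA -(mulmxA _ _ v) [LHS]mxE big_ord1.
Qed.

Lemma gs_proj_sum P (b : nat -> 'cV[R]_n) i :
  P = gs_proj P b i + \sum_(k < i) (qform (gs_proj P b k) (b k))^-1 *:
    (gs_proj P b k *m b k *m (gs_proj P b k *m b k)^T).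
Proof.
elim: i => [|i IH]; first by rewrite big_ord0 addr0.
rewrite big_ord_recr /= {1}IH /gs_step [X in _ = _ + X]addrC addrA.
by rewrite subrK.
Qed.

(** Gram-Schmidt yields a factorisation L D L^T of the Gram matrix, with L unit lower triangular and
    D the diagonal of the [q k]. It survives degenerate steps, where the column of L below the
    diagonal is zero. *)
Lemma det_gs_proj p P (b : nat -> 'cV[R]_n) : projector P ->
  \det (\matrix_(i < p, j < n) b i j 0 *m P *m (\matrix_(i < p, j < n) b i j 0)^T)
  = \prod_(i < p) qform (gs_proj P b i) (b i).
Proof.
move=> Pp; set X := \matrix_(i, j) _.
pose q k := qform (gs_proj P b k) (b k).
pose Y k := gs_proj P b k *m b k.
have Pip k := gs_proj_projector b k Pp.
pose L : 'M[R]_p := \matrix_(i, k) if (k < i)%N then (q k)^-1 * ((Y k)^T *m b i) 0 0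
  else (k == i)%:R.
pose D : 'rV[R]_p := \row_k q k.
have XE i j : (X *m P *m X^T) i j = ((b i)^T *m P *m b j) 0 0.
  rewrite !mxE; apply: eq_bigr => k _; rewrite !mxE; congr (_ * _).
  by apply: eq_bigr => l _; rewrite !mxE.
have LDE i j : (L *m diag_mx D *m L^T) i j = \sum_k L i k * q k * L j k.
  rewrite mxE; apply: eq_bigr => k _; rewrite mul_mx_diag !mxE.
  by congr (_ * _).
have Yb k j : ((Y k)^T *m b j) 0 0 = ((b k)^T *m gs_proj P b k *m b j) 0 0.
  by rewrite /Y trmx_mul; have [-> _] := Pip k.
have main (i j : 'I_p) : (i <= j)%N ->
    ((b i)^T *m P *m b j) 0 0 = \sum_(k < p) L i k * q k * L j k.
  move=> ij; rewrite {1}(gs_proj_sum P b i) mulmxDr mulmxDl mxE.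
  rewrite (bigID (fun k : 'I_p => (k < i)%N)) /= addrC; congr (_ + _).
    rewrite mulmx_sumr mulmx_suml summxE.
    rewrite (big_ord_widen p (fun k : nat => ((b i)^T *m ((qform (gs_proj P b k) (b k))^-1
      *: (gs_proj P b k *m b k *m (gs_proj P b k *m b k)^T)) *m b j) 0 0)); last exact: ltnW.
    apply: eq_bigr => k ki; rewrite [L i k]mxE [L j k]mxE ki (leq_trans ki ij).
    rewrite rank1_form -/(q k) -/(Y k).
    have [->|q0] := eqVneq (q k) 0; first by rewrite invr0 !mul0r.
    by field.
  rewrite (bigD1 i) ?ltnn //= big1 ?addr0 => [|k /andP[ki kni]]; last first.
    by rewrite mxE (negbTE ki) (negbTE kni) !mul0r.
  rewrite [L i i]mxE [L j i]mxE ltnn eqxx mul1r Yb.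
  case: ltngtP ij => // [ij _|/val_inj <- _]; last by rewrite eqxx mulr1.
  (* If [q i = 0] then [gs_proj P b i *m b i = 0], so the remaining term vanishes as well. *)
  have [q0|q0] := eqVneq (q i) 0; last by rewrite mulrA mulfV// mul1r.
  by rewrite q0 mul0r -Yb /Y qform_proj_eq0// trmx0 mul0mx mxE.
have -> : X *m P *m X^T = L *m diag_mx D *m L^T.
  apply/matrixP => i j; rewrite XE LDE; have [ij|/ltnW ji] := leqP i j.
    exact: main.
  have [PT _] := Pp.
  have -> : (b i)^T *m P *m b j = ((b j)^T *m P *m b i)^T.
    by rewrite !trmx_mul trmxK PT mulmxA.
  by rewrite mxE main//; apply: eq_bigr => k _; ring.
rewrite !det_mulmx det_tr det_diag.
rewrite det_trig; last first.
  apply/is_trig_mxP => i j ij; rewrite mxE ltnNge ltnW//=.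
  by rewrite -val_eqE /= gtn_eqF.
rewrite big1 ?mul1r ?mulr1; last by move=> i _; rewrite mxE ltnn eqxx.
by apply: eq_bigr => i _; rewrite mxE.
Qed.

End gram_schmidt.

(** * Independence and moments *)

Section decoupling.
Context {R : realType} {d} {T : measurableType d} (P : probability T R).
Context {d1 d2} {S1 : measurableType d1} {S2 : measurableType d2}.
Variables (u : T -> S1) (v : T -> S2).
Hypotheses (mu : measurable_fun [set: T] u) (mv : measurable_fun [set: T] v).
Hypothesis uv : forall A B, measurable A -> measurable B ->
  P (u @^-1` A `&` v @^-1` B) = (P (u @^-1` A) * P (v @^-1` B))%E.

Let uM := isMeasurableFun.Build _ _ _ _ _ mu.
Let u' : {mfun T >-> S1} := HB.pack u uM.
Let vM := isMeasurableFun.Build _ _ _ _ _ mv.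
Let v' : {mfun T >-> S2} := HB.pack v vM.

Let muv : measurable_fun [set: T] (fun w => (u w, v w)).
Proof. exact/measurable_fun_pairP. Qed.
Let uvM := isMeasurableFun.Build _ _ _ _ _ muv.
Let uv' : {mfun T >-> (S1 * S2)%type} := HB.pack (fun w => (u w, v w)) uvM.

Local Open Scope ereal_scope.

Let prodE : forall X, measurable X ->
  (distribution P u' \x distribution P v') X = distribution P uv' X.
Proof.
by apply: product_measure_unique => A B mA mB; rewrite /distribution /= /pushforward -uv.
Qed.

(** By independence the law of the pair is the product law, and Tonelli applies. *)
Lemma decouple_ge0 (h : (S1 * S2)%type -> \bar R) :
  measurable_fun setT h -> (forall z, 0 <= h z) ->
  \int[P]_w h (u w, v w) = \int[P]_w \int[P]_w' h (u w, v w').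
Proof.
move=> mh h0.
rewrite -(ge0_integral_distribution uv' mh h0).
rewrite -(eq_measure_integral (distribution P uv') (fun A mA _ => prodE mA)).
rewrite fubini_tonelli1//.
rewrite ge0_integral_distribution//; last 2 first.
- exact: measurable_fun_fubini_tonelli_F.
- by move=> y; exact: integral_ge0.
apply: eq_integral => w _ /=; rewrite /fubini_F ge0_integral_distribution//.
exact/measurableT_comp.
Qed.

(** This plays the part of the tower property: a zero mean in [v] for every frozen value of [u]
    forces a zero mean, without a conditional expectation being defined. *)
Lemma decouple_eq0 (h : (S1 * S2)%type -> \bar R) :
  measurable_fun setT h -> P.-integrable setT (fun w => h (u w, v w)) ->
  (forall w, P.-integrable setT (fun w' => h (u w, v w'))) ->
  (forall w, \int[P]_w' h (u w, v w') = 0) ->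
  \int[P]_w h (u w, v w) = 0.
Proof.
move=> mh ih ih' h0.
rewrite -(integral_distribution (X := uv') mh ih).
rewrite -(eq_measure_integral (distribution P uv') (fun A mA _ => prodE mA)).
have ih2 : (distribution P u' \x distribution P v').-integrable setT h.
  apply/integrableP; split=> //.
  rewrite (eq_measure_integral (distribution P uv') (fun A mA _ => prodE mA)).
  rewrite ge0_integral_distribution//; last exact: measurableT_comp.
  by move/integrableP : ih => [].
rewrite -integral12_prod_meas1//.
have F0 w : (fubini_F (distribution P v') h \o u) w = 0.
  rewrite /= /fubini_F integral_distribution//.
  - exact: h0.
  - exact: measurableT_comp.
  - exact: ih'.
rewrite integral_distribution//=.
- by apply: integral0_eq => w _; exact: F0.
- exact: (measurable_fubini_F ih2).
- by apply: eq_integrable (integrable0 P setT) => // w _; rewrite F0.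
Qed.

Lemma measurable_decouple (h : (S1 * S2)%type -> \bar R) :
  measurable_fun setT h -> (forall z, 0 <= h z) ->
  measurable_fun [set: S1] (fun s => \int[P]_w h (s, v w)).
Proof.
move=> mh h0.
have := @measurable_fun_fubini_tonelli_F _ _ _ _ _ (distribution P v') h mh h0.
congr (measurable_fun _ _); apply/funext => s; rewrite /fubini_F.
by rewrite ge0_integral_distribution//; exact/measurableT_comp.
Qed.

End decoupling.

(** * Independence of sigma-algebras generated by disjoint blocks *)

Section independent_sigma_algebras.
Context {R : realType} {d} {T : measurableType d} (P : probability T R).

(** Dynkin's argument: the events independent of [A] form a lambda-system, and [G] is a
    pi-system. *)
Lemma independent_g_sigma_algebra_r (A : set T) (G : set_system T) :
  measurable A -> G `<=` measurable -> setI_closed G ->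
  (forall B, G B -> P (A `&` B) = P A * P B)%E ->
  forall B, <<s G >> B -> P (A `&` B) = (P A * P B)%E.
Proof.
move=> mA mG GI GP.
have Gm B : <<s G >> B -> measurable B.
  by apply: smallest_sub => //; exact: sigma_algebra_measurable.
suff : <<s G >> `<=` [set B | measurable B /\ P (A `&` B) = (P A * P B)%E].
  by move=> H B /H[].
apply: lambda_system_subset => //; last first.
  by move=> B GB; split; [exact: mG|exact: GP].
apply/dynkin_lambda_system; split.
- by split => //; rewrite setIT probability_setT mule1.
- move=> B [mB PB]; split; first exact: measurableC.
  rewrite probability_setC// -setDE measureD//; last by rewrite -ge0_fin_numE// fin_num_measure.
  rewrite muleBr ?mule1//; last exact: fin_num_measure.
  by congr (_ - _)%E.
- move=> F tF FP; have mF n : measurable (F n) by have [] := FP n.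
  split; first exact: bigcupT_measurable.
  rewrite setI_bigcupr measure_semi_bigcup//; last 3 first.
  + by move=> n; exact: measurableI.
  + exact: trivIset_setIl.
  + by rewrite -setI_bigcupr; apply: measurableI => //; exact: bigcupT_measurable.
  rewrite measure_semi_bigcup//; last exact: bigcupT_measurable.
  have PAf : P A \is a fin_num by exact: fin_num_measure.
  rewrite -[X in (X * _)%E](fineK PAf) -nneseriesZl//.
  apply: eq_eseriesr => n _; rewrite fineK//.
  by have [] := FP n.
Qed.

Context {I : choiceType} (D : set I) (x : I -> {RV P >-> R}).
Hypothesis indep : mutually_independent D x.

Definition events_of (J : set I) : set_system T :=
  [set A | exists2 a, J a & exists2 B, measurable B & A = x a @^-1` B].

(** The one-variable events of [events_of] are not stable under intersection; these finite
    intersections form a pi-system generating the same sigma-algebra. *)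
Definition cylinders (J : set I) : set_system T :=
  [set A | exists s : seq I, exists B : I -> set R,
    [/\ uniq s, (forall i, i \in s -> J i), (forall i, measurable (B i)) &
        A = \bigcap_(i in [set` s]) x i @^-1` B i]].

Lemma cylindersE (J : set I) : <<s cylinders J >> = <<s events_of J >>.
Proof.
apply/seteqP; split; apply: smallest_sub; try exact: smallest_sigma_algebra.
  move=> _ [s [B [us sJ mB ->]]].
  apply: (@fin_bigcap_measurable _ (g_sigma_algebraType (events_of J))) => //.
  by move=> i /= /sJ Ji; apply: sub_sigma_algebra; exists i => //; exists (B i).
move=> _ [a Ja [B mB ->]]; apply: sub_sigma_algebra.
exists [:: a], (fun=> B); split => //.
  by move=> i; rewrite inE => /eqP ->.
by rewrite set_cons1 bigcap_set1.
Qed.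

Lemma cylinders_setI (J : set I) : setI_closed (cylinders J).
Proof.
move=> _ _ [s [B [us sJ mB ->]]] [s' [B' [us' sJ' mB' ->]]].
exists (undup (s ++ s')), (fun i => (if i \in s then B i else setT) `&`
   (if i \in s' then B' i else setT)); split.
- exact: undup_uniq.
- by move=> i; rewrite mem_undup mem_cat => /orP[/sJ|/sJ'].
- by move=> i; apply: measurableI; case: ifP.
- apply/seteqP; split => w /=.
    move=> [Hs Hs'] i /=; rewrite mem_undup mem_cat => is_.
    by split; case: ifPn => // ii; [exact: Hs|exact: Hs'].
  move=> H; split => i /= ii; have := H i; rewrite /= mem_undup mem_cat ii ?orbT.
    by case/(_ isT).
  by case/(_ isT).
Qed.

Lemma cylinders_measurable (J : set I) : cylinders J `<=` measurable.
Proof.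
move=> _ [s [B [us sJ mB ->]]].
by apply: fin_bigcap_measurable => // i _; rewrite -[X in measurable X]setTI; exact: measurable_funP.
Qed.

Lemma cylinders_indep (J J' : set I) : J `<=` D -> J' `<=` D ->
  J `&` J' = set0 -> forall A A', cylinders J A -> cylinders J' A' ->
  P (A `&` A') = (P A * P A')%E.
Proof.
move=> JD JD' JJ' _ _ [s [B [us sJ mB ->]]] [s' [B' [us' sJ' mB' ->]]].
have disj i : i \in s -> i \in s' -> False.
  by move=> /sJ Ji /sJ' J'i; have : (J `&` J') i by []; rewrite JJ'.
pose C i := if i \in s then B i else B' i.
have mC i : measurable (C i) by rewrite /C; case: ifP.
have -> : \bigcap_(i in [set` s]) x i @^-1` B i `&`
    \bigcap_(i in [set` s']) x i @^-1` B' i =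
    \bigcap_(i in [set` s ++ s']) x i @^-1` C i.
  apply/seteqP; split => w /=.
    move=> [H H'] i /=; rewrite mem_cat /C; case: ifPn => [ii _|_ /= ii].
      exact: H.
    exact: H'.
  move=> H; split => i /= ii; have := H i; rewrite /= mem_cat ii ?orbT /C.
    by rewrite ii; exact.
  by case: ifPn => [/disj /(_ ii)//|_]; exact.
rewrite indep//; last 2 first.
- rewrite cat_uniq us us' andbT /=; apply/hasPn => i ii'; apply/negP => ii.
  exact: (disj i).
- by move=> i; rewrite mem_cat => /orP[/sJ /JD|/sJ' /JD'].
rewrite big_cat /= indep//; last by move=> i /sJ /JD.
rewrite [X in _ = (_ * X)%E]indep//; last by move=> i /sJ' /JD'.
congr (_ * _)%E; apply: eq_big_seq => i ii; rewrite /C ?ii//.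
by case: ifPn => // /disj /(_ ii).
Qed.

(** The pi-lambda argument is applied twice, freeing one of the two events at a time. *)
Lemma sigma_indep (J J' : set I) : J `<=` D -> J' `<=` D ->
  J `&` J' = set0 -> forall A A', <<s events_of J >> A ->
  <<s events_of J' >> A' -> P (A `&` A') = (P A * P A')%E.
Proof.
move=> JD JD' JJ' A A'; rewrite -!cylindersE => sA sA'.
have mA' : measurable A'.
  move: A' sA'; apply: smallest_sub; first exact: sigma_algebra_measurable.
  exact: cylinders_measurable.
rewrite setIC muleC; apply: (independent_g_sigma_algebra_r mA') sA.
- exact: cylinders_measurable.
- exact: cylinders_setI.
move=> B cB; rewrite setIC muleC.
apply: (independent_g_sigma_algebra_r _ _ _ _ sA').
- exact: (cylinders_measurable cB).
- exact: cylinders_measurable.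
- exact: cylinders_setI.
- by move=> B' cB'; exact: (cylinders_indep JD JD').
Qed.

End independent_sigma_algebras.

Ltac mfun := repeat first
  [ assumption
  | exact: measurable_cst
  | apply: measurable_funX
  | apply: measurable_funM
  | apply: measurable_funB
  | apply: measurable_funD
  | apply: measurable_funN
  | apply: measurable_sum => ? ].

Ltac nneg := repeat first
  [ done | exact: ler0n | by apply: exprn_even_ge0 | by apply: sqr_ge0 | exact: normr_ge0
  | apply: addr_ge0 | apply: mulr_ge0 | apply: sumr_ge0 => ? _
  | by apply: ltW | by apply: invr_ge0; apply: ltW | apply: exprn_ge0 ].

Lemma sqr_le (R : realDomainType) (a b : R) : 0 <= a -> a <= b -> a ^+ 2 <= b ^+ 2.
Proof. by move=> a0 ab; rewrite ler_sqr// nnegrE// (le_trans a0). Qed.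

(** * Moment inequalities phrased as upper bounds of integrals *)

Section expectation_bounds.
Context {R : realType} {d} {T : measurableType d} (P : probability T R).
Implicit Types f g : T -> R.

Lemma int_le (f g : T -> R) (c : R) :
  measurable_fun setT f -> measurable_fun setT g ->
  (forall w, 0 <= f w) -> (forall w, f w <= g w) ->
  (\int[P]_w (g w)%:E <= c%:E -> \int[P]_w (f w)%:E <= c%:E)%E.
Proof.
move=> mf mg f0 fg; apply: le_trans; apply: ge0_le_integral => //.
- by move=> w _; rewrite lee_fin.
- exact/measurable_EFinP.
- exact/measurable_EFinP.
- by move=> w _; rewrite lee_fin.
Qed.

Lemma int_addle (f g : T -> R) (a b : R) :
  measurable_fun setT f -> measurable_fun setT g ->
  (forall w, 0 <= f w) -> (forall w, 0 <= g w) ->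
  (\int[P]_w (f w)%:E <= a%:E -> \int[P]_w (g w)%:E <= b%:E ->
   \int[P]_w (f w + g w)%:E <= (a + b)%:E)%E.
Proof.
move=> mf mg f0 g0 fa gb.
under eq_integral do rewrite EFinD.
rewrite ge0_integralD//; first by rewrite EFinD leeD.
- by move=> w _; rewrite lee_fin.
- exact/measurable_EFinP.
- by move=> w _; rewrite lee_fin.
- exact/measurable_EFinP.
Qed.

Lemma int_scalele (k : R) (f : T -> R) (a : R) :
  measurable_fun setT f -> (forall w, 0 <= f w) -> 0 <= k ->
  (\int[P]_w (f w)%:E <= a%:E ->
   \int[P]_w (k * f w)%:E <= (k * a)%:E)%E.
Proof.
move=> mf f0 k0 fa.
under eq_integral do rewrite EFinM.
rewrite ge0_integralZl_EFin//; first by rewrite EFinM lee_wpmul2l// lee_fin.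
- by move=> w _; rewrite lee_fin.
- exact/measurable_EFinP.
Qed.

Lemma int_sumle (I : Type) (s : seq I) (f : I -> T -> R) (a : I -> R) :
  (forall i, measurable_fun setT (f i)) -> (forall i w, 0 <= f i w) ->
  (forall i, \int[P]_w (f i w)%:E <= (a i)%:E)%E ->
  (\int[P]_w (\sum_(i <- s) f i w)%:E <= (\sum_(i <- s) a i)%:E)%E.
Proof.
move=> mf f0 fa; elim: s => [|i s IH].
  under eq_integral do rewrite big_nil.
  by rewrite big_nil integral0.
under eq_integral do rewrite big_cons.
rewrite big_cons; apply: int_addle => //.
- exact: measurable_sum.
- by move=> w; apply: sumr_ge0 => ? _.
Qed.

Lemma int_cstE (a : R) : (\int[P]_w a%:E = a%:E)%E.
Proof. by rewrite integral_cst//= probability_setT mule1. Qed.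

Lemma integrable_bound (f g : T -> R) (c : R) :
  measurable_fun setT f -> measurable_fun setT g ->
  (forall w, `|f w| <= g w) -> (\int[P]_w (g w)%:E <= c%:E)%E ->
  P.-integrable setT (EFin \o f).
Proof.
move=> mf mg fg gc; apply/integrableP; split; first exact/measurable_EFinP.
apply: le_lt_trans (ltry c); apply: le_trans gc.
apply: ge0_le_integral => //.
- exact/measurable_EFinP/measurableT_comp.
- exact/measurable_EFinP.
- by move=> w _; rewrite lee_fin.
Qed.

Lemma integrable_L4 (f : T -> R) (c : R) : measurable_fun setT f ->
  (\int[P]_w (f w ^+ 4)%:E <= c%:E)%E -> P.-integrable setT (EFin \o f).
Proof.
move=> mf fc; apply: (@integrable_bound _ (fun w => 1 + f w ^+ 4) (1 + c)) => //.
- by mfun.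
- move=> w; have := sqr_ge0 (f w ^+ 2 - 1); have := sqr_ge0 (f w - 1).
  by have := sqr_ge0 (f w + 1); rewrite ler_norml; nra.
- apply: int_addle => //; [by mfun| | by rewrite int_cstE].
  by move=> w; nneg.
Qed.

Lemma integrable_cube (S X : T -> R) (a b : R) :
  measurable_fun setT S -> measurable_fun setT X ->
  (\int[P]_w (S w ^+ 4)%:E <= a%:E)%E -> (\int[P]_w (X w ^+ 4)%:E <= b%:E)%E ->
  P.-integrable setT (EFin \o (fun w => S w ^+ 3 * X w)).
Proof.
move=> mS mX Sa Xb.
apply: (@integrable_bound _ (fun w => S w ^+ 4 + X w ^+ 4) (a + b)).
- by mfun.
- by mfun.
- move=> w; move: (S w) (X w) => s t.
  have := sqr_ge0 (s ^+ 2 - t ^+ 2); have := sqr_ge0 (s ^+ 2 - s * t).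
  have := sqr_ge0 (s ^+ 2 + s * t); have := sqr_ge0 (t ^+ 2).
  have := sqr_ge0 (s ^+ 2).
  by rewrite ler_norml; nra.
- by apply: int_addle => //; [mfun|mfun|move=> w; nneg|move=> w; nneg].
Qed.

Lemma amgm_sqr (a b t : R) : 0 < t -> 2 * (a * b) <= t * a ^+ 2 + t^-1 * b ^+ 2.
Proof.
move=> t0; have tn : t != 0 by rewrite gt_eqF.
have -> : t * a ^+ 2 + t^-1 * b ^+ 2 = t^-1 * (t * a - b) ^+ 2 + 2 * (a * b).
  by field.
by rewrite lerDr mulr_ge0 ?sqr_ge0// invr_ge0 ltW.
Qed.

(** The infimum over t of t s^2 + e^2 / t is 2 s e, formally reached at t = e / s. As [s] or [e] may
    vanish, both are shifted by a small [h]. *)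
Lemma le_of_amgm (X s e : R) : 0 <= s -> 0 <= e ->
  (forall t, 0 < t -> X <= t * s ^+ 2 + t^-1 * e ^+ 2) -> X <= 2 * (s * e).
Proof.
move=> s0 e0 H; apply/ler_addgt0Pr => k k0.
(* With this [h], the value at t = (e + h) / (s + h) is at most 2 s e + h (s + e), which is within
   [k] of the target. *)
pose h := k / (s + e + 1).
have se0 : 0 < s + e + 1 by lra.
have h0 : 0 < h by rewrite divr_gt0.
have sh0 : 0 < s + h by lra.
have eh0 : 0 < e + h by lra.
apply: le_trans (H ((e + h) / (s + h)) _) _; first by rewrite divr_gt0.
have H1 : (e + h) / (s + h) * s ^+ 2 <= (e + h) * s.
  rewrite -mulrA; apply: ler_wpM2l; first exact: ltW.
  rewrite mulrC ler_pdivrMr//.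
  by rewrite expr2 ler_wpM2l// lerDl ltW.
have H2 : ((e + h) / (s + h))^-1 * e ^+ 2 <= (s + h) * e.
  rewrite invf_div -mulrA; apply: ler_wpM2l; first exact: ltW.
  rewrite mulrC ler_pdivrMr//.
  by rewrite expr2 ler_wpM2l// lerDl ltW.
have : h * (s + e + 1) = k by rewrite /h divfK// gt_eqF.
by nra.
Qed.

(** Cauchy-Schwarz for bounds of the second moments: the inequality of [amgm_sqr] is integrated for
    each t, then optimised by [le_of_amgm]. *)
Lemma int_cauchy (f g : T -> R) (s e : R) :
  measurable_fun setT f -> measurable_fun setT g -> 0 <= s -> 0 <= e ->
  (forall w, 0 <= f w * g w) ->
  (\int[P]_w (f w ^+ 2)%:E <= (s ^+ 2)%:E ->
   \int[P]_w (g w ^+ 2)%:E <= (e ^+ 2)%:E ->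
   \int[P]_w (f w * g w)%:E <= (s * e)%:E)%E.
Proof.
move=> mf mg s0 e0 fg0 fs ge.
have H t : 0 < t ->
    (\int[P]_w (2 * (f w * g w))%:E <= (t * s ^+ 2 + t^-1 * e ^+ 2)%:E)%E.
  move=> t0; apply: (@int_le _ (fun w => t * f w ^+ 2 + t^-1 * g w ^+ 2)).
  - by mfun.
  - by mfun.
  - by move=> w; rewrite mulr_ge0.
  - by move=> w; exact: amgm_sqr.
  - apply: int_addle; try by mfun.
    + by move=> w; rewrite mulr_ge0 ?sqr_ge0// ltW.
    + by move=> w; rewrite mulr_ge0 ?sqr_ge0// invr_ge0 ltW.
    + by apply: int_scalele => //; [mfun | move=> w; rewrite sqr_ge0 | exact: ltW].
    + apply: int_scalele => //; [by mfun | by move=> w; rewrite sqr_ge0 |].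
      by rewrite invr_ge0 ltW.
have I0 : (0 <= \int[P]_w (2 * (f w * g w))%:E)%E.
  by apply: integral_ge0 => w _; rewrite lee_fin mulr_ge0.
have If : (\int[P]_w (2 * (f w * g w))%:E)%E \is a fin_num.
  by rewrite ge0_fin_numE//; apply: le_lt_trans (H 1 ltr01) (ltry _).
have -> : (\int[P]_w (f w * g w)%:E = \int[P]_w (2^-1 * (2 * (f w * g w)))%:E)%E.
  by apply: eq_integral => w _; rewrite mulKf.
rewrite -[s * e](mulKf (x := 2)) //.
apply: int_scalele => //; [by mfun | by move=> w; rewrite mulr_ge0 |].
rewrite -(fineK If) lee_fin; apply: le_of_amgm => // t t0.
by rewrite -lee_fin fineK// H.
Qed.

(* The fourth-moment substitute for orthogonality in L2: sqrt(E(.)^4) is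
   subadditive up to the constant 4 when E S^3 D = 0. *)
Lemma L4_add (S D : T -> R) (s e : R) :
  measurable_fun setT S -> measurable_fun setT D -> 0 <= s -> 0 <= e ->
  (\int[P]_w (S w ^+ 4)%:E <= (s ^+ 2)%:E ->
   \int[P]_w (D w ^+ 4)%:E <= (e ^+ 2)%:E ->
   \int[P]_w (S w ^+ 3 * D w)%:E = 0 ->
   \int[P]_w ((S w + D w) ^+ 4)%:E <= ((s + 4 * e) ^+ 2)%:E)%E.
Proof.
move=> mS mD s0 e0 HS HD HSD.
(* In the expansion of (S + D)^4 the term 4 S D^3 is at most 2 S^2 D^2 + 2 D^4; only the cubic term,
   of mean zero, is kept apart from [g]. The bound s^2 + 8 s e + 3 e^2 is then below (s + 4 e)^2. *)
pose g w := S w ^+ 4 + (8 * (S w ^+ 2 * D w ^+ 2) + 3 * D w ^+ 4).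
have mg : measurable_fun setT g by rewrite /g; mfun.
have g0 w : 0 <= g w.
  by rewrite /g; nneg.
have gb : (\int[P]_w (g w)%:E <= (s ^+ 2 + (8 * (s * e) + 3 * e ^+ 2))%:E)%E.
  have p4 (u : T -> R) w : 0 <= u w ^+ 4 by nneg.
  have q w : 0 <= S w ^+ 2 * D w ^+ 2 by rewrite mulr_ge0 ?sqr_ge0.
  apply: int_addle => //; [by mfun | by mfun | |].
    by move=> w; nneg.
  apply: int_addle => //; [by mfun | by mfun | | | |].
  - by move=> w; nneg.
  - by move=> w; nneg.
  - apply: int_scalele => //; first by mfun.
    apply: int_cauchy => //; [by mfun | by mfun | |].
      by under eq_integral do rewrite -exprM.
    by under eq_integral do rewrite -exprM.
  - by apply: int_scalele => //; mfun.
have ih : P.-integrable setT (EFin \o (fun w => S w ^+ 3 * D w)).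
  exact: integrable_cube HS HD.
have ih4 : P.-integrable setT (EFin \o (fun w => 4 * (S w ^+ 3 * D w))).
  by have := integrableZl measurableT 4 ih.
have ig : P.-integrable setT (EFin \o g).
  by apply: (@integrable_bound _ g) gb => // w; rewrite ger0_norm.
apply: (@le_trans _ _ (\int[P]_w (g w + 4 * (S w ^+ 3 * D w))%:E)%E).
  have pw w : (S w + D w) ^+ 4 <= g w + 4 * (S w ^+ 3 * D w).
    rewrite /g -subr_ge0.
    have -> : S w ^+ 4 + (8 * (S w ^+ 2 * D w ^+ 2) + 3 * D w ^+ 4) +
      4 * (S w ^+ 3 * D w) - (S w + D w) ^+ 4 = 2 * (S w * D w - D w ^+ 2) ^+ 2.
      by ring.
    by rewrite mulr_ge0 ?sqr_ge0.
  apply: ge0_le_integral => //.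
  - by move=> w _; rewrite lee_fin exprn_even_ge0.
  - by apply/measurable_EFinP; mfun.
  - by apply/measurable_EFinP; mfun.
  - by move=> w _; rewrite lee_fin.
under eq_integral do rewrite EFinD.
rewrite integralD//.
have -> : (\int[P]_w (4 * (S w ^+ 3 * D w))%:E = 0)%E.
  under eq_integral do rewrite EFinM.
  by rewrite integralZl// HSD mule0.
rewrite adde0; apply: le_trans gb _; rewrite lee_fin.
by nra.
Qed.

End expectation_bounds.

(** * Functions of disjoint blocks of variables *)

Section moments.
Context {R : realType} {d} {T : measurableType d} (P : probability T R).

Context {I : choiceType} (D : set I) (x : I -> {RV P >-> R}).
Hypothesis indep : mutually_independent D x.

Definition adapted (J : set I) (f : T -> R) : Prop :=
  @measurable_fun _ _ (g_sigma_algebraType (events_of x J)) _ setT f.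

Lemma adapted_rv (J : set I) a : J a -> adapted J (x a).
Proof.
move=> Ja; move=> _ B mB; rewrite setTI; apply: sub_sigma_algebra.
by exists a => //; exists B.
Qed.

Lemma events_of_measurable (J : set I) : <<s events_of x J >> `<=` measurable.
Proof.
apply: smallest_sub; first exact: sigma_algebra_measurable.
move=> _ [a _ [B mB ->]]; rewrite -[X in measurable X]setTI.
exact: measurable_funP.
Qed.

Lemma measurable_to_events (J : set I) :
  measurable_fun setT (id : T -> g_sigma_algebraType (events_of x J)).
Proof. by move=> _ B mB; rewrite setTI; exact: events_of_measurable mB. Qed.

Lemma adapted_measurable (J : set I) f : adapted J f -> measurable_fun setT f.
Proof.
by move=> af; exact: (@measurableT_comp _ _ _ T (g_sigma_algebraType _) _
  f _ id af (measurable_to_events (J := J))).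
Qed.

Lemma adapted_sub (J J' : set I) f : J `<=` J' -> adapted J f -> adapted J' f.
Proof.
move=> JJ' af _ B mB; have := af measurableT B mB.
apply: sub_sigma_algebra2 => _ [a Ja [C mC ->]].
by exists a; [exact: JJ'|exists C].
Qed.

Section two_blocks.
Variables J J' : set I.
Hypotheses (JD : J `<=` D) (JD' : J' `<=` D) (JJ' : J `&` J' = set0).
Let S : measurableType _ := g_sigma_algebraType (events_of x J).
Let S' : measurableType _ := g_sigma_algebraType (events_of x J').

Let idS : T -> S := id.
Let idS' : T -> S' := id.

Let indepS (A : set S) (B : set S') : measurable A -> measurable B ->
  P (idS @^-1` A `&` idS' @^-1` B) = (P (idS @^-1` A) * P (idS' @^-1` B))%E.
Proof. exact: (sigma_indep indep). Qed.

(** Decoupling with both maps the identity of [T], seen with the sigma-algebras of two disjoint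
    blocks. In [h (w, w')] the variables of [J] are read off [w] and those of [J'] off [w']. *)
Lemma blocks_ge0 (h : (S * S')%type -> \bar R) :
  measurable_fun setT h -> (forall z, (0 <= h z)%E) ->
  (\int[P]_w h (w, w) = \int[P]_w \int[P]_w' h (w, w'))%E.
Proof.
by move=> mh h0; exact: (@decouple_ge0 _ _ _ P _ _ S S' id id
  (measurable_to_events (J := J)) (measurable_to_events (J := J')) indepS h mh h0).
Qed.

Lemma blocks_eq0 (h : (S * S')%type -> \bar R) :
  measurable_fun setT h -> P.-integrable setT (fun w => h (w, w)) ->
  (forall w, P.-integrable setT (fun w' => h (w, w'))) ->
  (forall w, \int[P]_w' h (w, w') = 0)%E ->
  (\int[P]_w h (w, w) = 0)%E.
Proof.
by move=> *; apply: (@decouple_eq0 _ _ _ P _ _ S S' id id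
  (measurable_to_events (J := J)) (measurable_to_events (J := J')) indepS h).
Qed.

Lemma blocks_measurable (h : (S * S')%type -> \bar R) :
  measurable_fun setT h -> (forall z, (0 <= h z)%E) ->
  measurable_fun [set: S] (fun w => \int[P]_w' h (w, w'))%E.
Proof. exact: (@measurable_decouple _ _ _ P _ _ S S' id (measurable_to_events (J := J')) h). Qed.

Lemma adapted_fst f : adapted J f ->
  measurable_fun setT (fun z : (S * S')%type => f z.1).
Proof. by move=> af; apply: (@measurableT_comp _ _ _ (S * S')%type S _ f _ fst af). Qed.

Lemma adapted_snd f : adapted J' f ->
  measurable_fun setT (fun z : (S * S')%type => f z.2).
Proof. by move=> af; apply: (@measurableT_comp _ _ _ (S * S')%type S' _ f _ snd af). Qed.

Lemma indep_mul_le (f g : T -> R) (a b : R) : adapted J f -> adapted J' g ->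
  (forall w, 0 <= f w) -> (forall w, 0 <= g w) -> 0 <= b ->
  (\int[P]_w (f w)%:E <= a%:E -> \int[P]_w (g w)%:E <= b%:E ->
   \int[P]_w (f w * g w)%:E <= (a * b)%:E)%E.
Proof.
move=> af ag f0 g0 b0 fa gb.
rewrite (@blocks_ge0 (fun z => (f z.1 * g z.2)%:E)); last 2 first.
- apply/measurable_EFinP; apply: measurable_funM.
    exact: adapted_fst.
  exact: adapted_snd.
- by move=> z; rewrite lee_fin mulr_ge0.
have -> : (a * b)%:E = (b * a)%:E by rewrite mulrC.
apply: (@le_trans _ _ (\int[P]_w (b * f w)%:E)%E); last first.
  by apply: int_scalele => //; exact: adapted_measurable af.
apply: ge0_le_integral => //=.
- by move=> w _; apply: integral_ge0 => w' _; rewrite lee_fin mulr_ge0.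
- apply: (@measurableT_comp _ _ _ T S _ (fun w => \int[P]_w' (f w * g w')%:E)%E _ id _ (measurable_to_events (J := J))).
  apply: (@blocks_measurable (fun z => (f z.1 * g z.2)%:E)).
    apply/measurable_EFinP; apply: measurable_funM.
      exact: adapted_fst.
    exact: adapted_snd.
  by move=> z; rewrite lee_fin mulr_ge0.
- apply/measurable_EFinP; mfun; exact: adapted_measurable af.
- move=> w _; rewrite mulrC; apply: int_scalele => //.
  exact: adapted_measurable ag.
Qed.

Lemma indep_mul_eq0 (f g : T -> R) : adapted J f -> adapted J' g ->
  P.-integrable setT (EFin \o (fun w => f w * g w)) ->
  P.-integrable setT (EFin \o g) ->
  (\int[P]_w (g w)%:E = 0 -> \int[P]_w (f w * g w)%:E = 0)%E.
Proof.
move=> af ag ifg ig g0.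
apply: (@blocks_eq0 (fun z => (f z.1 * g z.2)%:E)) => //=.
- apply/measurable_EFinP; apply: measurable_funM.
    exact: adapted_fst.
  exact: adapted_snd.
- by move=> w; have := integrableZl measurableT (f w) ig.
- move=> w; under eq_integral do rewrite EFinM.
  by rewrite integralZl// g0 mule0.
Qed.

End two_blocks.

End moments.

(** Grouping the off-diagonal terms by the larger index makes the off-diagonal part of a quadratic
    form a sum of martingale differences. *)
Lemma sum_square_split (V : zmodType) (g : nat -> nat -> V) (N : nat) :
  \sum_(i < N) \sum_(j < N) g i j =
  \sum_(i < N) g i i + \sum_(k < N) \sum_(j < k) (g k j + g j k).
Proof.
elim: N => [|N IH]; first by rewrite !big_ord0 addr0.
rewrite big_ord_recr /= [X in _ + X]big_ord_recr /=.
under eq_bigr do rewrite big_ord_recr /=.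
rewrite big_split /= IH.
rewrite [X in _ = X + _]big_ord_recr [X in _ = _ + X]big_ord_recr /= big_split /=.
rewrite -!addrA; congr (_ + _); rewrite [RHS]addrCA; congr (_ + _).
by rewrite [RHS]addrC -addrA addrCA addrC -addrA.
Qed.

(** * Centred quadratic forms *)

(** 1500 exceeds 512 sqrt(8), which arises when the fourth powers of the diagonal and off-diagonal
    parts are added in [nat_quadratic_form_L4]. The lock keeps the value opaque in later
    computations. *)
Definition quad_const {R : realDomainType} (m : R) : R := locked (1500 * m ^+ 2).

Lemma quad_const_ge0 (R : realDomainType) (m : R) : 0 <= quad_const m.
Proof. by rewrite /quad_const -lock mulr_ge0 ?ler0n ?sqr_ge0. Qed.

Section quadratic_forms.
Context {R : realType} {d} {T : measurableType d} (P : probability T R).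
Context {I : choiceType} (D : set I) (x : I -> {RV P >-> R}).
Hypothesis indep : mutually_independent D x.
Variables (N : nat) (e : nat -> I) (m : R).
Hypothesis e_inj : forall j k, (j < N)%N -> (k < N)%N -> e j = e k -> j = k.
Hypothesis eD : forall k, (k < N)%N -> D (e k).
Hypothesis m1 : 1 <= m.
Hypothesis z1 : forall k, (k < N)%N -> (\int[P]_w (x (e k) w)%:E = 0)%E.
Hypothesis z2 : forall k, (k < N)%N -> (\int[P]_w (x (e k) w ^+ 2)%:E = 1)%E.
Hypothesis z8 : forall k, (k < N)%N -> (\int[P]_w (x (e k) w ^+ 8)%:E <= m%:E)%E.

Let z k : T -> R := x (e k).

Let mz k : measurable_fun setT (z k). Proof. exact: measurable_funP. Qed.

Let before k := [set e j | j in [set j | (j < k)%N]].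

Let before_D k : (k <= N)%N -> before k `<=` D.
Proof. by move=> kN _ [j /= jk <-]; apply: eD; exact: leq_trans jk kN. Qed.

Let at_D k : (k < N)%N -> [set e k] `<=` D.
Proof. by move=> kN _ ->; exact: eD. Qed.

Let before_at k : (k < N)%N -> before k `&` [set e k] = set0.
Proof.
move=> kN; apply/seteqP; split => // a [[j /= jk <-] jkE].
have := e_inj (ltn_trans jk kN) kN jkE => jE.
by move: jk; rewrite jE ltnn.
Qed.

Let adapted_z k : adapted x [set e k] (z k). Proof. exact: adapted_rv. Qed.

Let adapted_z_before j k : (j < k)%N -> adapted x (before k) (z j).
Proof. by move=> jk; apply: adapted_rv; exists j. Qed.

Let mm : m <= m ^+ 2.
Proof. by have := m1 => m1'; rewrite expr2 ler_peMl//; lra. Qed.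

Let z4 k : (k < N)%N -> (\int[P]_w (z k w ^+ 4)%:E <= ((4 * m) ^+ 2)%:E)%E.
Proof.
move=> kN; apply: (@le_trans _ _ (1 + m)%:E).
  apply: (@int_le _ _ _ _ _ (fun w => 1 + z k w ^+ 8)); [by mfun|by mfun|..].
  - by move=> w; nneg.
  - by move=> w; have := sqr_ge0 (z k w ^+ 4 - 1); nra.
  - apply: int_addle => //; [by mfun| | by rewrite int_cstE | exact: z8].
    by move=> w; nneg.
by rewrite lee_fin; have := mm; have := m1; lra.
Qed.

Let z24 k : (k < N)%N ->
  (\int[P]_w ((z k w ^+ 2 - 1) ^+ 4)%:E <= ((4 * m) ^+ 2)%:E)%E.
Proof.
move=> kN; apply: (@le_trans _ _ (8 * (1 + m))%:E); last first.
  by rewrite lee_fin; have := mm; have := m1; lra.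
apply: (@int_le _ _ _ _ _ (fun w => 8 * (1 + z k w ^+ 8))); [by mfun|by mfun|..].
- by move=> w; nneg.
- move=> w; have : 0 <= z k w ^+ 2 by nneg.
  have -> : z k w ^+ 8 = (z k w ^+ 2) ^+ 4 by rewrite -exprM.
  move: (z k w ^+ 2) => a a0; have : 0 <= (a ^+ 2) by nneg.
  have := sqr_ge0 (a ^+ 2 - 1); have := sqr_ge0 (a - 1); have : 0 <= a ^+ 3 by nneg.
  by nra.
- apply: int_scalele => //; [by mfun|by move=> w; nneg|].
  apply: int_addle => //; [by mfun| | by rewrite int_cstE | exact: z8].
  by move=> w; nneg.
Qed.

(* Both kinds of forms are sums of terms a_j(w) g(z_j), a_j depending on the
   variables before z_j only and g(z_j) having mean 0. *)
Let forms_L4 (a : nat -> T -> R) (g : R -> R) (v : nat -> R) (k : nat) :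
  (k <= N)%N -> measurable_fun setT g ->
  (forall j, (j < N)%N ->
    (\int[P]_w (g (z j w) ^+ 4)%:E <= ((4 * m) ^+ 2)%:E)%E) ->
  (forall j, (j < N)%N -> (\int[P]_w (g (z j w))%:E = 0)%E) ->
  (forall j, (j < N)%N -> adapted x (before j) (a j)) ->
  (forall j, 0 <= v j) ->
  (forall j, (j < N)%N -> (\int[P]_w (a j w ^+ 4)%:E <= (v j ^+ 2)%:E)%E) ->
  (\int[P]_w ((\sum_(j < k) a j w * g (z j w)) ^+ 4)%:E <=
   ((16 * m * \sum_(j < k) v j) ^+ 2)%:E)%E.
Proof.
move=> kN mg g4 g0 aa v0 av.
have m0 : 0 <= m by have := m1; lra.
have mgz j : measurable_fun setT (fun w => g (z j w)) by exact: measurableT_comp.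
have agz j : adapted x [set e j] (fun w => g (z j w)).
  exact: (@measurableT_comp _ _ _ (g_sigma_algebraType _) _ _ g _ (z j) mg (adapted_z (k := j))).
have ma j : (j < N)%N -> measurable_fun setT (a j).
  by move=> jN; exact: adapted_measurable (aa j jN).
have X4 j : (j < N)%N ->
    (\int[P]_w ((a j w * g (z j w)) ^+ 4)%:E <= ((4 * m * v j) ^+ 2)%:E)%E.
  move=> jN; under eq_integral do rewrite exprMn.
  have -> : (4 * m * v j) ^+ 2 = v j ^+ 2 * (4 * m) ^+ 2 by ring.
  apply: (indep_mul_le indep (J := before j) (J' := [set e j])).
  - exact/before_D/ltnW.
  - exact: at_D.
  - exact: before_at.
  - by have := aa j jN; rewrite /adapted => ?; mfun.
  - by have := agz j; rewrite /adapted => ?; mfun.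
  - by move=> w; nneg.
  - by move=> w; nneg.
  - by nneg.
  - exact: av.
  - exact: g4.
(* One factor 4 is that of [L4_add]; [4 * m] bounds the square root of the fourth moment of
   [g (z j)]. *)
have -> : 16 * m * \sum_(j < k) v j = 4 * \sum_(j < k) (4 * m * v j).
  by rewrite -mulr_sumr; ring.
have c0 j : 0 <= 4 * m * v j by nneg.
suff H : forall k, (k <= N)%N -> (\int[P]_w ((\sum_(j < k) a j w * g (z j w)) ^+ 4)%:E <=
    ((4 * \sum_(j < k) (4 * m * v j)) ^+ 2)%:E)%E by exact: H.
move=> {k kN}; elim => [_|k IH kN].
  under eq_integral do rewrite big_ord0 expr0n.
  by rewrite integral0 lee_fin big_ord0 mulr0 expr0n.
have {}IH := IH (ltnW kN).
under eq_integral do rewrite big_ord_recr /=.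
rewrite big_ord_recr /= mulrDr.
have mS : measurable_fun setT (fun w => \sum_(j < k) a j w * g (z j w)).
  apply: measurable_sum => j; have jN := ltn_trans (ltn_ord j) kN.
  by apply: measurable_funM => //; exact: ma.
apply: L4_add => //.
- by apply: measurable_funM => //; exact: ma.
- by nneg.
- exact: X4.
have -> : (\int[P]_w ((\sum_(j < k) a j w * g (z j w)) ^+ 3 * (a k w * g (z k w)))%:E =
    \int[P]_w ((\sum_(j < k) a j w * g (z j w)) ^+ 3 * a k w * g (z k w))%:E)%E.
  by apply: eq_integral => w _; rewrite mulrA.
apply: (indep_mul_eq0 indep (J := before k) (J' := [set e k])).
- exact/before_D/ltnW.
- exact: at_D.
- exact: before_at.
- have := aa k kN; rewrite /adapted => ?.
  apply: measurable_funM => //; apply: measurable_funX.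
  apply: measurable_sum => j; apply: measurable_funM.
    apply: (adapted_sub _ (aa j (ltn_trans (ltn_ord j) kN))) => _ [i /= ij <-].
    by exists i => //=; exact: ltn_trans ij (ltn_ord j).
  by apply: (adapted_sub _ (agz j)) => _ ->; exists (val j) => //=.
- exact: agz.
- have := integrable_cube mS (measurable_funM (ma k kN) (mgz k)) IH (X4 k kN).
  by apply: eq_integrable => // w _; rewrite /= mulrA.
- exact: integrable_L4 (g4 k kN).
- exact: g0.
Qed.

Let linear_form_L4 (c : nat -> R) (k : nat) : (k <= N)%N ->
  (\int[P]_w ((\sum_(j < k) c j * z j w) ^+ 4)%:E <=
   ((16 * m * \sum_(j < k) c j ^+ 2) ^+ 2)%:E)%E.
Proof.
move=> kN; apply: (forms_L4 (a := fun j _ => c j) (g := id) (v := fun j => c j ^+ 2)) => //.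
- by move=> j jN; exact: measurable_cst.
- by move=> j; nneg.
- by move=> j jN; rewrite int_cstE -exprM.
Qed.

Let diagonal_form_L4 (c : nat -> R) (k : nat) : (k <= N)%N ->
  (\int[P]_w ((\sum_(j < k) c j * (z j w ^+ 2 - 1)) ^+ 4)%:E <=
   ((16 * m * \sum_(j < k) c j ^+ 2) ^+ 2)%:E)%E.
Proof.
move=> kN; apply: (forms_L4 (a := fun j _ => c j) (g := fun r => r ^+ 2 - 1)
  (v := fun j => c j ^+ 2)) => //.
- by mfun.
- move=> j jN; under eq_integral do rewrite EFinB.
  rewrite integralB//.
  + by rewrite z2// int_cstE subee.
  + apply: (@integrable_bound _ _ _ _ _ (fun w => z j w ^+ 2) 1); [by mfun|by mfun| |by rewrite z2].
    by move=> w; rewrite ger0_norm//; nneg.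
  + apply: (@integrable_bound _ _ _ _ _ (fun w => 1) 1); [by mfun|by mfun| |by rewrite int_cstE].
    by move=> w; rewrite normr1.
- by move=> j jN; exact: measurable_cst.
- by move=> j; nneg.
- by move=> j jN; rewrite int_cstE -exprM.
Qed.

(** The coefficient of [z j] is itself a linear form in the earlier variables, so [linear_form_L4]
    supplies the bound [v j] on its fourth moment. *)
Let offdiagonal_form_L4 (c : nat -> nat -> R) (k : nat) : (k <= N)%N ->
  (\int[P]_w ((\sum_(j < k) (\sum_(i < j) c j i * z i w) * z j w) ^+ 4)%:E <=
   ((16 * m * \sum_(j < k) (16 * m * \sum_(i < j) c j i ^+ 2)) ^+ 2)%:E)%E.
Proof.
have m0 : 0 <= m by have := m1; lra.
move=> kN; apply: (forms_L4 (a := fun j w => \sum_(i < j) c j i * z i w) (g := id)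
  (v := fun j => 16 * m * \sum_(i < j) c j i ^+ 2)) => //.
- move=> j jN; apply: measurable_sum => i; apply: measurable_funM => //.
  exact: adapted_z_before.
- by move=> j; nneg.
- by move=> j jN; apply: linear_form_L4; exact: ltnW.
Qed.

Lemma nat_quadratic_form_L4 (b : nat -> nat -> R) :
  (\int[P]_w ((\sum_(i < N) \sum_(j < N) b i j * (z i w * z j w)
     - \sum_(i < N) b i i) ^+ 4)%:E <=
   ((1500 * m ^+ 2 * \sum_(i < N) \sum_(j < N) b i j ^+ 2) ^+ 2)%:E)%E.
Proof.
have m0 : 0 <= m by have := m1; lra.
pose U w := \sum_(j < N) b j j * (z j w ^+ 2 - 1).
pose V w := \sum_(j < N) (\sum_(i < j) (b j i + b i j) * z i w) * z j w.
have mU : measurable_fun setT U by rewrite /U; apply: measurable_sum => j; mfun.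
have mV : measurable_fun setT V.
  rewrite /V; apply: measurable_sum => j; apply: measurable_funM => //.
  by apply: measurable_sum => i; mfun.
have UV w : \sum_(i < N) \sum_(j < N) b i j * (z i w * z j w)
     - \sum_(i < N) b i i = U w + V w.
  rewrite (sum_square_split (fun i j => b i j * (z i w * z j w))) /U /V.
  rewrite addrAC -sumrB; congr (_ + _); first by apply: eq_bigr => j _; ring.
  apply: eq_bigr => j _; rewrite mulr_suml; apply: eq_bigr => i _; ring.
pose a := \sum_(j < N) b j j ^+ 2.
pose c := \sum_(j < N) \sum_(i < j) (b j i ^+ 2 + b i j ^+ 2).
rewrite (sum_square_split (fun i j => b i j ^+ 2)) -/a -/c.
have a0 : 0 <= a by rewrite /a; nneg.
have c0 : 0 <= c by rewrite /c; nneg.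
have HU : (\int[P]_w (U w ^+ 4)%:E <= ((16 * m * a) ^+ 2)%:E)%E.
  exact: (diagonal_form_L4 (fun j => b j j) (leqnn N)).
have HV : (\int[P]_w (V w ^+ 4)%:E <= ((512 * m ^+ 2 * c) ^+ 2)%:E)%E.
  apply: le_trans (offdiagonal_form_L4 (fun j i => b j i + b i j) (leqnn N)) _.
  rewrite lee_fin; apply: sqr_le; first by apply: mulr_ge0; [nneg|apply: sumr_ge0 => j _; nneg].
  (* 512 = 16 * 16 * 2: two martingale bounds, and a 2 for the square of the symmetrised coefficient
     [b j i + b i j]. *)
  rewrite -mulr_sumr (_ : 512 * m ^+ 2 * c = 16 * m * (16 * m * (2 * c))); last by ring.
  apply: ler_wpM2l; first by nneg.
  apply: ler_wpM2l; first by nneg.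
  rewrite /c mulr_sumr; apply: ler_sum => j _; rewrite mulr_sumr.
  apply: ler_sum => i _; have := sqr_ge0 (b j i - b i j); nra.
apply: (@le_trans _ _ (8 * (16 * m * a) ^+ 2 + 8 * (512 * m ^+ 2 * c) ^+ 2)%:E).
  apply: (@int_le _ _ _ _ _ (fun w => 8 * U w ^+ 4 + 8 * V w ^+ 4)).
  - under eq_fun do rewrite UV; mfun.
  - by mfun.
  - by move=> w; nneg.
  - move=> w; rewrite UV; move: (U w) (V w) => s t.
    have := sqr_ge0 (s ^+ 2 - t ^+ 2); have := sqr_ge0 (s * (s - t)).
    have := sqr_ge0 (t * (s - t)); have := sqr_ge0 ((s - t) ^+ 2); nra.
  - apply: int_addle; [by mfun|by mfun|by move=> w; nneg|by move=> w; nneg|..].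
    + by apply: int_scalele => //; [mfun|move=> w; nneg].
    + by apply: int_scalele => //; [mfun|move=> w; nneg].
rewrite lee_fin.
have A0 : 0 <= m ^+ 2 * a by nneg.
have C0 : 0 <= m ^+ 2 * c by nneg.
have H : (16 * m * a) ^+ 2 <= (16 * (m ^+ 2 * a)) ^+ 2.
  apply: sqr_le; first by nneg.
  by rewrite -mulrA; apply: ler_wpM2l => //; exact: ler_wpM2r.
have -> : 1500 * m ^+ 2 * (a + c) = 1500 * (m ^+ 2 * a + m ^+ 2 * c) by ring.
rewrite -(mulrA 512); have := mulr_ge0 A0 C0.
have := sqr_ge0 (m ^+ 2 * a); have := sqr_ge0 (m ^+ 2 * c).
by move: (m ^+ 2 * a) (m ^+ 2 * c) H => A C H *; lra.
Qed.

Lemma quadratic_form_L4 (B : 'M[R]_N) :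
  (\int[P]_w ((qform B (\col_i x (e i) w) - \tr B) ^+ 4)%:E <=
   ((quad_const m * frobenius2 B) ^+ 2)%:E)%E.
Proof.
(* The matrix is extended by zero to indices in [nat]. *)
rewrite /quad_const -lock; pose b i j := oapp (fun i' : 'I_N => oapp (B i') 0 (insub j)) 0 (insub i).
have bE (i j : 'I_N) : b i j = B i j by rewrite /b !valK.
have := nat_quadratic_form_L4 b.
have -> : \sum_(i < N) \sum_(j < N) b i j ^+ 2 = frobenius2 B.
  by apply: eq_bigr => i _; apply: eq_bigr => j _; rewrite bE.
apply: le_trans; rewrite le_eqVlt; apply/orP; left; apply/eqP.
apply: eq_integral => w _; congr ((_ - _) ^+ 4)%:E.
  rewrite qformE; apply: eq_bigr => i _; apply: eq_bigr => j _.
  by rewrite bE !mxE.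
by apply: eq_bigr => i _; rewrite bE.
Qed.

Lemma quadratic_form_integrable (B : 'M[R]_N) :
  P.-integrable setT (EFin \o (fun w => qform B (\col_i x (e i) w) - \tr B)).
Proof.
apply: (integrable_L4 _ (quadratic_form_L4 B)).
apply: measurable_funB => //; under eq_fun do rewrite qformE.
apply: measurable_sum => i; apply: measurable_sum => j.
apply: measurable_funM => //.
by under eq_fun do rewrite !mxE; apply: measurable_funM; exact: mz.
Qed.

Let zz_integrable i j : (i < N)%N -> (j < N)%N ->
  P.-integrable setT (EFin \o (fun w => z i w * z j w)).
Proof.
move=> iN jN.
apply: (@integrable_bound _ _ _ _ _ (fun w => z i w ^+ 2 + z j w ^+ 2) (1 + 1)).
- by mfun.
- by mfun.
- move=> w; have := sqr_ge0 (z i w - z j w); have := sqr_ge0 (z i w + z j w).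
  have := sqr_ge0 (z i w); have := sqr_ge0 (z j w).
  by rewrite ler_norml => *; apply/andP; split; lra.
- by apply: int_addle; [mfun|mfun|move=> w; nneg|move=> w; nneg|rewrite z2|rewrite z2].
Qed.

Let zz_mean i j : (i < N)%N -> (j < N)%N ->
  (\int[P]_w (z i w * z j w)%:E = (i == j)%:R%:E)%E.
Proof.
move=> iN jN; case: eqVneq => [->|ij]; first by rewrite -(z2 jN).
apply: (indep_mul_eq0 indep (J := [set e i]) (J' := [set e j])) => //.
- exact: at_D.
- exact: at_D.
- apply/seteqP; split => // a [-> eij]; move: ij; rewrite (e_inj iN jN eij).
  by rewrite eqxx.
- exact: zz_integrable.
- exact: integrable_L4 (z4 jN).
- exact: z1.
Qed.

Lemma quadratic_form_mean0 (B : 'M[R]_N) :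
  (\int[P]_w (qform B (\col_i x (e i) w) - \tr B)%:E = 0)%E.
Proof.
have iz (i j : 'I_N) : P.-integrable setT (fun w => (B i j * (z i w * z j w))%:E).
  by have := integrableZl measurableT (B i j) (zz_integrable (ltn_ord i) (ltn_ord j)).
have qE w : (qform B (\col_i x (e i) w))%:E =
    (\sum_(i < N) \sum_(j < N) (B i j * (z i w * z j w))%:E)%E.
  rewrite qformE -sumEFin; apply: eq_bigr => i _.
  by rewrite -sumEFin; apply: eq_bigr => j _; rewrite !mxE.
have I1 : (\int[P]_w (qform B (\col_i x (e i) w))%:E = (\tr B)%:E)%E.
  under eq_integral do rewrite qE.
  rewrite integral_sum//; last by move=> i; exact: integrable_sum.
  rewrite /mxtrace -sumEFin; apply: eq_bigr => i _.
  rewrite integral_sum// (bigD1 i) //= big1 ?adde0.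
    under eq_integral do rewrite EFinM.
    rewrite integralZl//; last exact: zz_integrable.
    by rewrite zz_mean// eqxx mule1.
  move=> j ji; under eq_integral do rewrite EFinM.
  rewrite integralZl//; last exact: zz_integrable.
  by rewrite zz_mean// val_eqE eq_sym (negbTE ji) mule0.
under eq_integral do rewrite EFinB.
rewrite integralB//.
- by rewrite I1 int_cstE subee.
- under eq_fun do rewrite qE.
  by apply: integrable_sum => // i _; exact: integrable_sum.
- exact: (finite_measure_integrable_cst P (\tr B) measurableT).
Qed.

End quadratic_forms.

(** * Chaining *)

(** The Hoelder scale of the whole proof: chaining controls fourth powers by a square root. *)
Definition root8 {R : rcfType} (r : R) : R := Num.sqrt (Num.sqrt (Num.sqrt r)).

Section root8.
Context {R : rcfType}.
Implicit Types a b : R.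

Lemma root8_ge0 a : 0 <= root8 a. Proof. exact: sqrtr_ge0. Qed.

Lemma root8M a b : 0 <= a -> root8 (a * b) = root8 a * root8 b.
Proof. by move=> a0; rewrite /root8 !sqrtrM ?sqrtr_ge0. Qed.

Lemma root8_gt0 a : 0 < a -> 0 < root8 a.
Proof. by move=> a0; rewrite !sqrtr_gt0. Qed.

Lemma root8_le a b : a <= b -> root8 a <= root8 b.
Proof. by move=> ab; do 3 apply: ler_wsqrtr. Qed.

Lemma root8_exp4 a : root8 a ^+ 4 = Num.sqrt a.
Proof.
by rewrite (exprM _ 2 2) /root8 sqr_sqrtr ?sqrtr_ge0// sqr_sqrtr// sqrtr_ge0.
Qed.

Lemma sqrtD_le a b : 0 <= a -> 0 <= b ->
  Num.sqrt (a + b) <= Num.sqrt a + Num.sqrt b.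
Proof.
move=> a0 b0; rewrite -[leRHS]ger0_norm ?addr_ge0 ?sqrtr_ge0// -sqrtr_sqr.
apply: ler_wsqrtr; rewrite sqrrD !sqr_sqrtr//.
by rewrite addrAC lerDl mulrn_wge0// mulr_ge0 ?sqrtr_ge0.
Qed.

Lemma root8D_le a b : 0 <= a -> 0 <= b -> root8 (a + b) <= root8 a + root8 b.
Proof.
move=> a0 b0; rewrite /root8.
apply: le_trans (sqrtD_le _ _); rewrite ?sqrtr_ge0//; apply: ler_wsqrtr.
apply: le_trans (sqrtD_le _ _); rewrite ?sqrtr_ge0//; apply: ler_wsqrtr.
exact: sqrtD_le.
Qed.

Lemma root8_1 : root8 (1 : R) = 1. Proof. by rewrite /root8 !sqrtr1. Qed.

Lemma sqrt2_gt1 : 1 < Num.sqrt (2 : R).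
Proof. by rewrite -[X in X < _]sqrtr1 ltr_sqrt// ltr1n. Qed.

Lemma root8_2_gt1 : 1 < root8 (2 : R).
Proof.
rewrite /root8; have H (a : R) : 1 < a -> 1 < Num.sqrt a.
  by move=> a1; rewrite -[X in X < _]sqrtr1 ltr_sqrt// (lt_trans ltr01).
by do 3 apply: (H); rewrite ltr1n.
Qed.

Lemma geometric_sum_le (q : R) (g : nat) : 1 < q ->
  \sum_(l < g.+1) q ^+ l <= q / (q - 1) * q ^+ g.
Proof.
move=> q1; have q0 : 0 < q - 1 by rewrite subr_gt0.
rewrite mulrAC ler_pdivlMr// mulrC -subrX1 exprS.
by rewrite gerBl.
Qed.

Lemma root8X a n : 0 <= a -> root8 (a ^+ n) = root8 a ^+ n.
Proof.
move=> a0; elim: n => [|n IH]; first by rewrite !expr0 root8_1.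
by rewrite !exprS root8M// IH.
Qed.

Lemma sqrtrXn a n : 0 <= a -> Num.sqrt (a ^+ n) = Num.sqrt a ^+ n.
Proof.
move=> a0; elim: n => [|n IH]; first by rewrite !expr0 sqrtr1.
by rewrite !exprS sqrtrM// IH.
Qed.

End root8.

(** Each of j and k is rounded down to multiples of 1, 2, 4, ..., 2^g, every rounding costing at
    most one dyadic step of its level. Since k - j <= 2^g, the two roundings at level g are equal or
    adjacent. *)
Lemma dyadic_chain (R : realDomainType) (Z r : nat -> R) (L : nat) :
  (forall l, 0 <= r l) ->
  (forall l j, (j.+1 * 2 ^ l <= L)%N ->
    `|Z (j.+1 * 2 ^ l)%N - Z (j * 2 ^ l)%N| <= r l) ->
  forall g j k, (j <= k <= L)%N -> (k - j <= 2 ^ g)%N ->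
  `|Z k - Z j| <= 2 * \sum_(l < g.+1) r l.
Proof.
move=> r0 H.
pose f l m := ((m %/ 2 ^ l) * 2 ^ l)%N.
have Hf g m : (m <= L)%N -> `|Z m - Z (f g m)| <= \sum_(l < g) r l.
  move=> mL; elim: g => [|g IH].
    by rewrite /f expn0 divn1 muln1 subrr normr0 big_ord0.
  rewrite big_ord_recr /=; apply: le_trans (ler_distD (Z (f g m)) _ _) _.
  apply: lerD => //.
  have fE : f g.+1 m = ((m %/ 2 ^ g %/ 2).*2 * 2 ^ g)%N.
    by rewrite /f expnSr divnMA -muln2 -mulnA (mulnC 2).
  rewrite fE /f; set q := (m %/ 2 ^ g)%N.
  (* Passing from level g to g+1 moves the rounded point by one step of level g if the quotient is
     odd, and not at all if it is even. *)
  have := odd_double_half q; rewrite -divn2.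
  case: (odd q) => /= qE; last by rewrite add0n in qE; rewrite qE subrr normr0.
  rewrite -{1}qE add1n; apply: H.
  by rewrite -add1n qE; apply: leq_trans (leq_trunc_div m (2 ^ g)) mL.
move=> g j k /andP[jk kL] kj.
have jL := leq_trans jk kL.
have Hm : `|Z (f g k) - Z (f g j)| <= r g.
  have g0 : (0 < 2 ^ g)%N by rewrite expn_gt0.
  have : (k %/ 2 ^ g = j %/ 2 ^ g \/ k %/ 2 ^ g = (j %/ 2 ^ g).+1)%N.
    have le1 : (j %/ 2 ^ g <= k %/ 2 ^ g)%N by exact: leq_div2r.
    have le2 : (k %/ 2 ^ g <= (j %/ 2 ^ g).+1)%N.
      have -> : (j %/ 2 ^ g).+1 = ((j + 2 ^ g) %/ 2 ^ g)%N.
        by rewrite divnDr// divnn g0 addn1.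
      by apply: leq_div2r; rewrite -leq_subLR.
    by clear -le1 le2; lia.
  move=> [E|E]; rewrite /f E; first by rewrite subrr normr0.
  by apply: H; rewrite -E; apply: leq_trans (leq_trunc_div k (2 ^ g)) kL.
have -> : Z k - Z j = (Z k - Z (f g k)) + (Z (f g k) - Z (f g j)) + (Z (f g j) - Z j).
  by ring.
apply: le_trans (ler_normD _ _) _.
apply: (@le_trans _ _ ((\sum_(l < g) r l + r g) + \sum_(l < g) r l)).
  apply: lerD; last by rewrite distrC Hf.
  by apply: le_trans (ler_normD _ _) _; rewrite lerD// Hf.
by rewrite big_ord_recr /=; have := r0 g; lra.
Qed.

Section chaining.
Context {R : realType}.

(** 32 is 2^4, for the factor 2 of [dyadic_chain], times 2 for rounding k - j up to a power of two.
    The two quotients bound the geometric sums of ratio root8 2, in the pathwise bound, and sqrt 2,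
    in the expectation. *)
Definition chain_const : R :=
  32 * (root8 2 / (root8 2 - 1)) ^+ 4 * (Num.sqrt 2 / (Num.sqrt 2 - 1)).

Lemma chain_const_gt0 : 0 < chain_const.
Proof.
have h8 : 0 < root8 (2 : R) - 1 by rewrite subr_gt0 root8_2_gt1.
have h2 : 0 < Num.sqrt (2 : R) - 1 by rewrite subr_gt0 sqrt2_gt1.
rewrite /chain_const; apply: mulr_gt0; last by rewrite divr_gt0// sqrtr_gt0.
by apply: mulr_gt0 => //; rewrite exprn_gt0// divr_gt0// root8_gt0.
Qed.

Context {d} {T : measurableType d} (P : probability T R).

(** At level l there are at most n / 2^l increments, each of fourth moment at most A s_l^4 with s_l
    = sqrt(2^l / n). Weighted by 1 / s_l they contribute at most A s_l in all, and these sum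
    geometrically to a multiple of A because 2^G <= n. Conversely the weighted sum [V0] dominates
    each dyadic increment: its fourth power is at most [V0 w] times s_l. *)
Lemma chaining (Z : nat -> T -> R) (L n : nat) (A : R) :
  (0 < n)%N -> (L <= n)%N -> 0 <= A ->
  (forall k, (k <= L)%N -> measurable_fun setT (Z k)) ->
  (forall j k, (j <= k <= L)%N ->
    \int[P]_w ((Z k w - Z j w) ^+ 4)%:E <=
      (A * ((k - j)%:R / n%:R) ^+ 2)%:E)%E ->
  exists V : T -> R, [/\ measurable_fun setT V, forall w, 0 <= V w,
    (\int[P]_w (V w)%:E <= (chain_const * A)%:E)%E &
    forall w j k, (j <= k <= L)%N ->
      (Z k w - Z j w) ^+ 4 <= V w * Num.sqrt ((k - j)%:R / n%:R)].
Proof.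
move=> n0 Ln A0 mZ HZ.
have nr0 : 0 < n%:R :> R by rewrite ltr0n.
pose G := trunc_log 2 L.
pose s l : R := Num.sqrt ((2 ^ l)%:R / n%:R).
have s0 l : 0 < s l by rewrite sqrtr_gt0 divr_gt0// ltr0n expn_gt0.
pose X l j w := (Z (j.+1 * 2 ^ l)%N w - Z (j * 2 ^ l)%N w) ^+ 4.
pose V0 w := \sum_(l < G.+1) \sum_(j < L %/ 2 ^ l) (s l)^-1 * X l j w.
pose K1 : R := root8 2 / (root8 2 - 1).
pose K2 : R := Num.sqrt 2 / (Num.sqrt 2 - 1).
have h8 : 0 < root8 (2 : R) - 1 by rewrite subr_gt0 root8_2_gt1.
have h2 : 0 < Num.sqrt (2 : R) - 1 by rewrite subr_gt0 sqrt2_gt1.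
have K10 : 0 < K1 by rewrite /K1 divr_gt0// root8_gt0.
have K20 : 0 < K2 by rewrite /K2 divr_gt0// sqrtr_gt0.
have jL l (j : 'I_(L %/ 2 ^ l)) : (j.+1 * 2 ^ l <= L)%N.
  by rewrite (leq_trans _ (leq_trunc_div L (2 ^ l)))// leq_mul2r ltn_ord orbT.
have X0 l j w : 0 <= X l j w by rewrite /X; nneg.
have mX l (j : 'I_(L %/ 2 ^ l)) : measurable_fun setT (X l j).
  rewrite /X; apply: measurable_funX; apply: measurable_funB; apply: mZ => //.
  by apply: leq_trans (jL l j); rewrite leq_mul2r leqnSn orbT.
have mV0 : measurable_fun setT V0.
  rewrite /V0; apply: measurable_sum => l; apply: measurable_sum => j.
  by apply: measurable_funM => //; exact: mX.
have V00 w : 0 <= V0 w.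
  rewrite /V0; apply: sumr_ge0 => l _; apply: sumr_ge0 => j _.
  by rewrite mulr_ge0// invr_ge0 ltW.
have EV0 : (\int[P]_w (V0 w)%:E <= (K2 * A)%:E)%E.
  apply: (@le_trans _ _ (\sum_(l < G.+1) \sum_(j < L %/ 2 ^ l)
      (s l)^-1 * (A * ((2 ^ l)%:R / n%:R) ^+ 2))%:E).
    apply: int_sumle => [l|l w|l].
    - by apply: measurable_sum => j; apply: measurable_funM => //; exact: mX.
    - by apply: sumr_ge0 => j _; rewrite mulr_ge0// invr_ge0 ltW.
    apply: int_sumle => [j|j w|j].
    - by apply: measurable_funM => //; exact: mX.
    - by rewrite mulr_ge0// invr_ge0 ltW.
    apply: int_scalele => //; first by rewrite invr_ge0 ltW.
    have := HZ (j * 2 ^ l)%N (j.+1 * 2 ^ l)%N.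
    rewrite jL leq_mul2r leqnSn orbT => /(_ isT).
    by rewrite -mulnBl subSnn mul1n.
  rewrite lee_fin.
  apply: (@le_trans _ _ (\sum_(l < G.+1) A * s l)).
    apply: ler_sum => l _; rewrite sumr_const card_ord -[leLHS]mulr_natl.
    have ssE : (2 ^ l)%:R / n%:R = s l ^+ 2.
      by rewrite sqr_sqrtr// divr_ge0.
    rewrite ssE.
    have -> : (L %/ 2 ^ l)%:R * ((s l)^-1 * (A * s l ^+ 2 ^+ 2)) =
        A * s l * ((L %/ 2 ^ l)%:R * s l ^+ 2).
      by field; rewrite gt_eqF.
    apply: ler_piMr; first by rewrite mulr_ge0// ltW.
    rewrite -ssE mulrA ler_pdivrMr// mul1r -natrM ler_nat.
    exact: leq_trans (leq_trunc_div L (2 ^ l)) Ln.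
  rewrite -mulr_sumr mulrC ler_wpM2r//.
  pose u : R := Num.sqrt (n%:R^-1).
  have sE l : s l = u * Num.sqrt 2 ^+ l.
    by rewrite /s natrX sqrtrM ?exprn_ge0// mulrC sqrtrXn.
  under eq_bigr do rewrite sE.
  rewrite -mulr_sumr.
  apply: (@le_trans _ _ (u * (K2 * Num.sqrt 2 ^+ G))).
    by rewrite ler_wpM2l ?sqrtr_ge0// geometric_sum_le// sqrt2_gt1.
  rewrite mulrCA -sE ger_pMr//.
  rewrite -[leRHS]sqrtr1; apply: ler_wsqrtr.
  rewrite ler_pdivrMr// mul1r ler_nat /G.
  case: (posnP L) => [->|L0]; first by rewrite trunc_log0 expn0.
  by apply: leq_trans Ln; exact: trunc_logP.
exists (fun w => 32 * K1 ^+ 4 * V0 w); split.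
- by mfun.
- by move=> w; rewrite mulr_ge0// mulr_ge0// exprn_ge0// ltW.
- have -> : chain_const * A = 32 * K1 ^+ 4 * (K2 * A) by rewrite mulrA.
  apply: int_scalele => //.
  by rewrite mulr_ge0// exprn_ge0// ltW.
move=> w j k /andP[jk kL].
have [kj0|kj0] := posnP (k - j)%N.
  have -> : j = k by move: kj0 => /eqP; rewrite subn_eq0 => kj; apply/eqP; rewrite eqn_leq jk kj.
  by rewrite subrr expr0n subnn mul0r sqrtr0 mulr0.
(* This level satisfies k - j <= 2^g <= 2 (k - j). *)
pose g := (trunc_log 2 (k - j)).+1.
have g1 : (k - j <= 2 ^ g)%N by rewrite ltnW// trunc_log_ltn.
have g2 : (2 ^ g <= 2 * (k - j))%N.
  by rewrite expnS leq_pmul2l// trunc_logP.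
pose v := Num.sqrt (Num.sqrt (V0 w)).
have v0 : 0 <= v by exact: sqrtr_ge0.
have v4 : v ^+ 4 = V0 w.
  by rewrite (exprM _ 2 2) /v sqr_sqrtr ?sqrtr_ge0// sqr_sqrtr.
pose rh l : R := root8 ((2 ^ l)%:R / n%:R).
have rh4 l : rh l ^+ 4 = s l by rewrite /rh root8_exp4.
have rh0 l : 0 <= rh l by exact: root8_ge0.
have D l i : (i.+1 * 2 ^ l <= L)%N ->
    `|Z (i.+1 * 2 ^ l)%N w - Z (i * 2 ^ l)%N w| <= v * rh l.
  move=> iL.
  have lG : (l < G.+1)%N.
    have L0 : (0 < L)%N by apply: leq_trans iL; rewrite muln_gt0 expn_gt0.
    rewrite ltnS /G trunc_log_max//; apply: leq_trans iL.
    by rewrite leq_pmull.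
  have iLl : (i < L %/ 2 ^ l)%N by rewrite leq_divRL// expn_gt0.
  rewrite -(@ler_pXn2r _ 4)// ?nnegrE ?mulr_ge0//.
  rewrite exprMn v4 rh4.
  have -> : `|Z (i.+1 * 2 ^ l)%N w - Z (i * 2 ^ l)%N w| ^+ 4 = X l i w.
    rewrite /X -normrX ger0_norm//; nneg.
  rewrite -ler_pdivrMr// mulrC /V0.
  rewrite (bigD1 (Ordinal lG)) //= (bigD1 (Ordinal iLl)) //=.
  rewrite -addrA lerDl addr_ge0//.
    by apply: sumr_ge0 => ? _; rewrite mulr_ge0// invr_ge0 ltW.
  apply: sumr_ge0 => ? _; apply: sumr_ge0 => ? _.
  by rewrite mulr_ge0// invr_ge0 ltW.
have vr0 l : 0 <= v * rh l by exact: mulr_ge0.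
have := dyadic_chain (Z := fun i => Z i w) vr0 D.
have jkL : (j <= k <= L)%N by rewrite jk.
move=> /(_ g j k jkL g1) H.
have H2 : 2 * \sum_(l < g.+1) v * rh l <= 2 * v * K1 * rh g.
  rewrite -mulr_sumr mulrA -[leRHS]mulrA; apply: ler_wpM2l; first by rewrite mulr_ge0.
  pose u : R := root8 (n%:R^-1).
  have rhE l : rh l = u * root8 2 ^+ l.
    by rewrite /rh natrX root8M ?exprn_ge0// mulrC root8X.
  under eq_bigr do rewrite rhE.
  rewrite -mulr_sumr rhE mulrCA; apply: ler_wpM2l; first exact: root8_ge0.
  exact/geometric_sum_le/root8_2_gt1.
have -> : (Z k w - Z j w) ^+ 4 = `|Z k w - Z j w| ^+ 4.
  by rewrite -normrX ger0_norm//; nneg.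
apply: (@le_trans _ _ ((2 * v * K1 * rh g) ^+ 4)).
  rewrite ler_pXn2r// ?nnegrE//; first exact: le_trans H H2.
  by rewrite (mulr_ge0 _ (rh0 g))// (mulr_ge0 _ (ltW K10))// mulr_ge0.
rewrite (_ : (2 * v * K1 * rh g) ^+ 4 = 2 ^+ 4 * v ^+ 4 * K1 ^+ 4 * rh g ^+ 4); last by ring.
rewrite rh4 v4.
have sg : s g <= 2 * Num.sqrt ((k - j)%:R / n%:R).
  apply: (@le_trans _ _ (Num.sqrt (2 * ((k - j)%:R / n%:R)))).
    apply: ler_wsqrtr; rewrite mulrA ler_pM2r ?invr_gt0//.
    by rewrite -natrM ler_nat.
  rewrite sqrtrM// ler_wpM2r ?sqrtr_ge0//.
  rewrite -[leRHS]ger0_norm// -sqrtr_sqr; apply: ler_wsqrtr.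
  by rewrite expr2 ler_peMl// ler1n.
have -> : 2 ^+ 4 * V0 w * K1 ^+ 4 * s g = 16 * K1 ^+ 4 * V0 w * s g by ring.
have -> : 32 * K1 ^+ 4 * V0 w * Num.sqrt ((k - j)%:R / n%:R) =
  16 * K1 ^+ 4 * V0 w * (2 * Num.sqrt ((k - j)%:R / n%:R)) by ring.
by rewrite ler_wpM2l// mulr_ge0// mulr_ge0// exprn_ge0// ltW.
Qed.

End chaining.

(** * Truncated logarithms *)

Section truncated_log.
Context {R : realType}.
Implicit Types x y : R.

Lemma measurable_inv : measurable_fun [set: R] (fun r : R => r^-1).
Proof.
have -> : [set: R] = [set~ 0] `|` [set 0].
  by rewrite setUC setUv.
have mz : measurable [set~ (0 : R)] by exact: measurableC.
apply/measurable_funU => //; split; last first.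
  exact: measurable_fun_set1.
apply: open_continuous_measurable_fun.
  by rewrite openC; exact: closed_eq.
by move=> r; rewrite inE /= => /eqP r0; exact: inv_continuous.
Qed.

(** The cut at 1/2 makes the function Lipschitz with constant 2 on the whole line, while it still
    equals ln(1 + x) for x >= -1/2. *)
Definition trunc_ln x : R := ln (Num.max (1 + x) 2^-1).

Let u x : R := Num.max (1 + x) 2^-1.

Let u_ge x : 2^-1 <= u x. Proof. by rewrite le_max lexx orbT. Qed.

Let u_gt0 x : 0 < u x. Proof. by apply: lt_le_trans (u_ge x); rewrite invr_gt0. Qed.

Lemma ln_le_sub1 x : 0 < x -> ln x <= x - 1.
Proof.
move=> x0; have := @le_ln1Dx _ (x - 1); rewrite (addrC 1) subrK; apply.
by rewrite ltrBrDl subrr.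
Qed.

Lemma measurable_trunc_ln : measurable_fun setT trunc_ln.
Proof.
apply: measurableT_comp; first exact: measurable_ln.
by apply: measurable_maxr; mfun.
Qed.

Lemma trunc_lnE x : - 2^-1 <= x -> trunc_ln x = ln (1 + x).
Proof. by move=> x1; rewrite /trunc_ln max_l//; lra. Qed.

Lemma trunc_ln0 : trunc_ln 0 = 0.
Proof. by rewrite trunc_lnE ?addr0 ?ln1//; lra. Qed.

Lemma ln_sub_le (a b : R) : 0 < a -> 0 < b -> ln a - ln b <= (a - b) / b.
Proof.
move=> a0 b0; rewrite -ln_div ?posrE// (le_trans (ln_le_sub1 _))// ?divr_gt0//.
by rewrite mulrBl divff ?gt_eqF.
Qed.

Lemma trunc_ln_ge x : -1 <= trunc_ln x.
Proof.
rewrite -[trunc_ln x]opprK lerN2.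
have := @ln_sub_le 1 (u x) ltr01 (u_gt0 x); rewrite ln1 sub0r => /le_trans; apply.
rewrite ler_pdivrMr// mul1r lerBlDr; apply: le_trans (lerD (u_ge x) (u_ge x)).
by lra.
Qed.

Let ulip x y : u x - u y <= `|x - y|.
Proof.
have := ler_norm (x - y); have := normr_ge0 (x - y).
rewrite /u /Num.max; case: ltP => ?; case: ltP => ?; lra.
Qed.

Let diff_le x y : trunc_ln x - trunc_ln y <= (u x - u y) / u y.
Proof. by apply: ln_sub_le; exact: u_gt0. Qed.

Let uinv x : (u x)^-1 <= 2.
Proof. by rewrite -[leRHS]invrK lef_pV2 ?posrE// invr_gt0. Qed.

Let trunc_ln_lip1 x y : trunc_ln x - trunc_ln y <= 2 * `|x - y|.
Proof.
apply: le_trans (diff_le x y) _; rewrite mulrC.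
have v0 : 0 <= (u y)^-1 by rewrite invr_ge0 ltW.
apply: le_trans (ler_wpM2l v0 (ulip x y)) _.
exact: ler_wpM2r.
Qed.

Lemma trunc_ln_lip x y : `|trunc_ln x - trunc_ln y| <= 2 * `|x - y|.
Proof.
rewrite ler_norml trunc_ln_lip1 andbT lerNl opprB distrC; exact: trunc_ln_lip1.
Qed.

Let u1 x : `|u x - 1| <= `|x|.
Proof.
have := ler_norm x; have := ler_norm (- x); rewrite normrN.
rewrite ler_norml /u /Num.max; case: ltP => ? *; apply/andP; split; lra.
Qed.

Let trunc_ln_second1 x y : trunc_ln x - trunc_ln y - (x - y) <=
  4 * (`|x - y| * (`|x| + `|y|)).
Proof.
have H1 : (u x - u y) / u y - (u x - u y) <= 2 * (`|x - y| * `|y|).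
  have -> : (u x - u y) / u y - (u x - u y) = (u y)^-1 * ((u x - u y) * (1 - u y)).
    by field; rewrite gt_eqF.
  apply: le_trans (ler_norm _) _; rewrite normrM (@ger0_norm _ (u y)^-1); last by rewrite invr_ge0 ltW.
  rewrite normrM; apply: ler_pM => //; first by rewrite invr_ge0 ltW.
  apply: ler_pM => //; last by rewrite distrC u1.
  by rewrite ler_norml ulip andbT lerNl opprB distrC ulip.
have H2 : (u x - u y) - (x - y) <= 2 * (`|x - y| * (`|x| + `|y|)).
  have [xy|xy] := boolP ((- 2^-1 <= x) && (- 2^-1 <= y)).
    move/andP: xy => [x2 y2]; rewrite /u !max_l; [|lra|lra].
    have : 0 <= 2 * (`|x - y| * (`|x| + `|y|)) by rewrite mulr_ge0// mulr_ge0// addr_ge0.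
    by lra.
  (* When truncation is active at x or y, the sum of their absolute values is at least 1/2, so a
     bound linear in the distance of x and y is already of second order. *)
  have H3 : 1 <= 2 * (`|x| + `|y|).
    have := ler_norm (- x); have := ler_norm (- y); rewrite !normrN.
    have := normr_ge0 x; have := normr_ge0 y.
    by move: xy; rewrite negb_and -!ltNge => /orP[]; lra.
  apply: (@le_trans _ _ `|x - y|); last first.
    by rewrite mulrCA ler_peMr.
  have := ler_norm (x - y); have := ler_norm (- (x - y)); rewrite normrN.
  by rewrite /u /Num.max; case: ltP => ?; case: ltP => ? *; lra.
have := diff_le x y.
have : 0 <= `|x - y| * `|x| by rewrite mulr_ge0.
rewrite mulrDr in H2; rewrite mulrDr.
by move=> *; lra.
Qed.

(** For centred variables the linear part integrates to zero, so this estimate alone governs the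
    difference of the means of two truncated logarithms. *)
Lemma trunc_ln_second x y : `|trunc_ln x - trunc_ln y - (x - y)| <=
  4 * (`|x - y| * (`|x| + `|y|)).
Proof.
rewrite ler_norml trunc_ln_second1 andbT lerNl.
have := trunc_ln_second1 y x; rewrite distrC (addrC `|y|).
by apply: le_trans; lra.
Qed.

End truncated_log.

(** * Log-determinants of the partial Gram matrices *)

Section coordinate_projections.
Context {R : realType} (n : nat).

Definition coord_proj (m : nat) : 'M[R]_n :=
  \matrix_(i, j) ((i == j) && (i < m)%N)%:R.

Lemma coord_proj_mul (m m' : nat) : (m <= m')%N ->
  coord_proj m' *m coord_proj m = coord_proj m.
Proof.
move=> mm'; apply/matrixP => i j; rewrite !mxE (bigD1 i) //= big1 => [|k ki].
  rewrite !mxE eqxx /= addr0; case: (ltnP i m) => im.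
    by rewrite (leq_trans im mm') mul1r.
  by rewrite andbF mulr0.
by rewrite !mxE eq_sym (negbTE ki) mul0r.
Qed.

Lemma coord_projP (m : nat) : projector (coord_proj m).
Proof.
split; last exact: coord_proj_mul.
by apply/matrixP => i j; rewrite !mxE; case: eqVneq => [->|ij]; rewrite ?eqxx.
Qed.

Lemma coord_proj_tr (m : nat) : (m <= n)%N -> \tr (coord_proj m) = m%:R.
Proof.
move=> mn; rewrite /mxtrace.
under eq_bigr do rewrite mxE eqxx /=.
rewrite (eq_bigr (fun i : 'I_n => if (i < m)%N then 1 else 0)); last first.
  by move=> i _; case: ifP.
by rewrite -big_mkcond /= -(big_ord_widen n (fun=> 1))// sumr_const card_ord.
Qed.

Lemma measurable_gs_proj {d} {S : measurableType d} (P0 : 'M[R]_n)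
    (b : S -> nat -> 'cV[R]_n) (i : nat) :
  (forall k l, (k < i)%N -> measurable_fun setT (fun s => b s k l 0)) ->
  forall l l', measurable_fun setT (fun s => gs_proj P0 (b s) i l l').
Proof.
elim: i => [|i IH] mb l l' /=; first exact: measurable_cst.
have {}IH := IH (fun k l ki => mb k l (ltnW ki)).
have mPb j : measurable_fun setT (fun s => (gs_proj P0 (b s) i *m b s i) j 0).
  under eq_fun do rewrite mxE.
  by apply: measurable_sum => k; apply: measurable_funM => //; exact: mb.
have mq : measurable_fun setT (fun s => qform (gs_proj P0 (b s) i) (b s i)).
  under eq_fun do rewrite qformE.
  apply: measurable_sum => k; apply: measurable_sum => k'.
  by apply: measurable_funM => //; apply: measurable_funM; exact: mb.
rewrite /gs_step; under eq_fun do rewrite mxE [X in _ + X]mxE [X in _ - X]mxE.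
apply: measurable_funB => //; apply: measurable_funM.
  by apply: measurableT_comp => //; exact: measurable_inv.
under eq_fun do rewrite mxE big_ord1 [X in _ * X]mxE.
exact: measurable_funM.
Qed.

(* The normalizations by [m - i] and [m' - i] differ, whence the two terms. *)
Lemma frobenius2_gs_projB_scaled (b : nat -> 'cV[R]_n) (i m m' : nat) (c : R) :
  0 < c -> (m <= m' <= n)%N -> (i <= m)%N -> c * n%:R <= (m - i)%:R ->
  frobenius2 ((m' - i)%:R^-1 *: gs_proj (coord_proj m') b i -
              (m - i)%:R^-1 *: gs_proj (coord_proj m) b i) <=
  (2 / c ^+ 2 + 2 / c ^+ 4) * ((m' - m)%:R / n%:R) / n%:R.
Proof.
move=> c0 /andP[mm' m'n] im cn.
have [n0|n0] := posnP n.
  rewrite /frobenius2 big1 => [|k]; last by have := ltn_ord k; rewrite {2}n0.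
  by rewrite n0 invr0 !mulr0.
have nr : 0 < n%:R :> R by rewrite ltr0n.
set P' := gs_proj (coord_proj m') b i; set Pm := gs_proj (coord_proj m) b i.
set a' : R := (m' - i)%:R; set a : R := (m - i)%:R in cn *.
set h : R := (m' - m)%:R.
have cn0 : 0 < c * n%:R by rewrite mulr_gt0.
have a0 : 0 < a by exact: lt_le_trans cn.
have a'E : a' = a + h.
  by rewrite /a' /a /h -natrD; congr _%:R; move: mm' im; clear; lia.
have h0 : 0 <= h by rewrite /h.
have a'0 : 0 < a' by lra.
have hn : h <= n%:R by rewrite ler_nat; move: m'n; clear; lia.
have -> : a'^-1 *: P' - a^-1 *: Pm = (a'^-1 - a^-1) *: P' + a^-1 *: (P' - Pm).
  by rewrite scalerBl scalerBr addrA subrK.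
apply: le_trans (frobenius2D_le _ _) _; rewrite !frobenius2Z.
have HP' : frobenius2 P' <= n%:R.
  rewrite frobenius2_proj; last exact/gs_proj_projector/coord_projP.
  apply: le_trans (gs_proj_trace_le _ _ (coord_projP _)) _.
  by rewrite coord_proj_tr// ler_nat.
have HPP : frobenius2 (P' - Pm) <= h.
  apply: le_trans (frobenius2_gs_projB _ _ (coord_projP _) (coord_projP _) _) _.
    exact: coord_proj_mul.
  by rewrite !coord_proj_tr// ?(leq_trans mm')// -natrB.
have ia : a^-1 <= (c * n%:R)^-1 by rewrite lef_pV2.
have ia' : a'^-1 <= (c * n%:R)^-1 by rewrite lef_pV2// ?posrE//; lra.
have ia0 : 0 <= a^-1 by rewrite invr_ge0 ltW.
have ia'0 : 0 <= a'^-1 by rewrite invr_ge0 ltW.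
have icn0 : 0 <= (c * n%:R)^-1 by rewrite invr_ge0 ltW.
(* The change of normalisation contributes h^2 n / (c n)^4. The factor n / h, at least 1 as h <= n,
   brings it to first order in h like the other term. *)
have -> : (2 / c ^+ 2 + 2 / c ^+ 4) * (h / n%:R) / n%:R =
   2 * (((c * n%:R)^-1 ^+ 2 * h) ^+ 2 * n%:R * (n%:R / h)) + 2 * ((c * n%:R)^-1 ^+ 2 * h).
  have [->|hn0] := eqVneq h 0; first by rewrite !(mul0r, mulr0, expr0n, addr0).
  by field; rewrite hn0 !gt_eqF.
have H1 : (a^-1) ^+ 2 * frobenius2 (P' - Pm) <= (c * n%:R)^-1 ^+ 2 * h.
  by apply: ler_pM => //; [nneg|exact: frobenius2_ge0|exact: sqr_le].
have H2 : (a'^-1 - a^-1) ^+ 2 * frobenius2 P' <=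
    ((c * n%:R)^-1 ^+ 2 * h) ^+ 2 * n%:R * (n%:R / h).
  have [hE|hn0] := eqVneq h 0.
    by rewrite a'E hE addr0 subrr expr0n mul0r invr0 !mulr0.
  have hp : 0 < h by rewrite lt_neqAle eq_sym hn0.
  apply: (@le_trans _ _ (((c * n%:R)^-1 ^+ 2 * h) ^+ 2 * n%:R)); last first.
    rewrite ler_peMr//; first by nneg.
    by rewrite ler_pdivlMr// mul1r.
  apply: ler_pM => //; [by nneg|exact: frobenius2_ge0|].
  have -> : (a'^-1 - a^-1) ^+ 2 = (a^-1 * a'^-1 * h) ^+ 2.
    by rewrite a'E; field; rewrite -a'E !gt_eqF.
  apply: sqr_le; first by nneg.
  rewrite expr2; apply: ler_wpM2r => //.
  exact: ler_pM.
by lra.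
Qed.

Lemma frobenius2_gs_proj_scaled (b : nat -> 'cV[R]_n) (i m : nat) (c : R) :
  0 < c -> (m <= n)%N -> c * n%:R <= (m - i)%:R ->
  frobenius2 ((m - i)%:R^-1 *: gs_proj (coord_proj m) b i) <= (c ^+ 2)^-1 / n%:R.
Proof.
move=> c0 mn cn.
have [n0|n0] := posnP n.
  rewrite /frobenius2 big1 => [|k]; last by have := ltn_ord k; rewrite {2}n0.
  by rewrite n0 invr0 !mulr0.
have nr : 0 < n%:R :> R by rewrite ltr0n.
have cn0 : 0 < c * n%:R by rewrite mulr_gt0.
rewrite frobenius2Z frobenius2_proj; last exact/gs_proj_projector/coord_projP.
have -> : (c ^+ 2)^-1 / n%:R = (c * n%:R)^-1 ^+ 2 * n%:R.
  by field; rewrite !gt_eqF.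
have a0 : 0 < (m - i)%:R :> R by exact: lt_le_trans cn.
apply: ler_pM.
- by nneg.
- rewrite -frobenius2_proj ?frobenius2_ge0//.
  exact/gs_proj_projector/coord_projP.
- by apply: sqr_le; [rewrite invr_ge0 ltW|rewrite lef_pV2].
- apply: le_trans (gs_proj_trace_le _ _ (coord_projP _)) _.
  by rewrite coord_proj_tr// ler_nat.
Qed.

End coordinate_projections.

(** * Fourth moments of martingales with frozen past *)

Section compensated_martingale.
Context {R : realType} {d} {T : measurableType d} (P : probability T R).
Context {I : choiceType} (D : set I) (x : I -> {RV P >-> R}).
Hypothesis indep : mutually_independent D x.
Variables (N : nat) (Bef At : nat -> set I).
Hypothesis BefD : forall i, (i < N)%N -> Bef i `<=` D.
Hypothesis AtD : forall i, (i < N)%N -> At i `<=` D.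
Hypothesis BefAt : forall i, (i < N)%N -> Bef i `&` At i = set0.
Hypothesis BefBef : forall k i, (k < i < N)%N -> Bef k `<=` Bef i.
Hypothesis AtBef : forall k i, (k < i < N)%N -> At k `<=` Bef i.

Notation sigma J := (g_sigma_algebraType (events_of x J)).

(** The first argument of [F] carries the variables before step i, the second those of step i; the
    random variable of interest is the diagonal [F w w]. *)
Definition measurable_blocks (i : nat) (F : T -> T -> R) : Prop :=
  measurable_fun [set: (sigma (Bef i) * sigma (At i))%type]
    (fun z : (sigma (Bef i) * sigma (At i))%type => F z.1 z.2).

Lemma measurable_blocks_diag i F dS (S : measurableType dS) (idB : S -> sigma (Bef i))
    (idA : S -> sigma (At i)) :
  measurable_fun setT idB -> measurable_fun setT idA ->
  measurable_blocks i F -> measurable_fun setT (fun s => F (idB s) (idA s)).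
Proof.
move=> mB mA mF.
have := @measurableT_comp _ _ _ S (sigma (Bef i) * sigma (At i))%type _
  _ _ (fun s => (idB s, idA s)) mF.
by apply; exact/measurable_fun_pairP.
Qed.

Lemma measurable_blocks_r i F (w : T) : measurable_blocks i F ->
  measurable_fun setT (F w).
Proof.
move=> mF; apply: (measurable_blocks_diag (S := T)
  (idB := fun=> w) (idA := id)) mF; first exact: measurable_cst.
exact: measurable_to_events.
Qed.

Lemma measurable_blocks_diagT i F : measurable_blocks i F ->
  measurable_fun setT (fun w => F w w).
Proof.
by move=> mF; apply: (measurable_blocks_diag (S := T) (i := i)
  (idB := id) (idA := id)) mF; exact: measurable_to_events.
Qed.

Lemma blocks_integral_le i F (c : R) : (i < N)%N -> measurable_blocks i F ->
  (forall w w', 0 <= F w w') ->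
  (forall w, (\int[P]_w' (F w w')%:E <= c%:E)%E) ->
  (\int[P]_w (F w w)%:E <= c%:E)%E.
Proof.
move=> iN mF F0 Fc.
rewrite (@blocks_ge0 _ _ _ P _ D x indep (Bef i) (At i) (BefD iN) (AtD iN)
  (BefAt iN) (fun z => (F z.1 z.2)%:E)); last 2 first.
- exact/measurable_EFinP.
- by move=> z; rewrite lee_fin.
apply: (@le_trans _ _ (\int[P]_w c%:E)%E); last by rewrite int_cstE.
apply: ge0_le_integral => //=.
- by move=> w _; apply: integral_ge0 => w' _; rewrite lee_fin.
- apply: (@measurableT_comp _ _ _ T (sigma (Bef i)) _
    (fun w => \int[P]_w' (F w w')%:E)%E _ id); last exact: measurable_to_events.
  apply: (@blocks_measurable _ _ _ P _ x (Bef i) (At i) (fun z => (F z.1 z.2)%:E)).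
    exact/measurable_EFinP.
  by move=> z; rewrite lee_fin.
Qed.

(** The partial sum before step i depends on [Bef i] only and [F i w] has mean zero for each frozen
    [w], so the cross term of [L4_add] vanishes. Square roots of fourth moments then add up. *)
Lemma compensated_martingale (F : nat -> T -> T -> R) (c : nat -> R) :
  (forall i, (i < N)%N -> measurable_blocks i (F i)) ->
  (forall i, 0 <= c i) ->
  (forall i w, (i < N)%N -> \int[P]_w' (F i w w')%:E = 0)%E ->
  (forall i w, (i < N)%N ->
    (\int[P]_w' (F i w w' ^+ 4)%:E <= (c i ^+ 2)%:E)%E) ->
  (\int[P]_w ((\sum_(i < N) F i w w) ^+ 4)%:E <= ((4 * \sum_(i < N) c i) ^+ 2)%:E)%E.
Proof.
move=> mF c0 F0 Fc.
have mFd i (iN : (i < N)%N) := measurable_blocks_diagT (mF i iN).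
have Fd i : (i < N)%N -> (\int[P]_w (F i w w ^+ 4)%:E <= (c i ^+ 2)%:E)%E.
  move=> iN; apply: (@blocks_integral_le i (fun w w' => F i w w' ^+ 4)) => //.
  - by have := mF i iN; rewrite /measurable_blocks => ?; apply: measurable_funX.
  - by move=> w w'; nneg.
  - by move=> w; exact: Fc.
have Sle i : (i <= N)%N ->
  (\int[P]_w ((\sum_(k < i) F k w w) ^+ 4)%:E <= ((4 * \sum_(k < i) c k) ^+ 2)%:E)%E ->
  (i < N)%N -> (\int[P]_w ((\sum_(k < i) F k w w) ^+ 3 * F i w w)%:E = 0)%E.
  move=> _ Si iN.
  have aS : adapted x (Bef i) (fun w => \sum_(k < i) F k w w).
    apply: measurable_sum => k.
    have kN := ltn_trans (ltn_ord k) iN.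
    apply: (measurable_blocks_diag (S := sigma (Bef i)) (i := nat_of_ord k)
      (idB := id) (idA := id) _ _ (mF k kN)).
    - move=> _ B mB; rewrite setTI; apply: sub_sigma_algebra2 mB => _ [a aB [C mC ->]].
      by exists a; [apply: BefBef aB; rewrite ltn_ord|exists C].
    - move=> _ B mB; rewrite setTI; apply: sub_sigma_algebra2 mB => _ [a aB [C mC ->]].
      by exists a; [apply: AtBef aB; rewrite ltn_ord|exists C].
  have mS := adapted_measurable aS.
  pose h (z : (sigma (Bef i) * sigma (At i))%type) : \bar R :=
    ((\sum_(k < i) F k z.1 z.1) ^+ 3 * F i z.1 z.2)%:E.
  apply: (@blocks_eq0 _ _ _ P _ D x indep (Bef i) (At i) (BefD iN) (AtD iN)
    (BefAt iN) h).
  - apply/measurable_EFinP; apply: measurable_funM; last exact: (mF i iN).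
    by apply: measurable_funX; exact: (adapted_fst (J' := At i) aS).
  - exact: integrable_cube mS (mFd i iN) Si (Fd i iN).
  - move=> w; have := @integrable_cube _ _ _ P (fun _ => \sum_(k < i) F k w w) (F i w)
      ((\sum_(k < i) F k w w) ^+ 4) (c i ^+ 2).
    apply => //; [exact: measurable_blocks_r (mF i iN)|by rewrite int_cstE|exact: Fc].
  - move=> w; rewrite /h /=; under eq_integral do rewrite EFinM.
    rewrite integralZl//; first by rewrite F0// mule0.
    exact: integrable_L4 (measurable_blocks_r w (mF i iN)) (Fc i w iN).
have main i : (i <= N)%N ->
    (\int[P]_w ((\sum_(k < i) F k w w) ^+ 4)%:E <= ((4 * \sum_(k < i) c k) ^+ 2)%:E)%E.
  elim: i => [_|i IH iN].
    under eq_integral do rewrite big_ord0 expr0n.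
    by rewrite integral0 lee_fin big_ord0 mulr0 expr0n.
  under eq_integral do rewrite big_ord_recr /=.
  rewrite big_ord_recr /= mulrDr.
  apply: L4_add => //.
  - by apply: measurable_sum => k; exact: mFd (ltn_trans (ltn_ord k) iN).
  - exact: mFd.
  - by nneg.
  - exact/IH/ltnW.
  - exact: Fd.
  - by apply: Sle => //; [exact: ltnW|exact/IH/ltnW].
exact: main.
Qed.

End compensated_martingale.

Lemma pow4_le (R : realDomainType) (a b : R) : `|a| <= b -> a ^+ 4 <= b ^+ 4.
Proof.
move=> ab; have b0 : 0 <= b by exact: le_trans ab.
have -> : a ^+ 4 = `|a| ^+ 4 by rewrite -normrX ger0_norm//; nneg.
by rewrite ler_pXn2r// nnegrE.
Qed.

Lemma pow4D_le (R : realDomainType) (s t : R) :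
  (s + t) ^+ 4 <= 8 * s ^+ 4 + 8 * t ^+ 4.
Proof.
have := sqr_ge0 (s ^+ 2 - t ^+ 2); have := sqr_ge0 (s * (s - t)).
have := sqr_ge0 (t * (s - t)); have := sqr_ge0 ((s - t) ^+ 2); nra.
Qed.

(** * Means and fluctuations of truncated logarithms *)

Section truncated_log_moments.
Context {R : realType} {d} {T : measurableType d} (P : probability T R).

Lemma L2_of_L4 (f : T -> R) (v : R) : measurable_fun setT f -> 0 <= v ->
  (\int[P]_w (f w ^+ 4)%:E <= (v ^+ 2)%:E -> \int[P]_w (f w ^+ 2)%:E <= v%:E)%E.
Proof.
move=> mf v0 f4.
have -> : (\int[P]_w (f w ^+ 2)%:E = \int[P]_w (f w ^+ 2 * 1)%:E)%E.
  by apply: eq_integral => w _; rewrite mulr1.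
rewrite -[v in leRHS]mulr1; apply: int_cauchy => //.
- by mfun.
- by move=> w; rewrite mulr1; nneg.
- by under eq_integral do rewrite -exprM.
- by rewrite expr1n int_cstE.
Qed.

Lemma integrable_trunc_ln (f : T -> R) (c : R) : measurable_fun setT f ->
  (\int[P]_w (f w ^+ 4)%:E <= c%:E)%E ->
  P.-integrable setT (EFin \o (fun w => trunc_ln (f w))).
Proof.
move=> mf fc; apply: (le_integrable measurableT _ _
   (integrableZl measurableT 2 (integrable_L4 mf fc))).
  apply/measurable_EFinP; apply: measurableT_comp => //.
  exact: measurable_trunc_ln.
move=> w _ /=; rewrite lee_fin normrM (@ger0_norm _ 2)//.
by have := trunc_ln_lip (f w) 0; rewrite trunc_ln0 !subr0.
Qed.

Variables (f g : T -> R) (u v cf cg : R).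
Hypotheses (mf : measurable_fun setT f) (mg : measurable_fun setT g).
Hypotheses (u0 : 0 <= u) (v0 : 0 <= v).
Hypotheses (f4 : (\int[P]_w (f w ^+ 4)%:E <= (u ^+ 2)%:E)%E)
  (g4 : (\int[P]_w (g w ^+ 4)%:E <= (u ^+ 2)%:E)%E)
  (fg4 : (\int[P]_w ((f w - g w) ^+ 4)%:E <= (v ^+ 2)%:E)%E).
Hypotheses (f1 : (\int[P]_w (f w)%:E = 0)%E) (g1 : (\int[P]_w (g w)%:E = 0)%E).
Hypotheses (cfE : (\int[P]_w (trunc_ln (f w))%:E = cf%:E)%E)
  (cgE : (\int[P]_w (trunc_ln (g w))%:E = cg%:E)%E).

Let mtf : measurable_fun setT (fun w => trunc_ln (f w)).
Proof. by apply: measurableT_comp => //; exact: measurable_trunc_ln. Qed.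

Let mtg : measurable_fun setT (fun w => trunc_ln (g w)).
Proof. by apply: measurableT_comp => //; exact: measurable_trunc_ln. Qed.

(** As f and g are centred, f - g may be subtracted under the integral; [trunc_ln_second] and
    Cauchy-Schwarz then give sqrt(v u). For u of order 1/n and v of order r/n this is sqrt(r)/n,
    summable over the rows, unlike the Lipschitz bound sqrt(v). *)
Lemma trunc_ln_mean_diff : `|cf - cg| <= 8 * Num.sqrt (v * u).
Proof.
have if1 := integrable_L4 mf f4; have ig1 := integrable_L4 mg g4.
have itf := integrable_trunc_ln mf f4; have itg := integrable_trunc_ln mg g4.
have E1 : (\int[P]_w (trunc_ln (f w) - trunc_ln (g w) - (f w - g w))%:E = (cf - cg)%:E)%E.
  under eq_integral do rewrite !EFinB.
  rewrite integralB//; last exact: integrableB.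
    rewrite !integralB//; first by rewrite cfE cgE f1 g1 subee// sube0.
  exact: integrableB.
rewrite -lee_fin -[X in (X <= _)%E]abse_EFin -E1.
apply: le_trans (le_abse_integral _ _ _) _ => //.
  by apply/measurable_EFinP; mfun.
have mn (h : T -> R) : measurable_fun setT h -> measurable_fun setT (fun w => `|h w|).
  by move=> mh; exact: measurableT_comp.
have mfg : measurable_fun setT (fun w => `|f w - g w|) by apply: mn; mfun.
have mfn := mn _ mf; have mgn := mn _ mg.
apply: (@int_le _ _ _ _ _ (fun w => 4 * (`|f w - g w| * (`|f w| + `|g w|)))).
- by apply: mn; mfun.
- by mfun.
- by move=> w.
- by move=> w; exact: trunc_ln_second.
have -> : 8 * Num.sqrt (v * u) = 4 * (Num.sqrt v * Num.sqrt (4 * u)).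
  rewrite [X in _ = 4 * (_ * X)]sqrtrM// (_ : 4 = 2 ^+ 2); last by rewrite -natrX.
  by rewrite sqrtr_sqr ger0_norm// sqrtrM//; ring.
apply: int_scalele; [by mfun|by move=> w; nneg|by []|].
apply: int_cauchy; [by mfun|by mfun|by rewrite sqrtr_ge0|by rewrite sqrtr_ge0|by move=> w; nneg| |].
- rewrite sqr_sqrtr//.
  under eq_integral do rewrite -normrX ger0_norm ?sqr_ge0//.
  by apply: L2_of_L4 => //; mfun.
- rewrite sqr_sqrtr; last by rewrite mulr_ge0.
  apply: (@int_le _ _ _ _ _ (fun w => 2 * f w ^+ 2 + 2 * g w ^+ 2)).
  + by mfun.
  + by mfun.
  + by move=> w; nneg.
  + move=> w; have := sqr_ge0 (`|f w| - `|g w|).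
    have -> : f w ^+ 2 = `|f w| ^+ 2 by rewrite -normrX ger0_norm ?sqr_ge0.
    have -> : g w ^+ 2 = `|g w| ^+ 2 by rewrite -normrX ger0_norm ?sqr_ge0.
    by move: `|f w| `|g w| => s t; lra.
  + have -> : 4 * u = 2 * u + 2 * u by ring.
    apply: int_addle => //; [by mfun|by mfun|by move=> w; nneg|by move=> w; nneg| |].
      apply: int_scalele; [by mfun|by move=> w; nneg|by []|exact: L2_of_L4].
    apply: int_scalele; [by mfun|by move=> w; nneg|by []|exact: L2_of_L4].
Qed.

(** The Lipschitz bound handles the logarithms, [trunc_ln_mean_diff] their means; 256 is a round
    majorant of the resulting constants. *)
Lemma trunc_ln_centered_L4 :
  (\int[P]_w ((trunc_ln (f w) - cf - (trunc_ln (g w) - cg)) ^+ 4)%:E <=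
   ((256 * (1 + u) * v) ^+ 2)%:E)%E.
Proof.
apply: (@le_trans _ _ (8 * (16 * v ^+ 2) + 8 * (8 * Num.sqrt (v * u)) ^+ 4)%:E).
  apply: (@int_le _ _ _ _ _ (fun w => 8 * (16 * (f w - g w) ^+ 4) +
      8 * (8 * Num.sqrt (v * u)) ^+ 4)).
  - by mfun.
  - by mfun.
  - by move=> w; nneg.
  - move=> w.
    have H1 : (trunc_ln (f w) - trunc_ln (g w)) ^+ 4 <= 16 * (f w - g w) ^+ 4.
      have -> : 16 * (f w - g w) ^+ 4 = (2 * `|f w - g w|) ^+ 4.
        rewrite exprMn -normrX (@ger0_norm _ ((f w - g w) ^+ 4)); last by nneg.
        by ring.
      apply: pow4_le.
      exact: trunc_ln_lip.
    have H2 : (cf - cg) ^+ 4 <= (8 * Num.sqrt (v * u)) ^+ 4.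
      apply: pow4_le.
      exact: trunc_ln_mean_diff.
    have -> : trunc_ln (f w) - cf - (trunc_ln (g w) - cg) =
        (trunc_ln (f w) - trunc_ln (g w)) - (cf - cg) by ring.
    have := pow4D_le (trunc_ln (f w) - trunc_ln (g w)) (- (cf - cg)).
    have -> : (- (cf - cg)) ^+ 4 = (cf - cg) ^+ 4 by ring.
    by lra.
  - apply: int_addle; [by mfun|by mfun|by move=> w; nneg|by move=> w; nneg| |].
      apply: int_scalele; [by mfun|by move=> w; nneg|by []|].
      by apply: int_scalele; [by mfun|by move=> w; nneg|by []|].
    by rewrite int_cstE.
rewrite lee_fin.
have -> : (8 * Num.sqrt (v * u)) ^+ 4 = 4096 * (v * u) ^+ 2.
  rewrite exprMn (exprM (Num.sqrt _) 2 2) sqr_sqrtr; last by rewrite mulr_ge0.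
  by rewrite -natrX.
have := mulr_ge0 v0 u0; have := sqr_ge0 v; have := sqr_ge0 (v * u).
have -> : 256 * (1 + u) * v = 256 * v + 256 * (v * u) by ring.
move: (v * u) (v0) => a v0' *.
have : 0 <= v * a by rewrite mulr_ge0.
by lra.
Qed.

End truncated_log_moments.

Section truncated_log_moments_single.
Context {R : realType} {d} {T : measurableType d} (P : probability T R).
Variables (f : T -> R) (u cf : R).
Hypotheses (mf : measurable_fun setT f) (u0 : 0 <= u).
Hypotheses (f4 : (\int[P]_w (f w ^+ 4)%:E <= (u ^+ 2)%:E)%E)
  (f1 : (\int[P]_w (f w)%:E = 0)%E)
  (cfE : (\int[P]_w (trunc_ln (f w))%:E = cf%:E)%E).

Let g4 : (\int[P]_w (((fun=> 0) w : R) ^+ 4)%:E <= (u ^+ 2)%:E)%E.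
Proof. by rewrite int_cstE lee_fin expr0n sqr_ge0. Qed.

Let fg4 : (\int[P]_w ((f w - (fun=> 0) w) ^+ 4)%:E <= (u ^+ 2)%:E)%E.
Proof. by under eq_integral do rewrite subr0. Qed.

Let g1 : (\int[P]_w ((fun=> 0) w : R)%:E = 0)%E.
Proof. by rewrite int_cstE. Qed.

Let cgE : (\int[P]_w (trunc_ln ((fun=> 0) w : R))%:E = 0%:E)%E.
Proof.
transitivity (\int[P]_w (0 : R)%:E)%E; last by rewrite int_cstE.
by apply: eq_integral => w _; rewrite trunc_ln0.
Qed.

(** The case g = 0 and v = u of the comparison of two variables. *)
Lemma trunc_ln_mean_le : `|cf| <= 8 * u.
Proof.
have := trunc_ln_mean_diff mf (measurable_cst _) u0 u0 f4 g4 fg4 f1 g1 cfE cgE.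
by rewrite subr0 -expr2 sqrtr_sqr (ger0_norm u0).
Qed.

Lemma trunc_ln_single_L4 :
  (\int[P]_w ((trunc_ln (f w) - cf) ^+ 4)%:E <= ((256 * (1 + u) * u) ^+ 2)%:E)%E.
Proof.
have := trunc_ln_centered_L4 mf (measurable_cst _) u0 u0 f4 g4 fg4 f1 g1 cfE cgE.
apply: le_trans; rewrite le_eqVlt; apply/orP; left; apply/eqP.
by apply: eq_integral => w _; rewrite trunc_ln0 !subr0.
Qed.

End truncated_log_moments_single.

(** * Arithmetic of the constants of the log-determinant bound *)

Section numerals.
Context {R : realType}.
Implicit Types u v s w z : R.

Let compensator_const_ge u v : 0 <= v -> 8 * (8 ^+ 4 * u) <= 64 * (512 * (u + v)).
Proof.
move=> v0; have -> : 64 * (512 * (u + v)) = 8 * (8 ^+ 4 * u) + 64 * (512 * v) by ring.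
rewrite lerDl; apply: mulr_ge0; [exact: ler0n|].
by apply: mulr_ge0; [exact: ler0n|exact: v0].
Qed.

Lemma sum_shift (I : finType) (F G : I -> R) u v :
  u + \sum_i F i - (v + \sum_i G i) = u - v + \sum_i (F i - G i).
Proof. by rewrite sumrB opprD addrACA. Qed.

Lemma logdet_diff_bound u v s w z z' : 0 <= w * s -> 0 <= u * s -> z <= w * s ->
  z' <= 8 ^+ 4 * v * s -> 8 * z + 8 * z' <= 64 * (w + 512 * (u + v)) * s.
Proof.
move=> ws us zw zv.
have -> : 64 * (w + 512 * (u + v)) * s =
  8 * (w * s) + 8 * (8 ^+ 4 * v * s) + (56 * (w * s) + 64 * 512 * (u * s)) by ring.
apply: (@le_trans _ _ (8 * (w * s) + 8 * (8 ^+ 4 * v * s))).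
  by apply: lerD; apply: ler_wpM2l; [exact: ler0n|exact: zw|exact: ler0n|exact: zv].
rewrite lerDl; apply: addr_ge0; apply: mulr_ge0; [exact: ler0n|exact: ws| |exact: us].
by apply: mulr_ge0; exact: ler0n.
Qed.

Lemma logdet_bound u v (dz z z0 c g w : R) : 0 <= v -> dz <= w ->
  z <= 8 * dz + 8 * z0 -> g <= 8 * z + 8 * c -> c <= 8 ^+ 4 * u ->
  g <= 64 * (w + z0 + 512 * (u + v)).
Proof.
move=> /(compensator_const_ge u); move: (8 ^+ 4 * u) (512 * (u + v)) => q k.
by lra.
Qed.

End numerals.

(** * Log-determinant of the first m columns, uniformly in m *)

Section array.
Context {R : realType} {d} {T : measurableType d} (P : probability T R).
Context {I : choiceType} (D : set I) (x : I -> {RV P >-> R}).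
Hypothesis indep : mutually_independent D x.
Variables (M c : R).
Hypotheses (M1 : 1 <= M) (c0 : 0 < c).
Hypothesis x1 : forall a, D a -> (\int[P]_w (x a w)%:E = 0)%E.
Hypothesis x2 : forall a, D a -> (\int[P]_w (x a w ^+ 2)%:E = 1)%E.
Hypothesis x8 : forall a, D a -> (\int[P]_w (x a w ^+ 8)%:E <= M%:E)%E.
Variables (n p m0 : nat) (idx : nat -> nat -> I).
Hypothesis idx_inj : forall i k i' k', (i < p)%N -> (k < n)%N -> (i' < p)%N ->
  (k' < n)%N -> idx i k = idx i' k' -> i = i' /\ k = k'.
Hypothesis idxD : forall i k, (i < p)%N -> (k < n)%N -> D (idx i k).
Hypotheses (n0 : (0 < n)%N) (m0n : (m0 <= n)%N).
Hypothesis pm0 : p%:R + c * n%:R <= m0%:R :> R.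

Definition array_row (w : T) (i : nat) : 'cV[R]_n := \col_(k < n) x (idx i k) w.

(** m - i is the trace of the projection when none of the first i steps is degenerate, so the
    quadratic form is normalised to mean 1 in that case. *)
Definition array_proj (m i : nat) (w : T) : 'M[R]_n :=
  (m - i)%:R^-1 *: gs_proj (coord_proj n m) (array_row w) i.

(** The rows before i are taken at [w] and row i at [w']: for frozen [w] this is a centred quadratic
    form in independent entries, with a deterministic matrix. *)
Definition array_xi (m i : nat) (w w' : T) : R :=
  qform (array_proj m i w) (array_row w' i) - \tr (array_proj m i w).

Let Bef (i : nat) : set I := [set a | exists i', exists k,
  [/\ (i' < i)%N, (i' < p)%N, (k < n)%N & a = idx i' k]].
Let At (i : nat) : set I := [set a | exists2 k, (k < n)%N & a = idx i k].

Let nr0 : 0 < n%:R :> R. Proof. by rewrite ltr0n. Qed.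

Let pm : (p <= m0)%N.
Proof.
rewrite -(ler_nat R); apply: le_trans pm0; rewrite lerDl.
by rewrite mulr_ge0// ltW.
Qed.

Let pn : (p <= n)%N. Proof. exact: leq_trans pm m0n. Qed.

Let cn_le m i : (m0 <= m)%N -> (i <= p)%N -> c * n%:R <= (m - i)%:R.
Proof.
move=> mm ip; have im : (i <= m)%N by rewrite (leq_trans ip)// (leq_trans pm).
have : m0%:R <= m%:R :> R by rewrite ler_nat.
have : i%:R <= p%:R :> R by rewrite ler_nat.
by have := pm0; rewrite natrB//; lra.
Qed.

Let BefD i : (i < p)%N -> Bef i `<=` D.
Proof. by move=> ip a [i' [k [ii' i'p kn ->]]]; exact: idxD. Qed.

Let AtD i : (i < p)%N -> At i `<=` D.
Proof. by move=> ip a [k kn ->]; exact: idxD. Qed.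

Let BefAt i : (i < p)%N -> Bef i `&` At i = set0.
Proof.
move=> ip; apply/seteqP; split => // a [[i' [k [i'i i'p kn ->]]] [k' k'n E]].
by have [E' _] := idx_inj i'p kn ip k'n E; move: i'i; rewrite E' ltnn.
Qed.

Let BefBef k i : (k < i < p)%N -> Bef k `<=` Bef i.
Proof.
move=> /andP[ki ip] a [i' [l [i'k i'p ln ->]]].
by exists i', l; split => //; exact: ltn_trans ki.
Qed.

Let AtBef k i : (k < i < p)%N -> At k `<=` Bef i.
Proof.
move=> /andP[ki ip] a [l ln ->].
by exists k, l; split => //; exact: ltn_trans ip.
Qed.

(** The square root of the fourth moment is at most a1 / n for [array_xi], and a2 r / n for its
    increment from m to m', where r = (m' - m) / n. *)
Let a1 : R := quad_const M * (c ^+ 2)^-1.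
Let a2 : R := quad_const M * (2 / c ^+ 2 + 2 / c ^+ 4).

Let M0 : 0 <= quad_const M. Proof. exact: quad_const_ge0. Qed.

Let a10 : 0 <= a1. Proof. by rewrite mulr_ge0// invr_ge0 sqr_ge0. Qed.
Let a20 : 0 <= a2.
Proof. by rewrite mulr_ge0// addr_ge0// divr_ge0// exprn_ge0// ltW. Qed.

Let row_form_L4 (i : nat) (B : 'M[R]_n) : (i < p)%N ->
  (\int[P]_w ((qform B (array_row w i) - \tr B) ^+ 4)%:E <=
   ((quad_const M * frobenius2 B) ^+ 2)%:E)%E.
Proof.
move=> ip; apply: (quadratic_form_L4 indep (e := idx i)) => //.
- by move=> j k jn kn /(idx_inj ip jn ip kn)[].
- by move=> k kn; exact: idxD.
- by move=> k kn; apply/x1/idxD.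
- by move=> k kn; apply/x2/idxD.
- by move=> k kn; apply/x8/idxD.
Qed.

Let row_form_mean0 (i : nat) (B : 'M[R]_n) : (i < p)%N ->
  (\int[P]_w (qform B (array_row w i) - \tr B)%:E = 0)%E.
Proof.
move=> ip; apply: (quadratic_form_mean0 indep (e := idx i) (m := M)) => //.
- by move=> j k jn kn /(idx_inj ip jn ip kn)[].
- by move=> k kn; exact: idxD.
- by move=> k kn; apply/x1/idxD.
- by move=> k kn; apply/x2/idxD.
- by move=> k kn; apply/x8/idxD.
Qed.

Let xi_blocks m i : (i < p)%N -> measurable_blocks x Bef At i (array_xi m i).
Proof.
move=> ip; rewrite /measurable_blocks /array_xi /array_proj.
have mP l l' : measurable_fun
    [set: (g_sigma_algebraType (events_of x (Bef i)) *
           g_sigma_algebraType (events_of x (At i)))%type]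
    (fun z => gs_proj (coord_proj n m) (array_row z.1) i l l').
  apply: measurable_gs_proj => k j ki; rewrite /array_row.
  under eq_fun do rewrite mxE.
  apply: (adapted_fst (J := Bef i) (J' := At i) (f := x (idx k j))).
  apply: adapted_rv; exists k, (val j); split => //; last exact: ltn_ord.
  exact: ltn_trans ki ip.
have mb j : measurable_fun
    [set: (g_sigma_algebraType (events_of x (Bef i)) *
           g_sigma_algebraType (events_of x (At i)))%type]
    (fun z => array_row z.2 i j 0).
  rewrite /array_row; under eq_fun do rewrite mxE.
  apply: (adapted_snd (J := Bef i) (J' := At i) (f := x (idx i j))).
  by apply: adapted_rv; exists (val j) => //; exact: ltn_ord.
apply: measurable_funB.
  under eq_fun do rewrite qformE.
  apply: measurable_sum => k; apply: measurable_sum => l.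
  apply: measurable_funM; last by apply: measurable_funM; exact: mb.
  by under eq_fun do rewrite mxE; apply: measurable_funM => //; exact: mP.
apply: measurable_sum => k; under eq_fun do rewrite mxE.
by apply: measurable_funM => //; exact: mP.
Qed.

Let mxi m i w : (i < p)%N -> measurable_fun setT (array_xi m i w).
Proof. by move=> ip; exact: measurable_blocks_r w (xi_blocks m ip). Qed.

Let xi_mean0 m i w : (i < p)%N -> (\int[P]_w' (array_xi m i w w')%:E = 0)%E.
Proof. by move=> ip; exact: row_form_mean0. Qed.

Let xi_L4 m i w : (i < p)%N -> (m0 <= m <= n)%N ->
  (\int[P]_w' (array_xi m i w w' ^+ 4)%:E <= ((a1 / n%:R) ^+ 2)%:E)%E.
Proof.
move=> ip /andP[m0m mn]; apply: le_trans (row_form_L4 _ ip) _.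
rewrite lee_fin; apply: sqr_le; first by rewrite mulr_ge0// frobenius2_ge0.
rewrite /a1 -[leRHS]mulrA; apply: ler_wpM2l => //.
by apply: frobenius2_gs_proj_scaled => //; apply: cn_le => //; exact: ltnW.
Qed.

Let xi_diff_L4 m m' i w : (i < p)%N -> (m0 <= m <= m')%N -> (m' <= n)%N ->
  (\int[P]_w' ((array_xi m' i w w' - array_xi m i w w') ^+ 4)%:E <=
   ((a2 * ((m' - m)%:R / n%:R) / n%:R) ^+ 2)%:E)%E.
Proof.
move=> ip /andP[m0m mm'] m'n.
have -> : (\int[P]_w' ((array_xi m' i w w' - array_xi m i w w') ^+ 4)%:E =
  \int[P]_w' ((qform (array_proj m' i w - array_proj m i w) (array_row w' i) -
    \tr (array_proj m' i w - array_proj m i w)) ^+ 4)%:E)%E.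
  apply: eq_integral => w' _; rewrite /array_xi qformB linearB /=.
  by congr (_ ^+ 4)%:E; ring.
apply: le_trans (row_form_L4 _ ip) _.
rewrite lee_fin; apply: sqr_le; first by rewrite mulr_ge0// frobenius2_ge0.
rewrite /a2 -2![leRHS]mulrA; apply: ler_wpM2l => //.
rewrite mulrA; apply: frobenius2_gs_projB_scaled => //.
- by rewrite mm'.
- by rewrite (leq_trans (ltnW ip))// (leq_trans pm).
- by apply: cn_le => //; exact: ltnW.
Qed.

(* [trunc_ln] is bounded below by -1: the conditional mean is computed with a
   nonnegative integrand, for which Fubini gives measurability. *)
Let cmp m i (w : T) : R :=
  fine (\int[P]_w' (trunc_ln (array_xi m i w w') + 1)%:E)%E - 1.

Let mt m i w : (i < p)%N ->
  measurable_fun setT (fun w' => trunc_ln (array_xi m i w w')).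
Proof.
by move=> ip; apply: measurableT_comp; [exact: measurable_trunc_ln|exact: mxi].
Qed.

Let cmpE m i w : (i < p)%N -> (m0 <= m <= n)%N ->
  (\int[P]_w' (trunc_ln (array_xi m i w w'))%:E = (cmp m i w)%:E)%E.
Proof.
move=> ip mm.
have it := integrable_trunc_ln (mxi m w ip) (xi_L4 w ip mm).
have i1 : P.-integrable setT (EFin \o cst (1 : R)).
  exact: finite_measure_integrable_cst.
have E1 : (\int[P]_w' (trunc_ln (array_xi m i w w') + 1)%:E =
    \int[P]_w' (trunc_ln (array_xi m i w w'))%:E + 1)%E.
  under eq_integral do rewrite EFinD.
  rewrite integralD//; congr (_ + _)%E.
  by rewrite int_cstE.
have fi := integrable_fin_num measurableT it.
rewrite /cmp E1 -(fineK fi) -EFinD /= addrK.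
by [].
Qed.

Let cmp_blocks m i : (i < p)%N -> (m0 <= m <= n)%N ->
  measurable_fun [set: g_sigma_algebraType (events_of x (Bef i))] (cmp m i).
Proof.
move=> ip mm; rewrite /cmp; apply: measurable_funB => //.
apply: (@measurableT_comp _ _ _ (g_sigma_algebraType (events_of x (Bef i)))
  (\bar R) R fine _ (fun w => \int[P]_w' (trunc_ln (array_xi m i w w') + 1)%:E)%E).
  exact: fine_measurable.
apply: (@blocks_measurable _ _ _ P _ x (Bef i) (At i)
  (fun z => (trunc_ln (array_xi m i z.1 z.2) + 1)%:E)).
  apply/measurable_EFinP; apply: measurable_funD => //.
  apply: measurableT_comp; first exact: measurable_trunc_ln.
  exact: xi_blocks.
by move=> z; rewrite lee_fin -lerBlDr sub0r trunc_ln_ge.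
Qed.

Let ratio_le m m' : (m' <= n)%N -> 0 <= ((m' - m)%:R / n%:R : R) <= 1.
Proof.
move=> m'n; rewrite divr_ge0//= ler_pdivrMr// mul1r ler_nat.
exact: leq_trans (leq_subr _ _) m'n.
Qed.

Let u_le : a1 / n%:R <= a1.
Proof. by rewrite ler_pdivrMr// ler_peMr// ler1n. Qed.

Let u_ge0 : 0 <= a1 / n%:R. Proof. by rewrite divr_ge0. Qed.

Let v_ge0 m m' : 0 <= a2 * ((m' - m)%:R / n%:R) / n%:R.
Proof. by rewrite divr_ge0// mulr_ge0// divr_ge0. Qed.

Let cmp_diff m m' i w : (i < p)%N -> (m0 <= m <= m')%N -> (m' <= n)%N ->
  `|cmp m' i w - cmp m i w| <=
    8 * Num.sqrt (a2 * ((m' - m)%:R / n%:R) / n%:R * (a1 / n%:R)).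
Proof.
move=> ip /andP[m0m mm'] m'n.
have hm' : (m0 <= m' <= n)%N by rewrite (leq_trans m0m).
have hm : (m0 <= m <= n)%N by rewrite m0m (leq_trans mm').
apply: (@trunc_ln_mean_diff _ _ _ P (array_xi m' i w) (array_xi m i w)) => //.
- exact: mxi.
- exact: mxi.
- exact: xi_L4.
- exact: xi_L4.
- by apply: xi_diff_L4 => //; rewrite m0m.
- exact: xi_mean0.
- exact: xi_mean0.
- exact: cmpE.
- exact: cmpE.
Qed.

Let cmp_le m i w : (i < p)%N -> (m0 <= m <= n)%N ->
  `|cmp m i w| <= 8 * (a1 / n%:R).
Proof.
move=> ip hm.
exact: trunc_ln_mean_le (mxi m w ip) u_ge0 (xi_L4 w ip hm) (xi_mean0 m w ip) (cmpE w ip hm).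
Qed.

Let Z m w : R := \sum_(i < p) (trunc_ln (array_xi m i w w) - cmp m i w).

(** 1024 = 4 * 256, with 4 from [compensated_martingale] and 256 from [trunc_ln_centered_L4]. *)
Let K : R := 1024 * (1 + a1).

Let a11 : 0 <= 1 + a1. Proof. exact: addr_ge0. Qed.

Let K0 : 0 <= K. Proof. by rewrite /K mulr_ge0 ?ler0n. Qed.

Let c256 : 0 <= 256 * (1 + a1). Proof. by rewrite mulr_ge0 ?ler0n. Qed.

Let c256u : 0 <= 256 * (1 + a1 / n%:R).
Proof. by rewrite mulr_ge0 ?ler0n// addr_ge0. Qed.

Let c256le : 256 * (1 + a1 / n%:R) <= 256 * (1 + a1).
Proof. by apply: ler_wpM2l; [exact: ler0n|rewrite lerD2l]. Qed.

Let term_blocks m i : (i < p)%N -> (m0 <= m <= n)%N ->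
  measurable_blocks x Bef At i
    (fun w w' => trunc_ln (array_xi m i w w') - cmp m i w).
Proof.
move=> ip hm; rewrite /measurable_blocks; apply: measurable_funB.
  apply: measurableT_comp; first exact: measurable_trunc_ln.
  exact: xi_blocks.
exact: (adapted_fst (J := Bef i) (J' := At i) (cmp_blocks ip hm)).
Qed.

Let mZ m : (m0 <= m <= n)%N -> measurable_fun setT (Z m).
Proof.
move=> hm; apply: measurable_sum => i.
exact: measurable_blocks_diagT (term_blocks (ltn_ord i) hm).
Qed.

Let term_integrable m i w : (i < p)%N -> (m0 <= m <= n)%N ->
  P.-integrable setT (EFin \o (fun w' => trunc_ln (array_xi m i w w'))).
Proof. by move=> ip hm; exact: integrable_trunc_ln (mxi m w ip) (xi_L4 w ip hm). Qed.

Let term_mean0 m i w : (i < p)%N -> (m0 <= m <= n)%N ->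
  (\int[P]_w' (trunc_ln (array_xi m i w w') - cmp m i w)%:E = 0)%E.
Proof.
move=> ip hm; under eq_integral do rewrite EFinB.
rewrite integralB//.
- by rewrite cmpE// int_cstE subee.
- exact: term_integrable.
- exact: (finite_measure_integrable_cst P (cmp m i w) measurableT).
Qed.

Let term_centered_integrable m i w : (i < p)%N -> (m0 <= m <= n)%N ->
  P.-integrable setT (EFin \o (fun w' => trunc_ln (array_xi m i w w') - cmp m i w)).
Proof.
move=> ip hm; have := integrableB measurableT (term_integrable w ip hm)
  (finite_measure_integrable_cst P (cmp m i w) measurableT).
exact.
Qed.

(** Each of the p rows contributes O(r / n) to the square root of the fourth moment, and p <= n; the
    resulting r^2 is the exponent that [chaining] takes as input. *)
Let Z_diff_L4 m m' : (m0 <= m <= m')%N -> (m' <= n)%N ->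
  (\int[P]_w ((Z m' w - Z m w) ^+ 4)%:E <=
    ((K * a2) ^+ 2 * ((m' - m)%:R / n%:R) ^+ 2)%:E)%E.
Proof.
move=> /andP[m0m mm'] m'n.
have hm' : (m0 <= m' <= n)%N by rewrite (leq_trans m0m).
have hm : (m0 <= m <= n)%N by rewrite m0m (leq_trans mm').
have [r0 r1] := andP (ratio_le m m'n).
set r := (m' - m)%:R / n%:R in r0 r1 *.
pose F i w w' := trunc_ln (array_xi m' i w w') - cmp m' i w -
  (trunc_ln (array_xi m i w w') - cmp m i w).
have -> : (\int[P]_w ((Z m' w - Z m w) ^+ 4)%:E =
    \int[P]_w ((\sum_(i < p) F i w w) ^+ 4)%:E)%E.
  by apply: eq_integral => w _; rewrite /Z -sumrB.
pose cc : R := 256 * (1 + a1) * (a2 * r / n%:R).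
have cc0 : 0 <= cc.
  exact: mulr_ge0 c256 (v_ge0 m m').
apply: le_trans (compensated_martingale indep BefD AtD BefAt BefBef AtBef
  (F := F) (c := fun=> cc) _ _ _ _) _ => //.
- move=> i ip; rewrite /measurable_blocks /F; apply: measurable_funB.
    exact: term_blocks.
  exact: term_blocks.
- move=> i w ip; rewrite /F; under eq_integral do rewrite EFinB.
  rewrite integralB//; last exact: term_centered_integrable.
    rewrite -[RHS](sube0 0); congr (_ - _)%E.
      exact: (term_mean0 w ip hm').
    exact: (term_mean0 w ip hm).
  exact: term_centered_integrable.
- move=> i w ip.
  apply: le_trans (trunc_ln_centered_L4 (mxi m' w ip) (mxi m w ip) u_ge0
    (v_ge0 m m') (xi_L4 w ip hm') (xi_L4 w ip hm) _
    (xi_mean0 m' w ip) (xi_mean0 m w ip) (cmpE w ip hm') (cmpE w ip hm)) _.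
    by apply: xi_diff_L4 => //; rewrite m0m.
  rewrite lee_fin; apply: sqr_le.
    exact: mulr_ge0 c256u (v_ge0 m m').
  exact: ler_wpM2r (v_ge0 m m') _ _ c256le.
rewrite lee_fin -exprMn; apply: sqr_le.
  by apply: mulr_ge0 => //; apply: sumr_ge0.
rewrite sumr_const card_ord -(mulr_natl cc p) /cc.
have -> : 4 * (p%:R * (256 * (1 + a1) * (a2 * r / n%:R))) =
  K * a2 * r * (p%:R / n%:R) by rewrite /K; ring.
apply: ler_piMr; first by do 2 (apply: mulr_ge0 => //).
by rewrite ler_pdivrMr// mul1r ler_nat.
Qed.

Let Z_L4 m : (m0 <= m <= n)%N ->
  (\int[P]_w (Z m w ^+ 4)%:E <= ((K * a1) ^+ 2)%:E)%E.
Proof.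
move=> hm.
pose F i w w' := trunc_ln (array_xi m i w w') - cmp m i w.
pose cc : R := 256 * (1 + a1) * (a1 / n%:R).
have cc0 : 0 <= cc by exact: mulr_ge0 c256 u_ge0.
apply: le_trans (compensated_martingale indep BefD AtD BefAt BefBef AtBef
  (F := F) (c := fun=> cc) _ _ _ _) _ => //.
- by move=> i ip; exact: term_blocks.
- by move=> i w ip; exact: term_mean0.
- move=> i w ip.
  apply: le_trans (trunc_ln_single_L4 (mxi m w ip) u_ge0 (xi_L4 w ip hm)
    (xi_mean0 m w ip) (cmpE w ip hm)) _.
  rewrite lee_fin; apply: sqr_le; first exact: mulr_ge0 c256u u_ge0.
  exact: ler_wpM2r u_ge0 _ _ c256le.
rewrite lee_fin; apply: sqr_le.
  by apply: mulr_ge0 => //; apply: sumr_ge0.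
rewrite sumr_const card_ord -(mulr_natl cc p) /cc.
have -> : 4 * (p%:R * (256 * (1 + a1) * (a1 / n%:R))) =
  K * a1 * (p%:R / n%:R) by rewrite /K; ring.
apply: ler_piMr; first exact: mulr_ge0.
by rewrite ler_pdivrMr// mul1r ler_nat.
Qed.

Let mxd m i : (i < p)%N -> measurable_fun setT (fun w => array_xi m i w w).
Proof. by move=> ip; exact: measurable_blocks_diagT (xi_blocks m ip). Qed.

Let xi_diag_L4 m i : (i < p)%N -> (m0 <= m <= n)%N ->
  (\int[P]_w (array_xi m i w w ^+ 4)%:E <= ((a1 / n%:R) ^+ 2)%:E)%E.
Proof.
move=> ip hm; apply: (blocks_integral_le indep BefD AtD BefAt ip
  (F := fun w w' => array_xi m i w w' ^+ 4)).
- by have := xi_blocks m ip; rewrite /measurable_blocks => ?; apply: measurable_funX.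
- by move=> w w'; nneg.
- by move=> w; exact: xi_L4.
Qed.

Let xi_diag_diff_L4 m m' i : (i < p)%N -> (m0 <= m <= m')%N -> (m' <= n)%N ->
  (\int[P]_w ((array_xi m' i w w - array_xi m i w w) ^+ 4)%:E <=
   ((a2 / n%:R) ^+ 2 * ((m' - m)%:R / n%:R) ^+ 2)%:E)%E.
Proof.
move=> ip hm m'n; apply: (blocks_integral_le indep BefD AtD BefAt ip
  (F := fun w w' => (array_xi m' i w w' - array_xi m i w w') ^+ 4)).
- have := xi_blocks m ip; have := xi_blocks m' ip; rewrite /measurable_blocks => ? ?.
  by apply: measurable_funX; apply: measurable_funB.
- by move=> w w'; nneg.
- move=> w; apply: le_trans (xi_diff_L4 w ip hm m'n) _.
  rewrite lee_fin -exprMn; apply: sqr_le; first exact: v_ge0.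
  by rewrite mulrAC.
Qed.

Definition array_mx (w : T) : 'M[R]_(p, n) := \matrix_(i, j) array_row w i j 0.

Definition array_gram (m : nat) (w : T) : 'M[R]_p :=
  array_mx w *m coord_proj n m *m (array_mx w)^T.

Definition array_G (m : nat) (w : T) : R :=
  ln (\det (array_gram m w)) - \sum_(i < p) ln ((m - i)%:R).

(** The share of the compensators: 8 * 8^4 = 64 * 512, where 8 is the constant in the bounds on each
    [cmp]. *)
Let K3 : R := 512 * (a1 ^+ 4 + a1 ^+ 2 * a2 ^+ 2).

Definition array_const : R :=
  64 * (chain_const * (K * a2) ^+ 2 + (K * a1) ^+ 2 + K3) +
  (chain_const * a2 ^+ 2 + a1 ^+ 2).

Let K30 : 0 <= K3.
Proof.
rewrite /K3; apply: mulr_ge0; first exact: ler0n.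
by apply: addr_ge0; nneg.
Qed.

Let cc0 : 0 <= chain_const :> R. Proof. exact/ltW/chain_const_gt0. Qed.

(* On the event that all the [array_xi] are at least -1/2, no Gram-Schmidt
   step is degenerate, so that the projections have the expected traces. *)
Let gram_det m w : (m0 <= m <= n)%N ->
  (forall i, (i < p)%N -> - 2^-1 <= array_xi m i w w) ->
  0 < \det (array_gram m w) /\
  array_G m w = \sum_(i < p) trunc_ln (array_xi m i w w).
Proof.
move=> /andP[m0m mn] xi2.
have Pp i := gs_proj_projector (array_row w) i (coord_projP n m).
have mi0 i : (i < p)%N -> 0 < (m - i)%:R :> R.
  move=> ip; rewrite ltr0n subn_gt0 (leq_trans ip)//.
  exact: leq_trans pm m0m.
pose q i := qform (gs_proj (coord_proj n m) (array_row w) i) (array_row w i).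
have xiE i : array_xi m i w w = (m - i)%:R^-1 * (q i -
    \tr (gs_proj (coord_proj n m) (array_row w) i)).
  by rewrite /array_xi /array_proj qformZ linearZ /= mulrBr.
have tq i : (i <= p)%N ->
    \tr (gs_proj (coord_proj n m) (array_row w) i) = (m - i)%:R.
  elim: i => [_|i IH ip]; first by rewrite coord_proj_tr// subn0.
  have {}IH := IH (ltnW ip).
  rewrite /= gs_step_trace// -/(q i) IH.
  have mn0 : (m - i)%:R != 0 :> R by rewrite gt_eqF// mi0.
  move: (xi2 i ip); rewrite xiE IH mulrBr (mulVf mn0) => qi.
  have q0 : 0 < (m - i)%:R^-1 * q i by lra.
  have -> /= : q i != 0 by apply: contraTneq q0 => ->; rewrite mulr0 ltxx.
  have im : (i < m)%N by rewrite (leq_trans ip)// (leq_trans pm).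
  by rewrite -natrB ?subn_gt0// -subnDA addn1.
have qE i : (i < p)%N -> q i = (m - i)%:R * (1 + array_xi m i w w).
  move=> ip; rewrite xiE tq ?(ltnW ip)//.
  by field; rewrite gt_eqF// mi0.
have xi1 i : (i < p)%N -> 0 < 1 + array_xi m i w w.
  by move=> ip; have := xi2 i ip; lra.
have q0 i : (i < p)%N -> 0 < q i.
  by move=> ip; rewrite qE// mulr_gt0// ?mi0// xi1.
have detE : \det (array_gram m w) = \prod_(i < p) q i.
  rewrite /array_gram /array_mx.
  exact: det_gs_proj (array_row w) (coord_projP n m).
have lnprod k : (k <= p)%N -> 0 < \prod_(i < k) q i /\
    ln (\prod_(i < k) q i) = \sum_(i < k) ln (q i).
  elim: k => [_|k IH kp]; first by rewrite !big_ord0 ln1.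
  have [I0 IE] := IH (ltnW kp).
  rewrite !big_ord_recr /=; split; first by rewrite mulr_gt0// q0.
  by rewrite lnM ?posrE ?IE// q0.
have [d0 dE] := lnprod p (leqnn p).
rewrite detE; split => //.
rewrite /array_G detE dE -sumrB; apply: eq_bigr => i _.
have ip := ltn_ord i.
by rewrite qE// lnM ?posrE ?mi0 ?xi1// trunc_lnE ?xi2// addrC addKr.
Qed.

Let cmp_sum_le m w : (m0 <= m <= n)%N ->
  (\sum_(i < p) cmp m i w) ^+ 4 <= (8 * a1) ^+ 4.
Proof.
move=> hm; apply: pow4_le.
apply: le_trans (ler_norm_sum _ _ _) _.
apply: (@le_trans _ _ (\sum_(i < p) 8 * (a1 / n%:R))).
  by apply: ler_sum => i _; exact: cmp_le.
rewrite sumr_const card_ord -(mulr_natl _ p).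
have -> : p%:R * (8 * (a1 / n%:R)) = 8 * a1 * (p%:R / n%:R) by ring.
apply: ler_piMr; first exact: mulr_ge0.
by rewrite ler_pdivrMr// mul1r ler_nat.
Qed.

(** Over p rows the bounds of [cmp_diff] add up to a multiple of sqrt(r), with fourth power r^2. As
    r <= 1 this is weakened to sqrt(r), the modulus that chaining gives for the martingale. *)
Let cmp_sum_diff m m' w : (m0 <= m <= m')%N -> (m' <= n)%N ->
  (\sum_(i < p) (cmp m' i w - cmp m i w)) ^+ 4 <=
  8 ^+ 4 * (a1 ^+ 2 * a2 ^+ 2) * Num.sqrt ((m' - m)%:R / n%:R).
Proof.
move=> hm m'n; have [r0 r1] := andP (ratio_le m m'n).
set r := (m' - m)%:R / n%:R in r0 r1 *.
apply: (@le_trans _ _ ((8 * Num.sqrt (a2 * a1 * r)) ^+ 4)).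
  apply: pow4_le; apply: le_trans (ler_norm_sum _ _ _) _.
  apply: (@le_trans _ _ (\sum_(i < p) 8 * Num.sqrt (a2 * r / n%:R * (a1 / n%:R)))).
    by apply: ler_sum => i _; exact: cmp_diff.
  rewrite sumr_const card_ord -(mulr_natl _ p).
  have -> : a2 * r / n%:R * (a1 / n%:R) = (n%:R^-1) ^+ 2 * (a2 * a1 * r) by ring.
  rewrite sqrtrM ?sqr_ge0// sqrtr_sqr ger0_norm ?invr_ge0//.
  have -> : p%:R * (8 * (n%:R^-1 * Num.sqrt (a2 * a1 * r))) =
    8 * Num.sqrt (a2 * a1 * r) * (p%:R / n%:R) by ring.
  apply: ler_piMr; first by rewrite mulr_ge0// sqrtr_ge0.
  by rewrite ler_pdivrMr// mul1r ler_nat.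
rewrite exprMn (exprM (Num.sqrt _) 2 2) sqr_sqrtr; last first.
  by rewrite mulr_ge0// mulr_ge0.
have -> : (a2 * a1 * r) ^+ 2 = a1 ^+ 2 * a2 ^+ 2 * r ^+ 2 by ring.
rewrite [leRHS](_ : _ = 8 ^+ 4 * (a1 ^+ 2 * a2 ^+ 2 * Num.sqrt r)); last by ring.
apply: ler_wpM2l; first exact: exprn_ge0.
apply: ler_wpM2l; first by rewrite mulr_ge0// sqr_ge0.
have s0 := sqrtr_ge0 r.
have s1 : Num.sqrt r <= 1 by rewrite -[leRHS]sqrtr1; exact: ler_wsqrtr.
rewrite -{1}(sqr_sqrtr r0) -exprM; move: (Num.sqrt r) s0 s1 => s s0 s1.
by rewrite -[leRHS]expr1 ler_wiXn2l.
Qed.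

(** [V] carries size and modulus, with mean O(1). [W] bounds the fourth powers of all the
    [array_xi], in i and in m, up to a constant; its mean is O(1/n), so the event where the
    truncation is inactive has probability tending to 1. *)
Theorem array_logdet : exists V W : T -> R,
  [/\ measurable_fun setT V /\ measurable_fun setT W,
      (forall w, 0 <= V w) /\ (forall w, 0 <= W w),
      (\int[P]_w (V w)%:E <= array_const%:E)%E /\
      (\int[P]_w (W w)%:E <= (array_const / n%:R)%:E)%E &
      forall w, W w < 256^-1 ->
        (forall m, (m0 <= m <= n)%N ->
           0 < \det (array_gram m w) /\ array_G m w ^+ 4 <= V w) /\
        (forall m m', (m0 <= m <= m')%N -> (m' <= n)%N ->
           (array_G m' w - array_G m w) ^+ 4 <=
             V w * Num.sqrt ((m' - m)%:R / n%:R))].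
Proof.
pose L := (n - m0)%N.
have hL k : (k <= L)%N -> (m0 <= m0 + k <= n)%N.
  by move=> kL; rewrite leq_addr/= -(subnKC m0n) leq_add2l.
have hm00 : (m0 <= m0 <= n)%N by rewrite leqnn.
have Ln : (L <= n)%N by exact: leq_subr.
have [V1 [mV1 V10 EV1 HV1]] : exists V : T -> R, [/\ measurable_fun setT V,
    forall w, 0 <= V w,
    (\int[P]_w (V w)%:E <= (chain_const * (K * a2) ^+ 2)%:E)%E &
    forall w j k, (j <= k <= L)%N ->
      (Z (m0 + k)%N w - Z (m0 + j)%N w) ^+ 4 <= V w * Num.sqrt ((k - j)%:R / n%:R)].
  apply: (@chaining _ _ _ P (fun k => Z (m0 + k)%N)) => //.
  - exact: sqr_ge0.
  - by move=> k kL; apply: mZ; exact: hL.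
  - move=> j k /andP[jk kL].
    have -> : (k - j = (m0 + k) - (m0 + j))%N by rewrite subnDl.
    apply: Z_diff_L4; first by rewrite leq_addr leq_add2l.
    by have /andP[] := hL k kL.
(* Each row is chained in m. A union bound over the p rows and the n values of m, with fourth
   moments O(1/n^2), would only give O(1); chaining pays for the rows alone. *)
have HH (i : 'I_p) : exists Vi : T -> R,
    [/\ measurable_fun setT Vi, forall w, 0 <= Vi w,
    (\int[P]_w (Vi w)%:E <= (chain_const * (a2 / n%:R) ^+ 2)%:E)%E &
    forall w j k, (j <= k <= L)%N ->
      (array_xi (m0 + k)%N i w w - array_xi (m0 + j)%N i w w) ^+ 4 <=
        Vi w * Num.sqrt ((k - j)%:R / n%:R)].
  apply: (@chaining _ _ _ P (fun k w => array_xi (m0 + k)%N i w w)) => //.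
  - exact: sqr_ge0.
  - by move=> k kL; exact: mxd.
  - move=> j k /andP[jk kL].
    have -> : (k - j = (m0 + k) - (m0 + j))%N by rewrite subnDl.
    apply: xi_diag_diff_L4 => //; first by rewrite leq_addr leq_add2l.
    by have /andP[] := hL k kL.
have [Vx HVx] := boolp.choice HH.
pose V w := 64 * (V1 w + Z m0 w ^+ 4 + K3).
pose W w := \sum_(i < p) (Vx i w + array_xi m0 i w w ^+ 4).
have mZ0 : measurable_fun setT (Z m0) by exact: mZ.
have Z40 w : 0 <= Z m0 w ^+ 4 by nneg.
have V1Z w : 0 <= V1 w + Z m0 w ^+ 4 by exact: addr_ge0.
have mVZ : measurable_fun setT (fun w => V1 w + Z m0 w ^+ 4) by mfun.
have mVZK : measurable_fun setT (fun w => V1 w + Z m0 w ^+ 4 + K3) by mfun.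
have mW1 i : measurable_fun setT (fun w => Vx i w + array_xi m0 i w w ^+ 4).
  have [mVi _ _ _] := HVx i; have mxi0 := mxd m0 (ltn_ord i).
  by apply: measurable_funD => //; apply: measurable_funX.
have W10 i w : 0 <= Vx i w + array_xi m0 i w w ^+ 4.
  by have [_ Vi0 _ _] := HVx i; apply: addr_ge0 => //; nneg.
exists V, W; split.
- split; first by rewrite /V; apply: measurable_funM.
  exact: measurable_sum.
- split=> w; last by rewrite /W; apply: sumr_ge0.
  by rewrite /V; apply: mulr_ge0; [exact: ler0n|exact: addr_ge0].
- split.
    apply: (@le_trans _ _ (64 * (chain_const * (K * a2) ^+ 2 + (K * a1) ^+ 2 + K3))%:E).
      apply: int_scalele; [exact: mVZK|by move=> w; exact: addr_ge0|exact: ler0n|].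
      apply: int_addle => //; last by rewrite int_cstE.
      apply: int_addle => //; first by mfun.
      exact: Z_L4.
    rewrite lee_fin /array_const lerDl; apply: addr_ge0; last exact: sqr_ge0.
    by rewrite mulr_ge0// sqr_ge0.
  apply: (@le_trans _ _ (\sum_(i < p)
      (chain_const * (a2 / n%:R) ^+ 2 + (a1 / n%:R) ^+ 2))%:E).
    apply: int_sumle => // i.
    have [mVi Vi0 EVi _] := HVx i; have mxi0 := mxd m0 (ltn_ord i).
    apply: int_addle => //; [by mfun|by move=> w; nneg|].
    exact: xi_diag_L4.
  rewrite lee_fin sumr_const card_ord -(mulr_natl _ p).
  have -> : p%:R * (chain_const * (a2 / n%:R) ^+ 2 + (a1 / n%:R) ^+ 2) =
    (chain_const * a2 ^+ 2 + a1 ^+ 2) / n%:R * (p%:R / n%:R) by ring.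
  have C20 : 0 <= chain_const * a2 ^+ 2 + a1 ^+ 2.
    by apply: addr_ge0; [rewrite mulr_ge0// sqr_ge0|exact: sqr_ge0].
  apply: (@le_trans _ _ ((chain_const * a2 ^+ 2 + a1 ^+ 2) / n%:R)).
    apply: ler_piMr; first by rewrite divr_ge0.
    by rewrite ler_pdivrMr// mul1r ler_nat.
  apply: ler_wpM2r; first by rewrite invr_ge0.
  rewrite /array_const lerDr; apply: mulr_ge0; first exact: ler0n.
  by apply: addr_ge0 => //; apply: addr_ge0; [rewrite mulr_ge0// sqr_ge0|exact: sqr_ge0].
move=> w Ww.
have xi2 m i : (m0 <= m <= n)%N -> (i < p)%N -> - 2^-1 <= array_xi m i w w.
  move=> /andP[m0m mn] ip; pose i' := Ordinal ip.
  have [_ Vi0 _ Hi] := HVx i'.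
  have kL : (0 <= m - m0 <= L)%N by rewrite /= leq_sub2r.
  have := Hi w 0%N (m - m0)%N kL; rewrite addn0 subnKC// subn0 => H1.
  have H2 : (array_xi m i w w - array_xi m0 i w w) ^+ 4 <= Vx i' w.
    apply: le_trans H1 _; apply: ler_piMr => //.
    rewrite -[leRHS]sqrtr1; apply: ler_wsqrtr.
    by have /andP[] := ratio_le m0 mn.
  have H3 : Vx i' w + array_xi m0 i w w ^+ 4 <= W w.
    rewrite /W (bigD1 i') //= lerDl.
    by apply: sumr_ge0 => ? _.
  have H4 := pow4D_le (array_xi m i w w - array_xi m0 i w w) (array_xi m0 i w w).
  rewrite subrK in H4.
  rewrite leNgt; apply/negP => lt2.
  (* The fourth power is at most 8 W < 8/256 = 1/32, which is below (1/2)^4 = 1/16. *)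
  have : 2^-1 ^+ 4 <= array_xi m i w w ^+ 4.
    have -> : array_xi m i w w ^+ 4 = (- array_xi m i w w) ^+ 4 by ring.
    by apply: pow4_le; rewrite ger0_norm ?invr_ge0//; lra.
  by move: H2 H3 H4 Ww; lra.
have GE m : (m0 <= m <= n)%N -> 0 < \det (array_gram m w) /\
    array_G m w = Z m w + \sum_(i < p) cmp m i w.
  move=> hm; have [d0 ->] := gram_det hm (fun i => xi2 m i hm).
  by split => //; rewrite /Z sumrB subrK.
have HZ m m' : (m0 <= m <= m')%N -> (m' <= n)%N ->
    (Z m' w - Z m w) ^+ 4 <= V1 w * Num.sqrt ((m' - m)%:R / n%:R).
  move=> /andP[m0m mm'] m'n.
  have jkL : (m - m0 <= m' - m0 <= L)%N by rewrite !leq_sub2r.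
  have := HV1 w _ _ jkL; rewrite !subnKC// ?(leq_trans m0m)//.
  have -> // : (m' - m0 - (m - m0) = m' - m)%N.
  by move: m0m mm'; clear; lia.
split=> [m hm|m m' hm m'n].
  have [d0 ->] := GE m hm; split => //.
  have /andP[m0m mn] := hm.
  have H1 : (Z m w - Z m0 w) ^+ 4 <= V1 w.
    apply: le_trans (HZ m0 m _ mn) _; first by rewrite leqnn.
    apply: ler_piMr => //; rewrite -[leRHS]sqrtr1; apply: ler_wsqrtr.
    by have /andP[] := ratio_le m0 mn.
  have H2 := pow4D_le (Z m w - Z m0 w) (Z m0 w); rewrite subrK in H2.
  have H3 := pow4D_le (Z m w) (\sum_(i < p) cmp m i w).
  have H4 := cmp_sum_le w hm.
  have a2212 : 0 <= a1 ^+ 2 * a2 ^+ 2 by nneg.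
  rewrite exprMn in H4; exact: (logdet_bound a2212 H1 H2 H3 H4).
have /andP[m0m mm'] := hm.
have hm1 : (m0 <= m <= n)%N by rewrite m0m (leq_trans mm').
have hm2 : (m0 <= m' <= n)%N by rewrite (leq_trans m0m).
have [_ ->] := GE m' hm2; have [_ ->] := GE m hm1.
have -> : Z m' w + \sum_(i < p) cmp m' i w - (Z m w + \sum_(i < p) cmp m i w) =
  (Z m' w - Z m w) + \sum_(i < p) (cmp m' i w - cmp m i w).
  exact: sum_shift.
apply: le_trans (pow4D_le _ _) _.
have H1 := HZ m m' hm m'n; have H2 := cmp_sum_diff w hm m'n.
set s := Num.sqrt _ in H1 H2 *; have s0 : 0 <= s by exact: sqrtr_ge0.
apply: (@le_trans _ _ (64 * (V1 w + K3) * s)).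
  have : 0 <= V1 w * s by exact: mulr_ge0.
  have : 0 <= a1 ^+ 4 * s by apply: mulr_ge0 => //; nneg.
  by move=> us ws; exact: logdet_diff_bound.
apply: ler_wpM2r => //; rewrite /V; apply: ler_wpM2l; first exact: ler0n.
by rewrite lerD2r lerDl.
Qed.

End array.

(** * The deterministic centering *)

Section centering.
Context {R : realType}.

(** The share of one block of size m in the centering, the normalisation by m of its sample
    covariance included. The term -p comes from Stirling's formula; it cancels in the process, where
    the block weights sum to zero. *)
Definition log_center (p m : nat) : R :=
  p%:R * ln m%:R - p%:R - (m%:R - p%:R - 2^-1) * ln (1 - p%:R / m%:R).

Definition center_err (p m : nat) : R :=
  \sum_(i < p) ln (m - i)%:R - log_center p m.

(** The logarithm of the ratio of k! to its Stirling approximation, up to an additive constant. Only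
    the size of its increments matters here, not its limit. *)
Let stirling (k : nat) : R :=
  \sum_(j < k) ln j.+1%:R - (k%:R + 2^-1) * ln k%:R + k%:R.

Let sum_ln p m : (p <= m)%N ->
  \sum_(i < p) ln (m - i)%:R =
  \sum_(j < m) ln j.+1%:R - \sum_(j < m - p) ln j.+1%:R :> R.
Proof.
elim: p => [|p IH] pm; first by rewrite big_ord0 subn0 subrr.
rewrite big_ord_recr /= IH ?(ltnW pm)//.
have -> : (m - p = (m - p.+1).+1)%N by rewrite -subSn.
by rewrite [in X in _ - X + _]big_ord_recr /=; ring.
Qed.

Let center_errE p m : (p < m)%N -> center_err p m =
  stirling m - stirling (m - p) + (ln m%:R - ln (m - p)%:R).
Proof.
move=> pm; have m0 : 0 < m%:R :> R by rewrite ltr0n (leq_trans _ pm).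
have mp0 : 0 < (m - p)%:R :> R by rewrite ltr0n subn_gt0.
rewrite /center_err sum_ln ?(ltnW pm)// /log_center /stirling.
have -> : 1 - p%:R / m%:R = (m - p)%:R / m%:R :> R.
  by rewrite natrB ?(ltnW pm)// mulrBl divff// gt_eqF.
rewrite ln_div ?posrE//.
move: (\sum_(j < m) _) (\sum_(j < m - p) _) (ln m%:R) (ln (m - p)%:R) => S1 S2 l1 l2.
by rewrite natrB ?(ltnW pm)//; lra.
Qed.

(** From 1/(k+1) <= ln(k+1) - ln k <= 1/k, multiplied by k + 1/2. *)
Let stirling_step k : (0 < k)%N -> `|stirling k.+1 - stirling k| <= k%:R^-1.
Proof.
move=> k0; have kr : 0 < k%:R :> R by rewrite ltr0n.
have kr1 : 0 < k.+1%:R :> R by rewrite ltr0n.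
have l1 := ln_sub_le kr1 kr; have l2 := ln_sub_le kr kr1.
have E : stirling k.+1 - stirling k = 1 - (k%:R + 2^-1) * (ln k.+1%:R - ln k%:R).
  by rewrite /stirling big_ord_recr /= -[k.+1%:R]natr1; ring.
rewrite E; move: (ln k.+1%:R) (ln k%:R) l1 l2 => a b.
rewrite -natr1 (addrC k%:R) addrK mul1r => l1.
have -> : k%:R - (1 + k%:R) = -1 :> R by ring.
rewrite mulN1r => l2.
have h0 : 0 <= k%:R + 2^-1 :> R by rewrite addr_ge0.
have i0 : 0 < k%:R^-1 :> R by rewrite invr_gt0.
have := ler_wpM2l h0 l1.
have -> : (k%:R + 2^-1) * k%:R^-1 = 1 + 2^-1 * k%:R^-1 :> R.
  by field; rewrite gt_eqF.
move=> l1'.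
have l3 : (1 + k%:R)^-1 <= a - b by lra.
have := ler_wpM2l h0 l3.
have -> : (k%:R + 2^-1) * (1 + k%:R)^-1 = 1 - 2^-1 * (1 + k%:R)^-1 :> R.
  by field; rewrite -natr1 in kr1; rewrite addrC gt_eqF.
have i1 : (1 + k%:R)^-1 <= k%:R^-1 :> R.
  by rewrite lef_pV2 ?posrE// ?lerDr// addrC natr1.
move=> l3'; rewrite ler_norml; apply/andP; split; lra.
Qed.

Lemma telescope_le (s : nat -> R) (e : R) (k l : nat) : (k <= l)%N ->
  (forall j, (k <= j < l)%N -> `|s j.+1 - s j| <= e) ->
  `|s l - s k| <= (l - k)%:R * e.
Proof.
elim: l => [|l IH] kl H.
  by move: kl; rewrite leqn0 => /eqP->; rewrite subrr normr0 mul0r.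
move: kl; rewrite leq_eqVlt => /predU1P[->|kl].
  by rewrite subrr normr0 subnn mul0r.
apply: le_trans (ler_distD (s l) _ _) _.
rewrite subSn// -natr1 mulrDl mul1r [leLHS]addrC lerD//.
  by apply: IH => // j /andP[kj jl]; apply: H; rewrite kj ltnW.
by apply: H; rewrite leqnn andbT.
Qed.

(** By [center_errE] the error consists of [stirling] and [ln], each at m and at m - p. Both
    arguments stay above c n, so a unit step in m costs at most 4 / (c n); the difference of each
    function between m - p and m is at most p / (c n) <= 1 / c. *)
Lemma center_err_bounds (c : R) (p n m0 : nat) : 0 < c -> (0 < n)%N ->
  p%:R + c * n%:R <= m0%:R ->
  (forall m, (m0 <= m <= n)%N -> `|center_err p m| <= 2 / c) /\
  (forall m m', (m0 <= m <= m')%N -> (m' <= n)%N ->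
    `|center_err p m' - center_err p m| <= 4 / c * ((m' - m)%:R / n%:R)).
Proof.
move=> c0 n0 pm0; have nr0 : 0 < n%:R :> R by rewrite ltr0n.
have cn0 : 0 < c * n%:R by exact: mulr_gt0.
have pm m : (m0 <= m)%N -> (p < m)%N.
  move=> m0m; rewrite -(ltr_nat R); have : m0%:R <= m%:R :> R by rewrite ler_nat.
  lra.
have mp m : (m0 <= m)%N -> c * n%:R <= (m - p)%:R.
  move=> m0m; rewrite natrB ?(ltnW (pm _ m0m))//.
  have : m0%:R <= m%:R :> R by rewrite ler_nat.
  lra.
have inv_le k : c * n%:R <= k%:R -> (0 < k)%N /\ k%:R^-1 <= (c * n%:R)^-1.
  move=> ck; have k0 : 0 < k%:R :> R by exact: lt_le_trans ck.
  by rewrite lef_pV2 ?posrE//; split => //; rewrite -(ltr0n R).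
split=> [m /andP[m0m mn]|m m' /andP[m0m mm'] m'n].
  have mpc := mp _ m0m; have pltm := pm _ m0m.
  rewrite center_errE//.
  have h1 : `|stirling m - stirling (m - p)| <= (m - (m - p))%:R * (c * n%:R)^-1.
    apply: telescope_le; first exact: leq_subr.
    move=> j /andP[j1 _]; have [|j0 j2] := inv_le j.
      by apply: le_trans mpc _; rewrite ler_nat.
    exact: le_trans (stirling_step j0) j2.
  rewrite subKn ?(ltnW pltm)// in h1.
  have pn1 : p%:R * (c * n%:R)^-1 <= c^-1.
    rewrite invfM mulrCA ler_piMr ?invr_ge0 ?(ltW c0)//.
    rewrite ler_pdivrMr// mul1r ler_nat.
    exact: leq_trans (ltnW pltm) mn.
  have m1 : 0 < m%:R :> R by rewrite ltr0n (leq_trans _ pltm).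
  have m2 : 0 < (m - p)%:R :> R by rewrite ltr0n subn_gt0.
  have h2 := ln_sub_le m1 m2.
  have h3 : ln (m - p)%:R <= ln m%:R :> R.
    by rewrite ler_ln ?posrE// ler_nat leq_subr.
  have h4 : (m%:R - (m - p)%:R) / (m - p)%:R <= p%:R * (c * n%:R)^-1.
    have -> : m%:R - (m - p)%:R = p%:R :> R by rewrite natrB ?(ltnW pltm)//; ring.
    by apply: ler_wpM2l => //; have [] := inv_le _ mpc.
  rewrite (le_trans (ler_normD _ _))// [`|ln _ - _|]ger0_norm ?subr_ge0//.
  have := le_trans h2 h4; lra.
have -> : 4 / c * ((m' - m)%:R / n%:R) = (m' - m)%:R * (4 * (c * n%:R)^-1).
  by rewrite invfM; ring.
apply: telescope_le => // k /andP[mk km'].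
have m0k := leq_trans m0m mk; have m0k1 := leqW m0k.
rewrite !center_errE ?pm//.
have kp := mp _ m0k; have [kp0 kpi] := inv_le _ kp.
have kc : c * n%:R <= k%:R by rewrite (le_trans kp)// ler_nat leq_subr.
have [k0 ki] := inv_le _ kc.
rewrite (subSn (ltnW (pm _ m0k))).
have h1 := le_trans (stirling_step k0) ki.
have h2 := le_trans (stirling_step kp0) kpi.
have lnS j : (0 < j)%N -> `|ln j.+1%:R - ln j%:R| <= j%:R^-1 :> R.
  move=> j0; have jr : 0 < j%:R :> R by rewrite ltr0n.
  rewrite ger0_norm ?subr_ge0 ?ler_ln ?posrE ?ler_nat ?ltr0n//.
  apply: le_trans (ln_sub_le _ jr) _; first by rewrite ltr0n.
  by rewrite -natr1 (addrC j%:R) addrK mul1r.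
have h3 := le_trans (lnS _ k0) ki.
have h4 := le_trans (lnS _ kp0) kpi.
move: h1 h2 h3 h4; rewrite !ler_norml => /andP[? ?] /andP[? ?] /andP[? ?] /andP[? ?].
apply/andP; split; lra.
Qed.

End centering.

(** * The kurtosis estimator and the covariance square root *)

Section kurtosis.
Context {R : realType}.

Lemma sum_sqr_shift (n : nat) (a : nat -> R) (c : R) :
  \sum_(1 <= i < n.+1) (a i - c) ^+ 2 =
  \sum_(1 <= i < n.+1) a i ^+ 2 - 2 * c * \sum_(1 <= i < n.+1) a i + n%:R * c ^+ 2.
Proof.
rewrite (eq_bigr (fun i => a i ^+ 2 - 2 * c * a i + c ^+ 2)); last by move=> i _; ring.
rewrite big_split /= big_split /= sumr_const_nat subn1 /= sumrN -mulr_sumr.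
by rewrite -(mulr_natl (c ^+ 2)).
Qed.

Lemma sum_sqr_mean_le (n : nat) (a : nat -> R) (c : R) :
  \sum_(1 <= i < n.+1) (a i - n%:R^-1 * \sum_(1 <= j < n.+1) a j) ^+ 2 <=
  \sum_(1 <= i < n.+1) (a i - c) ^+ 2.
Proof.
case: n => [|n]; first by rewrite !big_geq.
have n0 : n.+1%:R != 0 :> R by rewrite pnatr_eq0.
rewrite !sum_sqr_shift; move: (\sum_(1 <= i < n.+2) a i) => s.
move: (\sum_(1 <= i < n.+2) a i ^+ 2) => q.
rewrite -subr_ge0.
have -> : q - 2 * c * s + n.+1%:R * c ^+ 2 -
    (q - 2 * (n.+1%:R^-1 * s) * s + n.+1%:R * (n.+1%:R^-1 * s) ^+ 2) =
  n.+1%:R^-1 * (s - n.+1%:R * c) ^+ 2 by field.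
by rewrite mulr_ge0 ?sqr_ge0// invr_ge0.
Qed.

Lemma sqr_mean_le (n : nat) (a : nat -> R) :
  (n%:R^-1 * \sum_(1 <= i < n.+1) a i) ^+ 2 <=
  n%:R^-1 * \sum_(1 <= i < n.+1) a i ^+ 2.
Proof.
case: n => [|n]; first by rewrite invr0 !mul0r expr0n.
have n0 : n.+1%:R != 0 :> R by rewrite pnatr_eq0.
have : 0 <= \sum_(1 <= i < n.+2) (a i - n.+1%:R^-1 * \sum_(1 <= j < n.+2) a j) ^+ 2.
  by apply: sumr_ge0 => i _; exact: sqr_ge0.
rewrite sum_sqr_shift; move: (\sum_(1 <= i < n.+2) a i) => s.
move: (\sum_(1 <= i < n.+2) a i ^+ 2) => q.
have -> : q - 2 * (n.+1%:R^-1 * s) * s + n.+1%:R * (n.+1%:R^-1 * s) ^+ 2 =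
  n.+1%:R * (n.+1%:R^-1 * q - (n.+1%:R^-1 * s) ^+ 2) by field.
by rewrite pmulr_rge0 ?ltr0n// subr_ge0.
Qed.

Lemma sqr_sum_ord_le (p : nat) (a : 'I_p -> R) :
  (\sum_i a i) ^+ 2 <= p%:R * \sum_i a i ^+ 2.
Proof.
case: p a => [|p] a; first by rewrite !big_ord0 mul0r expr0n.
have p0 : 0 < p.+1%:R :> R by rewrite ltr0n.
pose b i := oapp a 0 (insub i.-1).
have := sqr_mean_le p.+1 b; rewrite !big_add1 !big_mkord /=.
have bE (i : 'I_p.+1) : b i.+1 = a i by rewrite /b /= valK.
under eq_bigr do rewrite bE; under [in leRHS]eq_bigr do rewrite bE.
rewrite exprMn -(ler_pM2l (exprn_gt0 2 p0)) mulrA -exprMn mulfV ?gt_eqF// expr1n mul1r.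
by rewrite mulrA expr2 -(mulrA p.+1%:R) mulfV ?gt_eqF// mulr1.
Qed.

Definition dotc (p : nat) (u v : 'cV[R]_p) : R := \sum_j u j 0 * v j 0.

Lemma sqnorm2_ge0 (p : nat) (u : 'cV[R]_p) : 0 <= sqnorm2 u.
Proof. by apply: sumr_ge0 => j _; exact: sqr_ge0. Qed.

Lemma sqnorm2BZ (p : nat) (u v : 'cV[R]_p) (t : R) :
  sqnorm2 (u - t *: v) = sqnorm2 u - 2 * t * dotc u v + t ^+ 2 * sqnorm2 v.
Proof.
rewrite /sqnorm2 /dotc !mulr_sumr -sumrB -big_split /=.
by apply: eq_bigr => j _; rewrite !mxE; ring.
Qed.

Lemma dotc_sqr_le (p : nat) (u v : 'cV[R]_p) :
  dotc u v ^+ 2 <= sqnorm2 u * sqnorm2 v.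
Proof.
have [v0|v0] := eqVneq (sqnorm2 v) 0.
  suff -> : dotc u v = 0 by rewrite v0 mulr0 expr0n.
  apply: big1 => j _.
  have := v0; rewrite /sqnorm2 => /eqP; rewrite psumr_eq0; last first.
    by move=> i _; exact: sqr_ge0.
  by move=> /allP/(_ j); rewrite mem_index_enum sqrf_eq0 /= => /(_ isT)/eqP->; rewrite mulr0.
have vp : 0 < sqnorm2 v by rewrite lt_neqAle eq_sym v0 sqnorm2_ge0.
have := sqnorm2_ge0 (u - (dotc u v / sqnorm2 v) *: v); rewrite sqnorm2BZ.
have -> : sqnorm2 u - 2 * (dotc u v / sqnorm2 v) * dotc u v +
    (dotc u v / sqnorm2 v) ^+ 2 * sqnorm2 v = sqnorm2 u - dotc u v ^+ 2 / sqnorm2 v.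
  by field.
by rewrite subr_ge0 ler_pdivrMr.
Qed.

Section bounds.
Variables (p n : nat) (y : nat -> 'cV[R]_p).
Hypotheses (p1 : (0 < p)%N) (pn : (p <= n)%N) (n2 : (1 < n)%N).

Let nr0 : 0 < n%:R :> R. Proof. by rewrite ltr0n (leq_trans _ n2). Qed.
Let n10 : 0 < n%:R - 1 :> R. Proof. by rewrite subr_gt0 ltr1n. Qed.
Let pr0 : 0 < p%:R :> R. Proof. by rewrite ltr0n. Qed.

(** tr C^2 dominates the sum of squares of the diagonal, which is at least (tr C)^2 / p, and p <= n.
    The sign suffices: [tau_hat] enters [kappa_hat] negatively, and [kappa_hat] is bounded below by
    1. *)
Lemma tau_hat_ge0 : 0 <= tau_hat n y.
Proof.
rewrite /tau_hat; set C := scov_cen n y.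
have CT : C^T = C.
  rewrite /C /scov_cen linearZ /= raddf_sum; congr (_ *: _).
  by apply: eq_bigr => k _; rewrite /= trmx_mul trmxK.
have Cs i j : C i j = C j i by rewrite -{1}CT mxE.
have h1 : \sum_i C i i ^+ 2 <= \tr (C *m C).
  rewrite /mxtrace; apply: ler_sum => i _; rewrite [leRHS]mxE (bigD1 i) //= expr2 lerDl.
  by apply: sumr_ge0 => j _; rewrite (Cs i j) -expr2 sqr_ge0.
have h2 := sqr_sum_ord_le (fun i => C i i).
have h3 : 0 <= \sum_i C i i ^+ 2 by apply: sumr_ge0 => i _; exact: sqr_ge0.
rewrite subr_ge0 mulrC ler_pdivrMr//; apply: le_trans h2 _.
rewrite mulrC; apply: (@le_trans _ _ (\tr (C *m C) * p%:R)); first by rewrite ler_pM2r.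
by apply: ler_wpM2l; [exact: le_trans h3 h1|rewrite ler_nat].
Qed.

Lemma omega_hat_ge :
  p%:R^-1 * (n%:R^-1 * \sum_(1 <= i < n.+1) sqnorm2 (y i - smean n y)) ^+ 2
    <= omega_hat n y.
Proof.
rewrite ler_pdivrMl// /omega_hat.
have -> : n%:R^-1 * \sum_(1 <= i < n.+1) sqnorm2 (y i - smean n y) =
  \sum_(j < p) (n%:R^-1 * \sum_(1 <= i < n.+1)
    (y i j 0 - n%:R^-1 * \sum_(1 <= i' < n.+1) y i' j 0) ^+ 2).
  rewrite /sqnorm2 exchange_big /= mulr_sumr; apply: eq_bigr => j _.
  congr (_ * _); apply: eq_bigr => i _.
  by rewrite /smean !mxE summxE.
exact: sqr_sum_ord_le.
Qed.

Lemma mean_sqnorm2_centered :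
  n%:R^-1 * \sum_(1 <= i < n.+1) sqnorm2 (y i - smean n y) =
  n%:R^-1 * (\sum_(1 <= i < n.+1) sqnorm2 (y i)) - sqnorm2 (smean n y).
Proof.
have dE : \sum_(1 <= i < n.+1) dotc (y i) (smean n y) = n%:R * sqnorm2 (smean n y).
  rewrite /dotc exchange_big /= /sqnorm2 mulr_sumr; apply: eq_bigr => j _.
  have mE : smean n y j 0 = n%:R^-1 * \sum_(1 <= i < n.+1) y i j 0.
    by rewrite /smean mxE summxE.
  by rewrite -mulr_suml mE expr2; field; rewrite gt_eqF.
rewrite (eq_bigr (fun i => sqnorm2 (y i) - 2 * dotc (y i) (smean n y) +
    sqnorm2 (smean n y))); last first.
  by move=> i _; rewrite -{1}(scale1r (smean n y)) sqnorm2BZ; ring.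
rewrite big_split /= big_split /= sumr_const_nat subn1 /= sumrN -mulr_sumr dE.
by rewrite -mulr_natl; field; rewrite gt_eqF.
Qed.

Variables (t b l u K : R).
Hypotheses (l0 : 0 < l) (u0 : 0 <= u) (K0 : 0 <= K) (b0 : 0 <= b).
Hypotheses (lt : l * p%:R <= t) (tu : t <= u * p%:R).
Hypothesis norms : n%:R^-1 * \sum_(1 <= i < n.+1) (sqnorm2 (y i) - t) ^+ 2 <= K * p%:R.
Hypothesis mean_norm : sqnorm2 (smean n y) <= b.
Hypotheses (Kp : 16 * K <= l ^+ 2 * p%:R) (bp : 4 * b <= l * p%:R).

Let Q : R := n%:R^-1 * \sum_(1 <= i < n.+1) sqnorm2 (y i).

Let Qt : (Q - t) ^+ 2 <= K * p%:R.
Proof.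
apply: le_trans norms.
have -> : Q - t = n%:R^-1 * \sum_(1 <= i < n.+1) (sqnorm2 (y i) - t).
  rewrite big_split /= sumr_const_nat subn1 /= mulrDr -/Q -(mulr_natl (- t)).
  by rewrite mulKf// gt_eqF.
exact: sqr_mean_le.
Qed.

Let p1r : 1 <= p%:R :> R. Proof. by rewrite ler1n. Qed.

Let Q_le : Q <= (u + 1 + K) * p%:R.
Proof.
have h : Q - t <= 1 + (Q - t) ^+ 2 by have := sqr_ge0 (Q - t - 1); have := sqr_ge0 (Q - t); lra.
have := p1r; have := Qt; have := tu; lra.
Qed.

(** By [Kp] the deviation of Q from t is at most l p / 4. Subtracting the squared norm of the mean,
    also at most l p / 4, leaves l p / 2 for [omega_ge]. *)
Let Q_ge : 3 / 4 * (l * p%:R) <= Q.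
Proof.
have lp : 0 < l * p%:R by exact: mulr_gt0.
rewrite leNgt; apply/negP => Ql.
have h1 : l * p%:R / 4 < t - Q by have := lt; lra.
have h2 : (l * p%:R / 4) ^+ 2 < (t - Q) ^+ 2.
  by rewrite ltr_pXn2r// nnegrE; lra.
have h3 := Qt; have h4 := ler_wpM2r (ltW pr0) Kp.
have E1 : (t - Q) ^+ 2 = (Q - t) ^+ 2 by ring.
have E2 : (l * p%:R / 4) ^+ 2 = l ^+ 2 * p%:R * p%:R / 16 by field.
rewrite E1 E2 in h2; lra.
Qed.

Let omega_ge : l ^+ 2 / 4 * p%:R <= omega_hat n y.
Proof.
apply: le_trans omega_hat_ge; rewrite mean_sqnorm2_centered -/Q.
have lp : 0 < l * p%:R by exact: mulr_gt0.
rewrite [leRHS]mulrC ler_pdivlMr//.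
have -> : l ^+ 2 / 4 * p%:R * p%:R = (l * p%:R / 2) ^+ 2 by field.
by apply: sqr_le; [lra|have := Q_ge; have := mean_norm; have := bp; lra].
Qed.

(** The empirical mean minimises the sum of squares, so it may be replaced by t + |m|^2. The
    deviation of |y_i - m|^2 becomes (|y_i|^2 - t) - 2 y_i . m, whose last term Cauchy-Schwarz
    controls. *)
Let nu_le : nu_hat n y <= (4 * K + 16 * b * (u + 1 + K)) * p%:R.
Proof.
set m := smean n y; pose V1 := \sum_(1 <= i < n.+1) (sqnorm2 (y i) - t) ^+ 2.
have h0 : nu_hat n y <= (n%:R - 1)^-1 *
    \sum_(1 <= i < n.+1) (sqnorm2 (y i - m) - (t + sqnorm2 m)) ^+ 2.
  rewrite /nu_hat; apply: ler_wpM2l; first by rewrite invr_ge0 ltW.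
  exact: sum_sqr_mean_le.
have h1 : \sum_(1 <= i < n.+1) (sqnorm2 (y i - m) - (t + sqnorm2 m)) ^+ 2 <=
    2 * V1 + 8 * (\sum_(1 <= i < n.+1) sqnorm2 (y i) * b).
  rewrite /V1 !mulr_sumr -big_split /=; apply: ler_sum => i _.
  rewrite -{1}(scale1r m) sqnorm2BZ expr1n mul1r mulr1.
  have d1 : dotc (y i) m ^+ 2 <= sqnorm2 (y i) * b.
    by apply: le_trans (dotc_sqr_le _ _) _; apply: ler_wpM2l => //; exact: sqnorm2_ge0.
  apply: (@le_trans _ _ (2 * (sqnorm2 (y i) - t) ^+ 2 + 8 * dotc (y i) m ^+ 2)).
    by have := sqr_ge0 (sqnorm2 (y i) - t + 2 * dotc (y i) m); lra.
  by rewrite lerD2l ler_wpM2l// ler0n.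
have V1E : V1 = n%:R * (n%:R^-1 * V1) by rewrite mulVKf// gt_eqF.
have QE : \sum_(1 <= i < n.+1) sqnorm2 (y i) * b = n%:R * (Q * b).
  by rewrite -mulr_suml /Q mulrA mulVKf// gt_eqF.
have h2 : 2 * V1 + 8 * (n%:R * (Q * b)) <=
    n%:R * (2 * (K * p%:R) + 8 * ((u + 1 + K) * p%:R * b)).
  have h3 := ler_wpM2r b0 Q_le; have h4 := norms; rewrite -/V1 in h4.
  rewrite V1E mulrCA (mulrCA 8) -mulrDr; apply: ler_wpM2l; first exact: ltW.
  by rewrite lerD// ler_wpM2l// ler0n.
rewrite QE in h1; apply: le_trans h0 _.
have C0 : 0 <= 2 * (K * p%:R) + 8 * ((u + 1 + K) * p%:R * b).
  have uK : 0 <= u + 1 + K by have := u0; have := K0; lra.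
  apply: addr_ge0; first by apply: mulr_ge0; [exact: ler0n|exact: mulr_ge0].
  apply: mulr_ge0; first exact: ler0n.
  by apply: mulr_ge0 => //; exact: mulr_ge0.
rewrite mulrC ler_pdivrMr//; apply: le_trans h1 _; apply: le_trans h2 _.
have n22 : n%:R <= 2 * (n%:R - 1) :> R.
  have n2r : 2 <= n%:R :> R by rewrite ler_nat.
  lra.
apply: le_trans (ler_wpM2r C0 n22) _.
by rewrite le_eqVlt; apply/orP; left; apply/eqP; ring.
Qed.

(** The 2 accounts for the floor of [kappa_hat] at 1; the quotient bounds [nu_hat / omega_hat], the
    numerator being O(p) and the denominator at least l^2 p / 4. *)
Definition kurtosis_bound : R := 2 + 4 * (4 * K + 16 * b * (u + 1 + K)) / l ^+ 2.

Lemma kappa_hat_bound : `|kappa_hat n y - 3| <= kurtosis_bound.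
Proof.
have w0 : 0 < omega_hat n y.
  by apply: lt_le_trans omega_ge; rewrite mulr_gt0// divr_gt0// exprn_gt0.
have nu0 : 0 <= nu_hat n y.
  rewrite /nu_hat mulr_ge0 ?invr_ge0 ?(ltW n10)//.
  by apply: sumr_ge0 => i _; exact: sqr_ge0.
have nl := nu_le; set c := 4 * K + 16 * b * (u + 1 + K) in nl.
have nw : nu_hat n y / omega_hat n y <= 4 * c / l ^+ 2.
  rewrite ler_pdivrMr//; apply: le_trans nl _.
  have c0 : 0 <= c.
    by have := le_trans nu0 nu_le; rewrite pmulr_lge0.
  have -> : c * p%:R = 4 * c / l ^+ 2 * (l ^+ 2 / 4 * p%:R).
    by field; rewrite gt_eqF.
  apply: ler_wpM2l omega_ge.
  by rewrite divr_ge0 ?exprn_ge0 ?(ltW l0)// mulr_ge0 ?ler0n.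
have t0 : 0 <= tau_hat n y / omega_hat n y by rewrite divr_ge0 ?tau_hat_ge0// ltW.
have nw0 : 0 <= nu_hat n y / omega_hat n y by rewrite divr_ge0// ltW.
rewrite /kurtosis_bound -/c.
have -> : kappa_hat n y = Num.max (3 + (nu_hat n y / omega_hat n y -
    2 * (tau_hat n y / omega_hat n y))) 1 by rewrite /kappa_hat mulrBl mulrA.
move: (nu_hat n y / _) (tau_hat n y / _) (4 * c / _) nw t0 nw0 => a e f nw t0 nw0.
rewrite ler_norml; case: (leP (3 + (a - 2 * e)) 1) => h.
  by apply/andP; split; lra.
by apply/andP; split; lra.
Qed.

End bounds.

End kurtosis.

(** * Spectrum of a real symmetric matrix *)

Module SymmetricSpectrum.
From mathcomp Require Import complex.

(** The matrix is diagonalised by a unitary Q over the complex numbers, and the identities are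
    brought back to [R] by injectivity of the embedding. The weights c_i are the squared moduli of
    the coordinates of Q v. *)
Lemma symmetric_spectrum (R : rcfType) (p : nat) (A : 'M[R]_p) : A^T = A ->
  exists s : 'I_p -> R, [/\ forall i, eigenvalue A (s i),
    \tr A = \sum_i s i, \tr (A *m A) = \sum_i s i ^+ 2 &
    forall v, exists2 c : 'I_p -> R, forall i, 0 <= c i &
      qform A v = \sum_i s i * c i /\ qform 1%:M v = \sum_i c i].
Proof.
move=> AT; pose f : {rmorphism R -> R[i]} := real_complex R.
pose B := map_mx f A.
have freal x : f x \is Num.real.
  by rewrite realE /f /= !lecE /= eqxx /=; exact: num_real.
have BH : B \is hermsymmx.
  apply: realsym_hermsym.
    apply/is_hermitianmxP; rewrite expr0 scale1r map_mx_id//.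
    by rewrite /B map_trmx AT.
  by apply/mxOverP => i j; rewrite mxE.
have /orthomx_spectralP := hermitian_normalmx BH.
have := spectral_unitarymx B.
have := spectral_unit B.
have := hermitian_spectral_diag_real BH.
move: (spectralmx B) (spectral_diag B) => Q d dreal Qu QU BE.
pose s i := complex.Re (d 0 i).
have dE i : d 0 i = f (s i).
  have /mxOverP /(_ 0 i) := dreal.
  by move=> dr; rewrite /f /= /s; rewrite RRe_real.
have trB : \tr B = \sum_i f (s i).
  rewrite BE mxtrace_mulC mulmxA mulmxV// mul1mx mxtrace_diag.
  by apply: eq_bigr => i _.
have trBB : \tr (B *m B) = \sum_i f (s i) ^+ 2.
  have -> : B *m B = invmx Q *m (diag_mx d *m diag_mx d) *m Q.
    by rewrite {1 2}BE !mulmxA mulmxK.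
  rewrite mxtrace_mulC mulKVmx// mulmx_diag mxtrace_diag.
  by apply: eq_bigr => i _; rewrite mxE dE expr2.
exists s; split.
- move=> i; rewrite -(eigenvalue_map f); apply/eigenvalueP.
  exists (row i Q).
    rewrite -/B {1}BE !mulmxA -row_mul mulmxV// row1 -dE.
    rewrite -[delta_mx 0 i *m _]rowE row_diag_mx -scalemxAl -rowE.
    by [].
  apply/negP => /eqP r0; have := mulmxV Qu.
  move=> /(congr1 (row i)); rewrite row_mul r0 mul0mx => /matrixP/(_ 0 i).
  by rewrite !mxE eqxx => /eqP; rewrite eq_sym oner_eq0.
- by apply: (fmorph_inj f); rewrite -trace_map_mx -/B trB raddf_sum.
- apply: (fmorph_inj f); rewrite -trace_map_mx map_mxM -/B trBB raddf_sum.
  by apply: eq_bigr => i _; exact: (esym (rmorphXn f 2 (s i))).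
- move=> v; pose u := map_mx f v; pose w := Q *m u.
  have uT : map_mx f v^T = (map_mx Num.conj u)^T.
    apply/matrixP => i j.
    by rewrite !mxE; apply/esym/CrealP; exact: freal.
  have wE i : w i 0 * (w i 0)^* = f (complex.Re (w i 0 * (w i 0)^*)).
    by rewrite /f /= RRe_real// mulrC -normCKC rpredX// normr_real.
  have main (D : 'rV[R[i]]_p) (C : 'M[R]_p) :
      map_mx f C = invmx Q *m diag_mx D *m Q ->
      f (qform C v) = \sum_i D 0 i * f (complex.Re (w i 0 * (w i 0)^*)).
    move=> CE; rewrite /qform.
    have -> : f ((v^T *m C *m v) 0 0) = ((map_mx f v^T) *m (map_mx f C) *m u) 0 0.
      by rewrite /u -!map_mxM [RHS]mxE.
    rewrite CE uT invmx_unitary// -!mulmxA -/w mulmxA mulmxA.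
    have -> : (map_mx Num.conj u)^T *m map_mx Num.conj Q^T = (map_mx Num.conj w)^T.
      by rewrite -map_trmx -trmx_mul -map_mxM.
    rewrite mxE; apply: eq_bigr => i _.
    have diagE (z : 'cV[R[i]]_p) :
        ((map_mx Num.conj z)^T *m diag_mx D) 0 i = (z i 0)^* * D 0 i.
      by rewrite mul_mx_diag !mxE.
    by rewrite -wE diagE; ring.
  exists (fun i => complex.Re (w i 0 * (w i 0)^*)).
    by move=> i; rewrite -lecR -/f; have := wE i; rewrite /f /= => <-; exact: mul_conjC_ge0.
  split; apply: (fmorph_inj f); rewrite raddf_sum.
    rewrite (main d A)//; apply: eq_bigr => i _.
    by rewrite dE; exact: (esym (rmorphM f _ _)).
  rewrite (main (const_mx 1) 1%:M).
    by apply: eq_bigr => i _; rewrite mxE mul1r.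
  by rewrite map_mx1 diag_const_mx mulmx1 mulVmx.
Qed.

End SymmetricSpectrum.

(** * Trace and norm bounds from the extreme eigenvalues *)

Section covariance.
Context {R : realType} (p : nat) (S A : 'M[R]_p) (l u : R).
Hypotheses (l0 : 0 < l) (hA : psd A) (hS : psd_sqrt S A).
Hypotheses (hl : (l%:E <= lambda_min A)%E) (hu : (lambda_max A <= u%:E)%E).

Let eig_itv a : eigenvalue A a -> l <= a <= u.
Proof.
move=> Aa; apply/andP; split; rewrite -lee_fin.
  by apply: le_trans hl _; apply: ereal_inf_lbound; exists a.
by apply: le_trans hu; apply: ereal_sup_ubound; exists a.
Qed.

Lemma sqrt_det_neq0 : \det S != 0.
Proof.
have [_ SS] := hS.
suff : \det A != 0 by rewrite -SS det_mulmx mulf_eq0 negb_or => /andP[].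
rewrite -unitfE -unitmxE; apply: contraT => Au.
have /eig_itv/andP[l0' _] : eigenvalue A 0.
  by rewrite /eigenvalue /eigenspace raddf0 subr0 kermx_eq0 row_free_unit.
by move: (lt_le_trans l0 l0'); rewrite ltxx.
Qed.

Lemma trace_cov_ge : l * p%:R <= \tr A.
Proof.
have [s [Hs -> _ _]] := SymmetricSpectrum.symmetric_spectrum (proj1 hA).
rewrite mulrC mulr_natl -[p in leLHS]card_ord -sumr_const; apply: ler_sum => i _.
by have /andP[] := eig_itv (Hs i).
Qed.

Lemma trace_cov_le : \tr A <= u * p%:R.
Proof.
have [s [Hs -> _ _]] := SymmetricSpectrum.symmetric_spectrum (proj1 hA).
rewrite mulrC mulr_natl -[p in leRHS]card_ord -sumr_const; apply: ler_sum => i _.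
by have /andP[] := eig_itv (Hs i).
Qed.

Lemma frobenius2_cov_le : frobenius2 A <= u ^+ 2 * p%:R.
Proof.
have [s [Hs _ + _]] := SymmetricSpectrum.symmetric_spectrum (proj1 hA).
rewrite frobenius2E (proj1 hA) => ->.
rewrite mulrC mulr_natl -[p in leRHS]card_ord -sumr_const; apply: ler_sum => i _.
have /andP[li iu] := eig_itv (Hs i).
by apply: sqr_le => //; exact: le_trans (ltW l0) li.
Qed.

Lemma qform_cov_le v : qform A v <= u * qform 1%:M v.
Proof.
have [s [Hs _ _ /(_ v)[c c0 [-> ->]]]] := SymmetricSpectrum.symmetric_spectrum (proj1 hA).
rewrite mulr_sumr; apply: ler_sum => i _; apply: ler_wpM2r => //.
by have /andP[] := eig_itv (Hs i).
Qed.

End covariance.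

(** * Uniqueness of the positive semidefinite square root *)

Section psd_sqrt_unique.
Context {R : realType} (p : nat).
Implicit Types S T D : 'M[R]_p.

(** With w = S v, the form at v + t w is 2 t |w|^2 + O(t^2); its nonnegativity for small negative t
    forces w = 0. *)
Let psd_kernel S v : psd S -> qform S v = 0 -> S *m v = 0.
Proof.
move=> [ST S0] Sv; set w := S *m v.
pose a : R := (w^T *m w) 0 0; pose b := qform S w.
have b0 : 0 <= b by exact: S0.
have H (t : R) : 0 <= 2 * t * a + t ^+ 2 * b.
  have := S0 (v + t *: w).
  have -> : ((v + t *: w)^T *m S *m (v + t *: w)) 0 0 =
      qform S v + 2 * t * a + t ^+ 2 * b.
    have T1 : (v + t *: w)^T = v^T + t *: w^T by apply/matrixP => i j; rewrite !mxE.
    rewrite /qform T1 !mulmxDl !mulmxDr -!scalemxAl -!scalemxAr.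
    have E1 : v^T *m S = w^T by rewrite /w trmx_mul ST.
    have E2 : w^T *m S *m v = w^T *m w by rewrite -mulmxA.
    by rewrite E2 E1 !mxE /a /b /qform !mxE; ring.
  by rewrite Sv add0r.
suff a0 : a = 0 by exact: norm2_eq0.
apply/le_anti/andP; split; last exact: norm2_ge0.
rewrite leNgt; apply/negP => a0.
have b1 : 0 < b + 1 by rewrite ltr_wpDl.
(* The minimiser would be -a / b; using b + 1 also covers b = 0. *)
have := H (- (a / (b + 1))).
have -> : 2 * - (a / (b + 1)) * a + (- (a / (b + 1))) ^+ 2 * b =
  - ((a / (b + 1)) ^+ 2 * (b + 2)) by field; rewrite gt_eqF.
rewrite oppr_ge0 leNgt => /negP; apply.
by rewrite mulr_gt0 ?exprn_gt0 ?divr_gt0// ltr_wpDl.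
Qed.

Let psd_conj_diag S D i : (D^T *m S *m D) i i = qform S (col i D).
Proof. 
rewrite /qform !mxE; apply: eq_bigr => k _; rewrite !mxE; congr (_ * _).
by apply: eq_bigr => l _; rewrite !mxE.
Qed.

(** D = S - T satisfies S D + D T = S^2 - T^2 = 0. Multiplying by D and taking traces gives two
    nonnegative numbers of sum zero, so S D = T D = 0; hence D^2 = 0, and the symmetric D
    vanishes. *)
Lemma psd_sqrt_unique A S T : psd_sqrt S A -> psd_sqrt T A -> S = T.
Proof.
move=> [hS SA] [hT TA]; pose D := S - T.
have DT : D^T = D by rewrite /D linearB /= (proj1 hS) (proj1 hT).
have E : S *m D + D *m T = 0.
  by rewrite /D mulmxBr mulmxBl SA TA addrA subrK subrr.
have tr0 : \tr (D^T *m S *m D) + \tr (D^T *m T *m D) = 0.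
  rewrite DT -mulmxA (mxtrace_mulC (D *m T)) -raddfD /= -mulmxDr.
  by rewrite E mulmx0 raddf0.
have q0 U i : psd U -> 0 <= qform U (col i D) by move=> [_]; exact.
have tr_ge0 U : psd U -> 0 <= \tr (D^T *m U *m D).
  by move=> hU; apply: sumr_ge0 => i _; rewrite psd_conj_diag q0.
have kill U : psd U -> \tr (D^T *m U *m D) = 0 -> U *m D = 0.
  move=> hU /eqP; rewrite /mxtrace psumr_eq0 => [/allP H|i _]; last first.
    by rewrite psd_conj_diag q0.
  apply/matrixP => i j; have := H j; rewrite mem_index_enum psd_conj_diag.
  move=> /(_ isT)/eqP/(psd_kernel hU)/matrixP/(_ i 0).
  have -> : (U *m D) i j = (U *m col j D) i 0.
    by rewrite !mxE; apply: eq_bigr => k _; rewrite !mxE.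
  by move=> ->; rewrite !mxE.
have [tS tT] : \tr (D^T *m S *m D) = 0 /\ \tr (D^T *m T *m D) = 0.
  have := tr_ge0 _ hS; have := tr_ge0 _ hT; move: tr0.
  by move: (\tr _) (\tr _) => x y *; split; lra.
have DD : D *m D = 0 by rewrite {1}/D mulmxBl (kill _ hS)// (kill _ hT)// subrr.
apply/subr0_eq/matrixP => i j; have := norm2_eq0 (v := col j D).
rewrite tr_col -{1}DT trmxK.
have -> : (row j D *m col j D) 0 0 = (D *m D) j j by rewrite !mxE; apply: eq_bigr => k _; rewrite !mxE.
by rewrite DD mxE => /(_ erefl)/matrixP/(_ i 0); rewrite !mxE.
Qed.

End psd_sqrt_unique.

(** * Compactness and tightness *)

Section tightness.
Context {R : realType} (a b : R).
Local Notation I := `[a, b]%classic.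

Lemma root8_pow8 (e : R) : 0 <= e -> root8 (e ^+ 8) = e.
Proof.
move=> e0; rewrite /root8 (exprM e 4 2) sqrtr_sqr ger0_norm ?exprn_ge0//.
rewrite (exprM e 2 2) sqrtr_sqr ger0_norm ?exprn_ge0//.
by rewrite sqrtr_sqr ger0_norm.
Qed.

Lemma interval_net (e : R) : 0 < e ->
  exists (N : nat) (pt : 'I_N -> I), forall t : I, exists i,
    `|\val t - \val (pt i)| <= e.
Proof.
move=> e0.
(* An empty interval has an empty net; otherwise [t0] stands in for the nodes beyond [b]. *)
have [t0|nI] := pselect (exists t0 : I, True); last first.
  exists 0%N; exists (fun i : 'I_0 => False_rect I (let: Ordinal m h := i in notF h)).
  by move=> t; exfalso; apply: nI; exists t.
case: t0 => t0 _.
have H (i : 'I_(Num.truncn ((b - a) / e)).+1) : exists s : I, a + i%:R * e <= b -> \val s = a + i%:R * e.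
  have [ib|] := boolP (a + i%:R * e <= b); last by exists t0.
  have hI : a + i%:R * e \in I.
    by rewrite inE /= in_itv /= ib lerDl mulr_ge0// ltW.
  by exists (SigSub hI).
have [pt Hpt] := boolp.choice H.
exists _, pt => t.
have /andP[at0 tb] : a <= \val t <= b by have := set_valP t; rewrite /= in_itv.
have ta0 : 0 <= (\val t - a) / e by rewrite divr_ge0 ?subr_ge0// ltW.
have /andP[i1 i2] := truncn_itv ta0.
have iN : (Num.truncn ((\val t - a) / e) < (Num.truncn ((b - a) / e)).+1)%N.
  by rewrite ltnS; apply: le_truncn; rewrite ler_pM2r ?invr_gt0// lerD2r.
exists (Ordinal iN).
have h1 : (Num.truncn ((\val t - a) / e))%:R * e <= \val t - a.
  by rewrite -ler_pdivlMr.
move: i2; rewrite ltr_pdivrMr// -natr1 mulrDl mul1r => i2.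
have -> : \val (pt (Ordinal iN)) = a + (Num.truncn ((\val t - a) / e))%:R * e.
  by apply: Hpt; rewrite -lerBrDl (le_trans h1)// lerD2r.
by rewrite ler_norml; apply/andP; split; lra.
Qed.

Definition holder_ball (M : R) : set (linfty I R) :=
  [set f | (forall t, `|f t| <= M) /\
           (forall s t, `|f s - f t| <= M * root8 `|\val s - \val t|)].

(** The limit along the ultrafilter is the supremum of the levels r that [f t] eventually
    exceeds. *)
Let ultra_limit (F : set_system (linfty I R)) (M : R) (t : I) :
  UltraFilter F -> F [set f : linfty I R | `|f t| <= M] ->
  exists g : R, forall e, 0 < e -> F [set f : linfty I R | `|f t - g| < e].
Proof.
move=> FU FM.
pose A := [set r : R | F [set f : linfty I R | r <= f t]].
have A1 : A (- M).
  by apply: filterS FM => f /=; rewrite ler_norml => /andP[].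
have A2 : ubound A M.
  move=> r Ar; have [f [/= fM rf]] := filter_ex (filterI FM Ar).
  by apply: le_trans rf _; move: fM; rewrite ler_norml => /andP[].
have hA : has_sup A by split; [exists (- M)|exists M].
exists (sup A) => e e0.
have [r Ar re] := sup_adherent e0 hA.
have F1 : F [set f : linfty I R | f t < sup A + e].
  have [FA|] := in_ultra_setVsetC [set f : linfty I R | sup A + e <= f t] FU.
    have := ub_le_sup (proj2 hA) FA; lra.
  by apply: filterS => f /= /negP; rewrite -ltNge.
apply: filterS (filterI Ar F1) => f [/= rf fe].
by rewrite ltr_norml; apply/andP; split; lra.
Qed.

(** Arzela-Ascoli by ultrafilters: the pointwise limit inherits both bounds, and the common modulus
    turns convergence on a finite net into uniform convergence. *)
Lemma compact_holder_ball (M : R) : 0 <= M -> compact (holder_ball M).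
Proof.
move=> M0; rewrite compact_ultra => F FU FK.
have FKt t : F [set f : linfty I R | `|f t| <= M].
  by apply: filterS FK => f [fM _]; exact: fM.
have [g Hg] := boolp.choice (fun t => ultra_limit FU (FKt t)).
have gM t : `|g t| <= M.
  apply/ler_addgt0Pr => e e0.
  have [f [/= fM fg]] := filter_ex (filterI (FKt t) (Hg t e e0)).
  move: fM fg; rewrite !ler_norml !ltr_norml => /andP[? ?] /andP[? ?].
  by apply/andP; split; lra.
have gl : g \in @linfty_pred I R by apply/linfty_predP; exists M.
exists (Linfty gl); split.
  split => //= s t; apply/ler_addgt0Pr => e e0.
  have e20 : 0 < e / 2 by rewrite divr_gt0.
  have [f [[fs ft] [_ /(_ s t) fK]]] :=
    filter_ex (filterI (filterI (Hg s _ e20) (Hg t _ e20)) FK).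
  move: fs ft fK => /=; rewrite !ler_norml !ltr_norml.
  by move=> /andP[? ?] /andP[? ?] /andP[? ?]; apply/andP; split; lra.
move=> A /=; rewrite -nbhs_ballE => -[e /= e0 eA].
(* Between a point and its net node, both the limit and the function move by at most e/8, and at the
   node they differ by less than e/8: 3e/8 in all. *)
have [d d0 dE] : exists2 d : R, 0 < d & M * root8 d <= e / 8.
  pose u := (e / 8) / (M + 1); have u0 : 0 < u by rewrite !divr_gt0// ltr_wpDl.
  exists (u ^+ 8); first exact: exprn_gt0.
  rewrite root8_pow8 ?(ltW u0)// /u mulrCA ler_piMr ?divr_ge0 ?(ltW e0)//.
  by rewrite ler_pdivrMr ?ltr_wpDl// mul1r lerDl.
have [N [pt Hpt]] := interval_net d0.
have e80 : 0 < e / 8 by rewrite divr_gt0.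
have FN : F [set f : linfty I R | forall i : 'I_N, `|f (pt i) - g (pt i)| < e / 8].
  by apply: filter_forall => i; exact: Hg.
apply: filterS (filterI FN FK) => f [/= fN [_ fK]]; apply: eA.
rewrite -ball_normE /ball_ /=.
apply: (@le_lt_trans _ _ (e / 2)); last by lra.
apply: linfty_norm_le => [|t]; first by lra.
have [i ti] := Hpt t.
have gK : `|g t - g (pt i)| <= M * root8 `|\val t - \val (pt i)|.
  apply/ler_addgt0Pr => e1 e10.
  have e20 : 0 < e1 / 2 by rewrite divr_gt0.
  have [h [[fs ft] [_ /(_ t (pt i)) hK]]] :=
    filter_ex (filterI (filterI (Hg t _ e20) (Hg (pt i) _ e20)) FK).
  move: fs ft hK => /=; rewrite !ler_norml !ltr_norml.
  by move=> /andP[? ?] /andP[? ?] /andP[? ?]; apply/andP; split; lra.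
have rd : M * root8 `|\val t - \val (pt i)| <= e / 8.
  by apply: le_trans dE; apply: ler_wpM2l => //; exact: root8_le.
set z := M * _ in gK rd; have fz : `|f t - f (pt i)| <= z by exact: fK.
have -> : (Linfty gl - f) t = g t - f t by [].
move: (fN i) gK fz.
rewrite !ler_norml ltr_norml => /andP[? ?] /andP[? ?] /andP[? ?].
by apply/andP; split; lra.
Qed.

(* McShane extension: [fun t => inf_s (h s + M * root8 |t - s|)]. *)
Lemma holder_approx (h : linfty I R) (M r eta : R) : 0 <= M -> 0 <= r ->
  (forall t, `|h t| <= M) ->
  (forall s t, `|h s - h t| <= M * (root8 `|\val s - \val t| + r)) ->
  M * r <= M -> M * r < eta ->
  enlargement (holder_ball (2 * M)) eta h.
Proof.
move=> M0 r0 hM hK rM reta.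
pose A (t : I) := range (fun s : I => h s + M * root8 `|\val t - \val s|).
have Alb t : has_inf (A t).
  split; first by exists (h t + M * root8 `|\val t - \val t|); exists t.
  exists (- M) => _ [s _ <-].
  have := hM s; rewrite ler_norml => /andP[? _].
  have : 0 <= M * root8 `|\val t - \val s| by rewrite mulr_ge0// root8_ge0.
  lra.
pose g t := inf (A t).
have gle t s : g t <= h s + M * root8 `|\val t - \val s|.
  by apply: ge_inf; [exact: (proj2 (Alb t))|exists s].
have gh t : g t <= h t.
  have := gle t t; rewrite subrr normr0 /root8 !sqrtr0 mulr0 addr0.
  exact.
have hg t : h t - M * r <= g t.
  apply: lb_le_inf; first exact: (proj1 (Alb t)).
  move=> _ [s _ <-]; have := hK t s; rewrite ler_norml => /andP[_].
  by rewrite mulrDr; lra.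
have gK1 s t : g s - g t <= M * root8 `|\val s - \val t|.
  rewrite lerBlDl -lerBlDr; apply: lb_le_inf; first exact: (proj1 (Alb t)).
  move=> _ [u _ <-]; rewrite lerBlDr -addrA -mulrDr.
  apply: le_trans (gle s u) _; rewrite lerD2l; apply: ler_wpM2l => //.
  rewrite [leRHS]addrC; apply: le_trans (root8D_le _ _) => //; apply: root8_le.
  exact: (ler_distD (\val t)).
have g2M t : `|g t| <= 2 * M.
  have := hM t; have := gh t; have := hg t; rewrite !ler_norml => ? ? /andP[? ?].
  by apply/andP; split; lra.
have gl : g \in @linfty_pred I R by apply/linfty_predP; exists (2 * M).
exists (Linfty gl).
  split => //= s t; have mr : 0 <= M * root8 `|\val s - \val t|.
    by rewrite mulr_ge0// root8_ge0.
  have := gK1 s t; have := gK1 t s; rewrite (distrC (\val t)).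
  by move=> ? ?; rewrite ler_norml; apply/andP; split; lra.
rewrite -ball_normE /ball_ /=; apply: le_lt_trans reta.
apply: linfty_norm_le => [|t]; first by rewrite mulr_ge0.
have -> : (Linfty gl - h) t = g t - h t by [].
by have := gh t; have := hg t; rewrite ler_norml => ? ?; apply/andP; split; lra.
Qed.

(** The paths are step functions of t, hence Hoelder only up to an error [r n]. Likely paths
    therefore lie near the compact Hoelder ball rather than in it, at a distance tending to 0. The
    measurable [B] bounds the inner probability from below. *)
Lemma tight_of_modulus (d : nat -> measure_display)
    (T : forall n, measurableType (d n)) (P : forall n, probability (T n) R)
    (Z : forall n, T n -> linfty I R) (r : nat -> R) :
  (forall n, 0 <= r n) -> r n @[n --> \oo] --> 0 ->
  (forall eps : R, 0 < eps -> exists2 M : R, 0 <= M &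
    \forall n \near \oo, exists B : set (T n),
      [/\ measurable B, ((1 - eps)%:E <= P n B)%E &
       forall w, B w -> (forall t, `|Z n w t| <= M) /\
         (forall s t, `|Z n w s - Z n w t| <= M * (root8 `|\val s - \val t| + r n))]) ->
  asymptotically_tight P Z.
Proof.
move=> r0 rcvg H eps eps0; have [M M0 HM] := H eps eps0.
exists (holder_ball (2 * M)); first by apply: compact_holder_ball; rewrite mulr_ge0.
move=> eta eta0.
have near1 : \forall n \near \oo, M * r n <= M /\ M * r n < eta.
  have u0 : 0 < Num.min 1 (eta / (M + 1)).
    by rewrite lt_min ltr01/= divr_gt0// ltr_wpDl.
  move/cvgrPdist_lt : rcvg => /(_ _ u0); apply: filterS => n.
  rewrite sub0r normrN ger0_norm// lt_min => /andP[r1 r2]; split.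
    by rewrite ler_piMr// ltW.
  move: r2; rewrite ltr_pdivlMr ?ltr_wpDl// => r2.
  by have := r0 n; lra.
have [N _ HN] := filterI HM near1.
rewrite limn_einf_lim; apply: lime_ge; first exact: is_cvg_einfs.
exists N => // n /= Nn; apply: le_ereal_inf_tmp => _ [k /= nk <-].
have [[B [mB PB BZ]] [h1 h2]] := HN k (leq_trans Nn nk).
apply: le_trans PB _; apply: ereal_sup_ubound; exists B => //; split => //.
move=> w /BZ[Z1 Z2]; exact: (@holder_approx _ M (r k)).
Qed.

End tightness.

(** * Moments of the entries from their common law *)

Section moments.
Context {R : realType}.

Lemma pow8_le_powR (r delta : R) : 4 < delta -> r ^+ 8 <= 1 + `|r| `^ (4 + delta).
Proof.
move=> d4; have -> : r ^+ 8 = `|r| ^+ 8.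
  by rewrite (exprM _ 2 4) (exprM `|r| 2 4) real_normK// num_real.
have [r1|r1] := leP `|r| 1.
  apply: (@le_trans _ _ 1); first exact: exprn_ile1.
  by rewrite lerDl powR_ge0.
rewrite -powR_mulrn//; apply: (@le_trans _ _ (`|r| `^ (4 + delta))).
  apply: ler_powR; first exact: ltW.
  by move: d4; clear; lra.
by rewrite lerDr.
Qed.

Let rv_moments {d} {T : measurableType d} (P : probability T R) (Y : {RV P >-> R})
    (delta : R) :
  'V_P[Y] = 1%E -> 4 < delta ->
  ('E_P[(fun w => `|Y w| `^ (4 + delta))%R] < +oo)%E -> ('E_P[Y] = 0)%E ->
  exists2 M : R, 1 <= M &
   [/\ (\int[P]_w (Y w)%:E = 0)%E, (\int[P]_w (Y w ^+ 2)%:E = 1)%E &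
       (\int[P]_w (Y w ^+ 8)%:E <= M%:E)%E].
Proof.
move=> V1 d4 Ed E0; have mY := measurable_funPT Y.
have I0 : (\int[P]_w (Y w)%:E = 0)%E by move: E0; rewrite unlock.
move: Ed; rewrite unlock => Ed.
have mp : measurable_fun setT (fun w => `|Y w| `^ (4 + delta)).
  apply: (@measurableT_comp _ _ _ _ _ _ (fun r : R => r `^ (4 + delta)) _ (fun w => `|Y w|)).
    exact: measurable_powR.
  exact: measurableT_comp.
have p0 : (0 <= \int[P]_w (`|Y w| `^ (4 + delta))%:E)%E.
  by apply: integral_ge0 => w _; rewrite lee_fin powR_ge0.
have fin : (\int[P]_w (`|Y w| `^ (4 + delta))%:E)%E \is a fin_num.
  by rewrite ge0_fin_numE.
exists (1 + fine (\int[P]_w (`|Y w| `^ (4 + delta))%:E)%E).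
  by rewrite lerDl fine_ge0.
split=> //.
- move: V1; rewrite /variance unlock E0 /=.
  rewrite unlock => <-; apply: eq_integral => w _ /=.
  by rewrite !fctE /= subr0 expr2.
- apply: (@int_le _ _ _ _ _ (fun w => 1 + `|Y w| `^ (4 + delta))).
  + by mfun.
  + by apply: measurable_funD.
  + by move=> w; nneg.
  + by move=> w; exact: pow8_le_powR.
  + apply: int_addle => //.
    * by rewrite int_cstE.
    * by rewrite fineK.
Qed.

Let moments_transfer {d} {T : measurableType d} (P : probability T R)
    {d'} {T' : measurableType d'} (P' : probability T' R)
    (X : {RV P >-> R}) (Y : {RV P' >-> R}) (M : R) :
  (forall A : set R, measurable A -> distribution P X A = distribution P' Y A) ->
  (\int[P']_r (Y r)%:E = 0)%E -> (\int[P']_r (Y r ^+ 2)%:E = 1)%E ->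
  (\int[P']_r (Y r ^+ 8)%:E <= M%:E)%E ->
  [/\ (\int[P]_w (X w)%:E = 0)%E, (\int[P]_w (X w ^+ 2)%:E = 1)%E &
      (\int[P]_w (X w ^+ 8)%:E <= M%:E)%E].
Proof.
move=> HX l1 l2 l8.
have E (f : R -> \bar R) :
    (\int[distribution P X]_r f r = \int[distribution P' Y]_r f r)%E.
  by apply: eq_measure_integral => A mA _; exact: HX.
have ge0E (f : R -> R) : measurable_fun setT f -> (forall r, 0 <= f r) ->
    (\int[P]_w (f (X w))%:E = \int[P']_r (f (Y r))%:E)%E.
  move=> mf f0; have mf' : measurable_fun setT (EFin \o f) by exact/measurable_EFinP.
  by have := E (EFin \o f); rewrite !ge0_integral_distribution.
have rv_int d0 (T0 : measurableType d0) (P0 : probability T0 R) (Z : {RV P0 >-> R}) :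
    (\int[P0]_r (Z r ^+ 2)%:E = 1)%E -> P0.-integrable setT (EFin \o Z).
  move=> Z2; have mZ := measurable_funPT Z.
  apply: (@integrable_bound _ _ _ _ _ (fun w => 1 + Z w ^+ 2) (1 + 1)).
  + exact: mZ.
  + by mfun.
  + move=> w; have := sqr_ge0 (Z w - 1); have := sqr_ge0 (Z w + 1).
    by rewrite ler_norml => *; apply/andP; split; lra.
  + apply: int_addle => //; [by mfun|by move=> w; nneg|..].
      by rewrite int_cstE.
    by rewrite Z2.
have X2 : (\int[P]_w (X w ^+ 2)%:E = 1)%E.
  by rewrite -l2; apply: (ge0E (fun r => r ^+ 2)); [mfun|move=> r; nneg].
split => //.
- have mE : measurable_fun setT (EFin : R -> \bar R) by exact/measurable_EFinP.
  have := E EFin; rewrite !integral_distribution//.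
  + by move=> ->.
  + exact: rv_int.
  + exact: rv_int.
- have -> // : (\int[P]_w (X w ^+ 8)%:E = \int[P']_r (Y r ^+ 8)%:E)%E.
  by apply: (ge0E (fun r => r ^+ 8)); [mfun|move=> r; nneg].
Qed.

(* [measurableTypeR R] and [R] carry the same sigma-algebra as distinct
   measurable structures; the identity transports the law from one to the other. *)
Let idR : measurableTypeR R -> R := idfun.

#[local] HB.instance Definition _ :=
  @isMeasurableFun.Build _ _ _ _ idR (@measurable_id _ _ setT).

Lemma law_moments (law : probability (measurableTypeR R) R) (delta : R) :
  'V_law[fun r : R => r] = 1%E -> 4 < delta ->
  ('E_law[(fun r : R => `|r| `^ (4 + delta))%R] < +oo)%E ->
  ('E_law[fun r : R => r] = 0)%E ->
  exists2 M : R, 1 <= M &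
   forall {d} {T : measurableType d} (P : probability T R) (X : {RV P >-> R}),
   (forall A : set R, measurable A -> distribution P X A = law A) ->
   [/\ (\int[P]_w (X w)%:E = 0)%E, (\int[P]_w (X w ^+ 2)%:E = 1)%E &
      (\int[P]_w (X w ^+ 8)%:E <= M%:E)%E].
Proof.
move=> V1 d4 Ed E0.
have [M M1 [I1 I2 I8]] := @rv_moments _ _ law idR delta V1 d4 Ed E0.
exists M => // d T P X HX.
by apply: (@moments_transfer _ _ P _ _ law X idR M).
Qed.

End moments.

(** * The likelihood-ratio process *)

Section sample.
Context {R : realType} {d} {T : measurableType d} (P : probability T R).
Variables (p n : nat) (x : 'I_p -> nat -> {RV P >-> R}).
Hypothesis indep : mutually_independent
  [set ji : 'I_p * nat | (1 <= ji.2 <= n)%N] (fun ji => x ji.1 ji.2).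
Variable M : R.
Hypothesis M1 : 1 <= M.
Hypothesis x1 : forall j k, (1 <= k <= n)%N -> (\int[P]_w (x j k w)%:E = 0)%E.
Hypothesis x2 : forall j k, (1 <= k <= n)%N -> (\int[P]_w (x j k w ^+ 2)%:E = 1)%E.
Hypothesis x8 : forall j k, (1 <= k <= n)%N -> (\int[P]_w (x j k w ^+ 8)%:E <= M%:E)%E.
Hypotheses (p1 : (0 < p)%N) (n1 : (0 < n)%N).

Definition sample (w : T) (k : nat) : 'cV[R]_p := \col_j x j k w.

Definition sample_index (i : nat) : 'I_p := odflt (Ordinal p1) (insub i).

Lemma sample_indexK (j : 'I_p) : sample_index j = j.
Proof. by rewrite /sample_index valK. Qed.

Lemma sample_index_inj i i' : (i < p)%N -> (i' < p)%N ->
  sample_index i = sample_index i' -> i = i'.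
Proof.
move=> ip i'p; rewrite -[i]/(val (Ordinal ip)) -[i']/(val (Ordinal i'p)).
by rewrite !sample_indexK => ->.
Qed.

Let mx j k : measurable_fun setT (x j k). Proof. exact: measurable_funPT. Qed.

Let msample (B : 'M[R]_p) k : measurable_fun setT (fun w => qform B (sample w k)).
Proof.
under eq_fun do rewrite qformE.
apply: measurable_sum => i; apply: measurable_sum => j; apply: measurable_funM => //.
by under eq_fun do rewrite !mxE; apply: measurable_funM; exact: mx.
Qed.

(** With y = S x and S^2 = A, |y|^2 = x^T A x: this is the mean square deviation of the squared
    norms of the observations from tr A. *)
Definition norm_spread (A : 'M[R]_p) (w : T) : R :=
  n%:R^-1 * \sum_(1 <= k < n.+1) (qform A (sample w k) - \tr A) ^+ 2.

Lemma norm_spread_mean (A : 'M[R]_p) : [/\ measurable_fun setT (norm_spread A),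
  forall w, 0 <= norm_spread A w &
  (\int[P]_w (norm_spread A w)%:E <= (quad_const M * frobenius2 A)%:E)%E].
Proof.
have n0 : 0 <= n%:R^-1 :> R by rewrite invr_ge0.
have mq k : measurable_fun setT (fun w => (qform A (sample w k) - \tr A) ^+ 2).
  by have := msample A k => ?; mfun.
have ms : measurable_fun setT
    (fun w => \sum_(1 <= k < n.+1) (qform A (sample w k) - \tr A) ^+ 2).
  exact: measurable_sum.
have s0 w : 0 <= \sum_(1 <= k < n.+1) (qform A (sample w k) - \tr A) ^+ 2.
  by apply: sumr_ge0 => k _; exact: sqr_ge0.
split.
- exact: measurable_funM.
- by move=> w; exact: mulr_ge0.
have C0 : 0 <= quad_const M * frobenius2 A.
  by rewrite mulr_ge0 ?frobenius2_ge0 ?quad_const_ge0.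
have -> : quad_const M * frobenius2 A =
    n%:R^-1 * \sum_(1 <= k < n.+1) (quad_const M * frobenius2 A).
  rewrite sumr_const_nat subn1 /= -[X in _ = _ * X]mulr_natl mulKf//.
  by rewrite pnatr_eq0 -lt0n.
apply: int_scalele => //.
under eq_integral do rewrite big_add1 big_mkord.
rewrite [X in X%:E]big_add1 big_mkord.
apply: int_sumle => // [k w|k]; first exact: sqr_ge0.
have kn : (1 <= k.+1 <= n)%N by rewrite /= ltn_ord.
apply: L2_of_L4 => //.
  by have := msample A k.+1 => ?; apply: measurable_funB.
have -> : (\int[P]_w ((qform A (sample w k.+1) - \tr A) ^+ 4)%:E =
    \int[P]_w ((qform A (\col_i x (sample_index i) k.+1 w) - \tr A) ^+ 4)%:E)%E.
  apply: eq_integral => w _; congr ((qform A _ - _) ^+ 4)%:E.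
  by apply/matrixP => i j; rewrite !mxE sample_indexK.
apply: (@quadratic_form_L4 _ _ _ P _ _ _ indep p (fun i => (sample_index i, k.+1)) M) => //.
- by move=> i i' ip i'p [] /(sample_index_inj ip i'p).
- by move=> i ip; exact: x1.
- by move=> i ip; exact: x2.
- by move=> i ip; exact: x8.
Qed.

Definition mean_norm2 (w : T) : R :=
  \sum_j (n%:R^-1 * \sum_(1 <= k < n.+1) x j k w) ^+ 2.

Lemma mean_norm2_mean : [/\ measurable_fun setT mean_norm2,
  forall w, 0 <= mean_norm2 w &
  (\int[P]_w (mean_norm2 w)%:E <= (p%:R / n%:R)%:E)%E].
Proof.
have ms j : measurable_fun setT (fun w => (n%:R^-1 * \sum_(1 <= k < n.+1) x j k w) ^+ 2).
  apply: measurable_funX; apply: measurable_funM => //.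
  by apply: measurable_sum => k; exact: mx.
split.
- exact: measurable_sum.
- by move=> w; apply: sumr_ge0 => j _; exact: sqr_ge0.
have -> : p%:R / n%:R = \sum_(j < p) n%:R^-1 :> R.
  by rewrite sumr_const card_ord mulr_natl.
apply: int_sumle => // [j w|j]; first exact: sqr_ge0.
(* The squared mean of a row is a quadratic form with constant matrix; its trace 1/n is the
   expectation. *)
pose B : 'M[R]_n := const_mx (n%:R^-1 ^+ 2).
have qB w : (n%:R^-1 * \sum_(1 <= k < n.+1) x j k w) ^+ 2 =
    qform B (\col_(k < n) x j k.+1 w).
  rewrite qformE big_add1 big_mkord exprMn [X in _ * X]expr2.
  rewrite mulr_suml mulr_sumr.
  apply: eq_bigr => k _; rewrite !mulr_sumr; apply: eq_bigr => l _.
  by rewrite !mxE.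
have trB : \tr B = n%:R^-1.
  rewrite /mxtrace; under eq_bigr do rewrite mxE.
  rewrite sumr_const card_ord -[X in X = _]mulr_natl expr2 mulVKf//.
  by rewrite pnatr_eq0 -lt0n.
have e1 i i' : (i < n)%N -> (i' < n)%N -> (j, i.+1) = (j, i'.+1) -> i = i'.
  by move=> _ _ [].
have H0 : (\int[P]_w (qform B (\col_(k < n) x j k.+1 w) - \tr B)%:E = 0)%E.
  apply: (@quadratic_form_mean0 _ _ _ P _ _ _ indep n (fun i => (j, i.+1)) M) => //.
  - by move=> k kn; exact: x1.
  - by move=> k kn; exact: x2.
  - by move=> k kn; exact: x8.
have Hi : P.-integrable setT
    (EFin \o (fun w => qform B (\col_(k < n) x j k.+1 w) - \tr B)).
  apply: (@quadratic_form_integrable _ _ _ P _ _ _ indep n (fun i => (j, i.+1)) M) => //.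
  - by move=> k kn; exact: x1.
  - by move=> k kn; exact: x2.
  - by move=> k kn; exact: x8.
have -> : (\int[P]_w ((n%:R^-1 * \sum_(1 <= k < n.+1) x j k w) ^+ 2)%:E =
    \int[P]_w ((qform B (\col_(k < n) x j k.+1 w) - \tr B)%:E + (\tr B)%:E))%E.
  by apply: eq_integral => w _; rewrite -EFinD subrK qB.
rewrite integralD//; last exact: (finite_measure_integrable_cst P (\tr B) measurableT).
by rewrite H0 add0e int_cstE trB.
Qed.

End sample.

(** * The process in terms of three log-determinants *)

Section representation.
Context {R : realType} (p : nat).

Lemma gram_colsum (n m : nat) (c : nat -> 'cV[R]_p) : (m <= n)%N ->
  (\matrix_(i < p, k < n) c k i 0) *m coord_proj n m *m
    (\matrix_(i < p, k < n) c k i 0)^T =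
  \sum_(0 <= k < m) c k *m (c k)^T.
Proof.
move=> mn; apply/matrixP => i j; rewrite mxE summxE.
rewrite (big_nat_widen _ _ n)//= big_mkord [RHS]big_mkcond /=.
apply: eq_bigr => k _; rewrite !mxE (bigD1 k) //= big1 => [|l lk]; last first.
  by rewrite !mxE (negbTE lk) mulr0.
rewrite !mxE eqxx /= addr0; case: ifP => km; last by rewrite mulr0 mul0r.
by rewrite mulr1 big_ord1 !mxE.
Qed.

Lemma ln_det_scov (i j : nat) (S : 'M[R]_p) (z y : nat -> 'cV[R]_p) :
  (i <= j)%N -> S^T = S -> \det S != 0 ->
  (forall k, (i <= k <= j)%N -> y k = S *m z k) ->
  let G := \sum_(i <= k < j.+1) z k *m (z k)^T in
  0 < \det G -> 0 < \det (scov y i j) /\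
  ln (\det (scov y i j)) = ln (\det G) + ln (\det S ^+ 2) - p%:R * ln (j.+1 - i)%:R.
Proof.
move=> ij ST S0 yE G G0; have r0 : 0 < (j.+1 - i)%:R :> R by rewrite ltr0n subn_gt0.
have sE : scov y i j = (j.+1 - i)%:R^-1 *: (S *m G *m S).
  rewrite /scov; congr (_ *: _); rewrite /G mulmx_sumr mulmx_suml.
  apply: eq_big_nat => k /andP[ik]; rewrite ltnS => kj.
  by rewrite yE ?ik// trmx_mul ST !mulmxA.
have S2 : 0 < \det S ^+ 2 by rewrite exprn_even_gt0.
have dE : \det (scov y i j) = (j.+1 - i)%:R^-1 ^+ p * (\det G * \det S ^+ 2).
  by rewrite sE detZ !det_mulmx; ring.
have rp : 0 < (j.+1 - i)%:R^-1 ^+ p :> R by rewrite exprn_gt0// invr_gt0.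
have GS : 0 < \det G * \det S ^+ 2 by exact: mulr_gt0.
rewrite dE; split; first exact: mulr_gt0.
rewrite lnM ?posrE// [X in _ + X]lnM ?posrE// lnXn ?invr_gt0// lnV ?posrE//.
by rewrite -mulr_natl; ring.
Qed.

Let ln_powR_ratio (a b c r s t : R) : 0 < a -> 0 < b -> 0 < c ->
  ln (a `^ r * b `^ s / c `^ t) = r * ln a + s * ln b - t * ln c.
Proof.
move=> a0 b0 c0; have pa := powR_gt0 r a0; have pb := powR_gt0 s b0.
have pc := powR_gt0 t c0.
by rewrite ln_div ?posrE ?mulr_gt0// lnM ?posrE// !ln_powR.
Qed.

(** The weights m/n, (n-m)/n and -1 sum to zero. This cancels ln det S^2, hence the covariance, and
    the term -p of [log_center]. *)
Lemma LR_process_repr (n : nat) (S : 'M[R]_p) (z y : nat -> 'cV[R]_p) (t0 : R)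
    (t : `[t0, 1 - t0]%classic) :
  let m := floor_nt n (\val t) in
  let G := \sum_(1 <= k < m.+1) z k *m (z k)^T in
  let G' := \sum_(m.+1 <= k < n.+1) z k *m (z k)^T in
  let Gn := \sum_(1 <= k < n.+1) z k *m (z k)^T in
  (0 < m < n)%N -> S^T = S -> \det S != 0 ->
  (forall k, (1 <= k <= n)%N -> y k = S *m z k) ->
  0 < \det G -> 0 < \det G' -> 0 < \det Gn ->
  LR_process n y t0 t =
    m%:R / n%:R * (ln (\det G) - log_center p m) +
    (n - m)%:R / n%:R * (ln (\det G') - log_center p (n - m)) -
    (ln (\det Gn) - log_center p n) + (kappa_hat n y - 3) * (p%:R / n%:R) / 2.
Proof.
move=> m G G' Gn /andP[m0 mn] ST S0 yE G0 G0' Gn0.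
have n0 : (0 < n)%N by exact: ltn_trans m0 mn.
have nr0 : n%:R != 0 :> R by rewrite pnatr_eq0 -lt0n.
have [d1 l1] := @ln_det_scov 1 m S z y m0 ST S0
  (fun k hk => yE k (introT andP (conj (proj1 (andP hk))
     (leq_trans (proj2 (andP hk)) (ltnW mn))))) G0.
have [d2 l2] := @ln_det_scov m.+1 n S z y mn ST S0
  (fun k hk => yE k (introT andP (conj (leq_ltn_trans (leq0n m) (proj1 (andP hk)))
     (proj2 (andP hk))))) G0'.
have [d3 l3] := @ln_det_scov 1 n S z y n0 ST S0 yE Gn0.
rewrite subSS subn0 in l1; rewrite subSS subn0 in l3; rewrite subSS in l2.
rewrite /LR_process /= /LR_process_fun /LR /centering -/m.
have lnLR : ln (\det (scov y 1 m) `^ (m%:R / 2) *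
    \det (scov y m.+1 n) `^ ((n - m)%:R / 2) / \det (scov y 1 n) `^ (n%:R / 2)) =
  m%:R / 2 * ln (\det (scov y 1 m)) + (n - m)%:R / 2 * ln (\det (scov y m.+1 n)) -
  n%:R / 2 * ln (\det (scov y 1 n)).
  exact: ln_powR_ratio.
rewrite lnLR l1 l2 l3 /log_center -/G -/G' -/Gn.
rewrite natrB ?(ltnW mn)//.
move: (ln (\det G)) (ln (\det G')) (ln (\det Gn)) (ln (\det S ^+ 2)) (ln m%:R)
  (ln (n%:R - m%:R)) (ln n%:R) (ln (1 - p%:R / m%:R)) (ln (1 - p%:R / n%:R))
  (ln (1 - p%:R / (n%:R - m%:R))) (kappa_hat n y) => g1 g2 g3 s a1 a2 a3 b1 b2 b3 k.
by field.
Qed.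

End representation.

(** * Modulus of continuity of the weighted combination *)

Section modulus.
Context {R : realType}.
Variables (n m0 : nat) (h h' : nat -> R) (C : R).
Hypotheses (n0 : (0 < n)%N) (m0n : (m0 <= n)%N) (C0 : 0 <= C).
Hypothesis hC : forall m, (m0 <= m <= n)%N -> `|h m| <= C.
Hypothesis h'C : forall m, (m0 <= m <= n)%N -> `|h' m| <= C.
Hypothesis hK : forall m m', (m0 <= m <= m')%N -> (m' <= n)%N ->
  `|h m' - h m| <= C * root8 ((m' - m)%:R / n%:R).
Hypothesis h'K : forall m m', (m0 <= m <= m')%N -> (m' <= n)%N ->
  `|h' m' - h' m| <= C * root8 ((m' - m)%:R / n%:R).

Let nr0 : 0 < n%:R :> R. Proof. by rewrite ltr0n. Qed.

Let wsum (m : nat) : R := m%:R / n%:R * h m + (n - m)%:R / n%:R * h' (n - m).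

Let ratio_ge0 k : 0 <= k%:R / n%:R :> R. Proof. by rewrite divr_ge0. Qed.

Let ratio_le1 k : (k <= n)%N -> k%:R / n%:R <= 1 :> R.
Proof. by move=> kn; rewrite ler_pdivrMr// mul1r ler_nat. Qed.

Lemma root8_ge_id (r : R) : 0 <= r -> r <= 1 -> r <= root8 r.
Proof.
move=> r0 r1; have H (s : R) : 0 <= s -> s <= 1 -> s <= Num.sqrt s <= 1.
  move=> s0 s1; apply/andP; split; last by rewrite -[leRHS]sqrtr1; exact: ler_wsqrtr.
  have q1 : Num.sqrt s <= 1 by rewrite -[leRHS]sqrtr1; exact: ler_wsqrtr.
  rewrite -{1}(sqr_sqrtr s0) expr2; apply: ler_piMl => //; exact: sqrtr_ge0.
have /andP[a1 a2] := H _ r0 r1.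
have /andP[b1 b2] := H _ (sqrtr_ge0 r) a2.
have /andP[c1 c2] := H _ (sqrtr_ge0 (Num.sqrt r)) b2.
exact: le_trans a1 (le_trans b1 c1).
Qed.

Let term_diff (g : nat -> R) k k' : (m0 <= k <= k')%N -> (k' <= n)%N ->
  (forall m, (m0 <= m <= n)%N -> `|g m| <= C) ->
  (forall m m', (m0 <= m <= m')%N -> (m' <= n)%N ->
    `|g m' - g m| <= C * root8 ((m' - m)%:R / n%:R)) ->
  `|k'%:R / n%:R * g k' - k%:R / n%:R * g k| <=
    2 * C * root8 ((k' - k)%:R / n%:R).
Proof.
move=> hk k'n gC gK; have /andP[mk kk'] := hk.
have -> : k'%:R / n%:R * g k' - k%:R / n%:R * g k =
    k'%:R / n%:R * (g k' - g k) + (k' - k)%:R / n%:R * g k.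
  by rewrite (natrB _ kk'); ring.
apply: le_trans (ler_normD _ _) _; rewrite !normrM.
have a1 := gK _ _ hk k'n; have a2 : `|g k| <= C by apply: gC; rewrite mk (leq_trans kk').
have e1 : `|k'%:R / n%:R| * `|g k' - g k| <= C * root8 ((k' - k)%:R / n%:R).
  rewrite -[leRHS]mul1r; apply: ler_pM => //.
  by rewrite ger0_norm// ratio_le1.
have e2 : `|(k' - k)%:R / n%:R| * `|g k| <= root8 ((k' - k)%:R / n%:R) * C.
  apply: ler_pM => //; rewrite ger0_norm//; apply: root8_ge_id => //.
  by apply: ratio_le1; exact: leq_trans (leq_subr _ _) k'n.
by move: e1 e2; rewrite -!normrM; move: (root8 _) => r e1 e2; lra.
Qed.

Let wsum_le m : (m0 <= m)%N -> (m0 <= n - m)%N -> (m <= n)%N -> `|wsum m| <= 2 * C.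
Proof.
move=> m1 m2 mn; apply: le_trans (ler_normD _ _) _; rewrite !normrM.
have a1 : `|h m| <= C by apply: hC; rewrite m1.
have a2 : `|h' (n - m)| <= C by apply: h'C; rewrite m2 leq_subr.
have T (u v : R) : 0 <= u -> u <= 1 -> `|v| <= C -> `|u| * `|v| <= C.
  by move=> u0 u1 vC; rewrite -[leRHS]mul1r; apply: ler_pM => //; rewrite ger0_norm.
have := T _ _ (ratio_ge0 m) (ratio_le1 mn) a1.
have := T _ _ (ratio_ge0 (n - m)) (ratio_le1 (leq_subr m n)) a2.
by rewrite -!normrM => x1 x2; have := lerD x2 x1; lra.
Qed.

Let wsum_diff m m' : (m0 <= m)%N -> (m <= m')%N -> (m0 <= n - m')%N -> (m' <= n)%N ->
  `|wsum m' - wsum m| <= 4 * C * root8 ((m' - m)%:R / n%:R).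
Proof.
move=> m1 mm' m2 mn.
have e1 := @term_diff h m m' (introT andP (conj m1 mm')) mn hC hK.
have mm2 : (n - m' <= n - m)%N by rewrite leq_sub2l.
have e2 := @term_diff h' (n - m') (n - m) (introT andP (conj m2 mm2)) (leq_subr m n) h'C h'K.
have nE : (n - m - (n - m') = m' - m)%N by move: mm' mn; clear; lia.
rewrite nE distrC in e2.
have -> : wsum m' - wsum m = (m'%:R / n%:R * h m' - m%:R / n%:R * h m) +
  ((n - m')%:R / n%:R * h' (n - m')%N - (n - m)%:R / n%:R * h' (n - m)%N).
  by rewrite /wsum; ring.
by apply: le_trans (ler_normD _ _) _; have := lerD e1 e2; lra.
Qed.

(** The floors of n s and n t differ by at most n |s - t| + 1; by subadditivity of [root8] this adds
    [root8 n%:R^-1]. The terms [h n] and [k] do not depend on t and leave the increments. *)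
Lemma weighted_modulus (F : R -> R) (k t0 : R) : `|k| <= C ->
  0 <= t0 -> m0%:R <= n%:R * t0 ->
  (forall t, t0 <= t <= 1 - t0 ->
    F t = wsum (floor_nt n t) - h n + k) ->
  (forall t, t0 <= t <= 1 - t0 -> `|F t| <= 4 * C) /\
  (forall s t, t0 <= s <= 1 - t0 -> t0 <= t <= 1 - t0 ->
    `|F s - F t| <= 4 * C * (root8 `|s - t| + root8 n%:R^-1)).
Proof.
move=> kC t00 m0t FE.
have fl t : t0 <= t <= 1 - t0 ->
    [/\ (m0 <= floor_nt n t)%N, (m0 <= n - floor_nt n t)%N, (floor_nt n t <= n)%N,
      (floor_nt n t)%:R <= n%:R * t & n%:R * t < (floor_nt n t)%:R + 1].
  move=> /andP[t1 t2]; have t3 : 0 <= t by exact: le_trans t1.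
  have nt0 : 0 <= n%:R * t by rewrite mulr_ge0.
  have /andP[f1 f2] := truncn_itv nt0; rewrite -/(floor_nt n t) -natr1 in f1 f2.
  have nt1 := ler_wpM2l (ltW nr0) t2; rewrite mulrBr mulr1 in nt1.
  have fn : (floor_nt n t <= n)%N.
    rewrite -(ler_nat R); apply: le_trans f1 _; apply: le_trans nt1 _.
    by rewrite gerBl mulr_ge0.
  split => //.
    rewrite /floor_nt truncn_ge_nat//; apply: le_trans m0t _.
    by apply: ler_wpM2l => //; exact: ltW.
  by rewrite -(ler_nat R) natrB//; move: m0t f1 nt1 => *; lra.
split=> [t ht|].
  have [f1 f2 f3 _ _] := fl t ht; rewrite (FE _ ht).
  have := wsum_le f1 f2 f3; have : `|h n| <= C by apply: hC; rewrite m0n leqnn.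
  by move: kC; rewrite !ler_norml => /andP[? ?] /andP[? ?] /andP[? ?]; apply/andP; split; lra.
have wlog_le s t : t0 <= s <= 1 - t0 -> t0 <= t <= 1 - t0 -> s <= t ->
    `|F t - F s| <= 4 * C * (root8 `|t - s| + root8 n%:R^-1).
  move=> hs ht st; have [f1 f2 f3 f4 f5] := fl t ht; have [g1 g2 g3 g4 g5] := fl s hs.
  have fst : (floor_nt n s <= floor_nt n t)%N.
    by rewrite /floor_nt; apply: le_truncn; apply: ler_wpM2l => //; exact: ltW.
  rewrite (FE _ hs) (FE _ ht).
  have -> : wsum (floor_nt n t) - h n + k - (wsum (floor_nt n s) - h n + k) =
    wsum (floor_nt n t) - wsum (floor_nt n s) by ring.
  apply: le_trans (wsum_diff g1 fst f2 f3) _; apply: ler_wpM2l; first by rewrite mulr_ge0.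
  have ni0 : 0 <= n%:R^-1 :> R by rewrite invr_ge0.
  apply: le_trans (root8D_le (normr_ge0 (t - s)) ni0).
  apply: root8_le; rewrite ger0_norm ?subr_ge0// natrB// ler_pdivrMr//.
  by rewrite mulrDl mulVf ?gt_eqF//; move: f4 f5 g4 g5 => *; lra.
move=> s t hs ht; have [st|/ltW ts] := leP s t; last exact: wlog_le.
by rewrite distrC (distrC s); exact: wlog_le.
Qed.

End modulus.

Section likely.
Context {R : realType} {d} {T : measurableType d} (P : probability T R).

Definition likely (e : R) (B : set T) : Prop :=
  measurable B /\ (P (~` B) <= e%:E)%E.

Lemma likelyI (e e' : R) (B B' : set T) :
  likely e B -> likely e' B' -> likely (e + e') (B `&` B').
Proof.
move=> [mB PB] [mB' PB']; split; first exact: measurableI.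
rewrite setCI EFinD; apply: le_trans (leeD PB PB').
by apply: measureU2; exact: measurableC.
Qed.

Lemma likely_ge (e : R) (B : set T) : likely e B -> ((1 - e)%:E <= P B)%E.
Proof.
move=> [mB PB].
have -> : (P B = 1 - P (~` B))%E.
  by rewrite -probability_setC ?setCK//; exact: measurableC.
by rewrite EFinB; apply: leeB.
Qed.

(** Markov's inequality. *)
Lemma likely_lt (f : T -> R) (a e : R) : 0 < a -> measurable_fun setT f ->
  (forall w, 0 <= f w) -> (\int[P]_w (f w)%:E <= e%:E)%E ->
  likely (a^-1 * e) [set w | f w < a].
Proof.
move=> a0 mf f0 fe.
have mB : measurable [set w | f w < a].
  rewrite [X in measurable X](_ : _ = f @^-1` `]-oo, a[%classic).
    by rewrite -[X in measurable X]setTI; exact: mf.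
  by apply/seteqP; split => w /=; rewrite in_itv.
split => //; set B := [set w | _] in mB *.
have mC : measurable (~` B) by exact: measurableC.
have ai0 : 0 <= a^-1 by rewrite invr_ge0 ltW.
rewrite -[X in P X]setIT -integral_indic//.
apply: (@int_le _ _ _ P _ (fun w => a^-1 * f w)) => //.
- by apply: measurable_funM.
- move=> w; rewrite indicE; case: (boolP (w \in _)) => [|_]; last exact: mulr_ge0.
  by rewrite inE /B /= => /negP; rewrite -leNgt ler_pdivlMl// mulr1.
- exact: int_scalele.
Qed.

End likely.

Lemma pow4_norm_le {R : realDomainType} (a b : R) : 0 <= b -> a ^+ 4 <= b ^+ 4 -> `|a| <= b.
Proof.
move=> b0; have -> : a ^+ 4 = `|a| ^+ 4.
  by rewrite (exprM a 2 2) (exprM `|a| 2 2) real_normK// num_real.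
by rewrite ler_pXn2r// nnegrE.
Qed.

(** * Bounds on the process at fixed n *)

Section process_bound.
Context {R : realType} {d} {T : measurableType d} (P : probability T R).
Variables (p n : nat) (x : 'I_p -> nat -> {RV P >-> R}).
Hypothesis indep : mutually_independent
  [set ji : 'I_p * nat | (1 <= ji.2 <= n)%N] (fun ji => x ji.1 ji.2).
Variable M : R.
Hypothesis M1 : 1 <= M.
Hypothesis x1 : forall j k, (1 <= k <= n)%N -> (\int[P]_w (x j k w)%:E = 0)%E.
Hypothesis x2 : forall j k, (1 <= k <= n)%N -> (\int[P]_w (x j k w ^+ 2)%:E = 1)%E.
Hypothesis x8 : forall j k, (1 <= k <= n)%N -> (\int[P]_w (x j k w ^+ 8)%:E <= M%:E)%E.
Hypotheses (p1 : (0 < p)%N) (pn : (p <= n)%N) (n2 : (1 < n)%N).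
Variables (c : R) (m0 : nat).
Hypotheses (c0 : 0 < c) (m0n : (m0 <= n)%N) (pm0 : p%:R + c * n%:R <= m0%:R :> R).

Let n0 : (0 < n)%N. Proof. exact: ltn_trans n2. Qed.

Let nr0 : 0 < n%:R :> R. Proof. by rewrite ltr0n. Qed.

(** [s] fixes the order of the observations: [succn] yields the first m of them, and k -> n - k the
    last m. *)
Definition gram_along (s : nat -> nat) (w : T) (m : nat) : 'M[R]_p :=
  \sum_(0 <= k < m) sample x w (s k) *m (sample x w (s k))^T.

Let hdet s w m : R := ln (\det (gram_along s w m)) - log_center p m.

(** Stated for any injective ordering so that it serves both blocks; 4 / c also absorbs the
    deterministic errors of [center_err_bounds]. *)
Let logdet_along (s : nat -> nat) :
  (forall k k', (k < n)%N -> (k' < n)%N -> s k = s k' -> k = k') ->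
  (forall k, (k < n)%N -> (1 <= s k <= n)%N) ->
  exists V W : T -> R,
  [/\ measurable_fun setT V /\ measurable_fun setT W,
      (forall w, 0 <= V w) /\ (forall w, 0 <= W w),
      (\int[P]_w (V w)%:E <= (array_const M c)%:E)%E /\
      (\int[P]_w (W w)%:E <= (array_const M c / n%:R)%:E)%E &
      forall w C, W w < 256^-1 -> 0 <= C -> V w <= C ^+ 4 ->
        (forall m, (m0 <= m <= n)%N ->
           0 < \det (gram_along s w m) /\ `|hdet s w m| <= C + 4 / c) /\
        (forall m m', (m0 <= m <= m')%N -> (m' <= n)%N ->
           `|hdet s w m' - hdet s w m| <=
             (C + 4 / c) * root8 ((m' - m)%:R / n%:R))].
Proof.
move=> sI sn; pose idx i k : 'I_p * nat := (sample_index p1 i, s k).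
have idxI i k i' k' : (i < p)%N -> (k < n)%N -> (i' < p)%N -> (k' < n)%N ->
    idx i k = idx i' k' -> i = i' /\ k = k'.
  move=> ip kn i'p k'n [iE kE]; split; last exact: sI.
  exact: (sample_index_inj ip i'p iE).
have := @array_logdet _ _ _ P _ _ _ indep M c M1 c0 _ _ _ n p m0 idx idxI _ n0 m0n pm0.
case => [[j k] /= hk|[j k] /= hk|[j k] /= hk|i k ip kn|V [W [mVW VW0 EVW H]]].
- exact: x1.
- exact: x2.
- exact: x8.
- exact: sn.
exists V, W; split => // w C Ww C0 VC.
have [H1 H2] := H w Ww; have [e1 e2] := center_err_bounds c0 n0 pm0.
have gE m : (m <= n)%N -> array_gram (fun ji => x ji.1 ji.2) n p idx m w = gram_along s w m.
  move=> mn; rewrite /gram_along -(gram_colsum _ mn) /array_gram.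
  have -> // : array_mx (fun ji => x ji.1 ji.2) n p idx w =
      \matrix_(i < p, k < n) sample x w (s k) i 0.
  by apply/matrixP => i k; rewrite !mxE /= sample_indexK.
have hE m : (m <= n)%N -> hdet s w m =
    array_G (fun ji => x ji.1 ji.2) n p idx m w + center_err p m.
  by move=> mn; rewrite /hdet /array_G /center_err gE//; ring.
have c40 : 0 <= 4 / c by rewrite divr_ge0// ltW.
split=> [m hm|m m' hm m'n].
  have /andP[_ mn] := hm; have [d0 G4] := H1 m hm; rewrite -gE//; split => //.
  rewrite hE//; apply: le_trans (ler_normD _ _) _; apply: lerD.
    by apply: pow4_norm_le => //; exact: le_trans VC.
  apply: le_trans (e1 m hm) _; apply: ler_wpM2r; first by rewrite invr_ge0 ltW.
  by rewrite ler_nat.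
have /andP[_ mm'] := hm; have mn := leq_trans mm' m'n.
rewrite !hE//.
set a := array_G _ _ _ _ m' w; set b := array_G _ _ _ _ m w.
have -> : a + center_err p m' - (b + center_err p m) =
  (a - b) + (center_err p m' - center_err p m) by ring.
have r0 : 0 <= (m' - m)%:R / n%:R :> R by rewrite divr_ge0.
have r1 : (m' - m)%:R / n%:R <= 1 :> R.
  by rewrite ler_pdivrMr// mul1r ler_nat (leq_trans (leq_subr _ _)).
rewrite mulrDl; apply: le_trans (ler_normD _ _) _; apply: lerD.
  apply: pow4_norm_le; first by rewrite mulr_ge0// root8_ge0.
  apply: le_trans (H2 m m' hm m'n) _.
  by rewrite exprMn root8_exp4; apply: ler_wpM2r => //; exact: sqrtr_ge0.
apply: le_trans (e2 m m' hm m'n) _; apply: ler_wpM2l => //.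
exact: root8_ge_id.
Qed.

Variables (S A : 'M[R]_p) (l u : R).
Hypotheses (l0 : 0 < l) (u0 : 0 <= u) (hA : psd A) (hS : psd_sqrt S A).
Hypotheses (hl : (l%:E <= lambda_min A)%E) (hu : (lambda_max A <= u%:E)%E).
Variables (a K t0 : R).
Hypotheses (a0 : 0 < a) (K0 : 0 < K) (t00 : 0 <= t0) (m0t : m0%:R <= n%:R * t0).
Hypotheses (Kp : 16 * K <= l ^+ 2 * p%:R) (bp : 4 * (u * K) <= l * p%:R).

Let ST : S^T = S. Proof. by have [[]] := hS. Qed.

Let sqnorm2E (v : 'cV[R]_p) : sqnorm2 (S *m v) = qform A v.
Proof.
have [_ <-] := hS; rewrite /qform mulmxA -mulmxA.
have <- : (S *m v)^T = v^T *m S by rewrite trmx_mul ST.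
have nE (z : 'cV[R]_p) : sqnorm2 z = (z^T *m z) 0 0.
  by rewrite mxE; apply: eq_bigr => j _; rewrite mxE expr2.
exact: nE.
Qed.

Let qform1E (v : 'cV[R]_p) : qform 1%:M v = sqnorm2 v.
Proof. by rewrite /qform mulmx1 mxE; apply: eq_bigr => j _; rewrite mxE expr2. Qed.

Definition process_const : R :=
  4 * (1 + a + 4 / c + kurtosis_bound (u * K) l u K).

(** Six Markov bounds: [V] at level a and [W] at level 1/256, for each of the two orderings;
    [norm_spread] at level K p; [mean_norm2] at level K. *)
Definition process_error : R :=
  2 * (array_const M c / a) + 512 * (array_const M c / n%:R) +
  quad_const M * u ^+ 2 / K + K^-1.

Let error_sum (e1 e2 e3 e4 e5 e6 : R) : e3 <= e4 -> e5 <= e6 ->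
  e1 + e1 + 256 * e2 + 256 * e2 + e3 + e5 <= 2 * e1 + 512 * e2 + e4 + e6.
Proof. by move=> h1 h2; lra. Qed.

Lemma process_bound (y : T -> nat -> 'cV[R]_p) :
  (forall w k, (1 <= k <= n)%N -> y w k = S *m sample x w k) ->
  exists B : set T, [/\ measurable B, ((1 - process_error)%:E <= P B)%E &
    forall w, B w ->
      (forall t, `|LR_process n (y w) t0 t| <= process_const) /\
      (forall s t, `|LR_process n (y w) t0 s - LR_process n (y w) t0 t| <=
         process_const * (root8 `|\val s - \val t| + root8 n%:R^-1))].
Proof.
move=> yE.
have pr0 : 0 < p%:R :> R by rewrite ltr0n.
have [||V [W [[mV mW] [V0 W0] [EV EW] HV]]] := @logdet_along succn.
- by move=> k k' _ _ [].
- by move=> k kn.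
have [||V' [W' [[mV' mW'] [V'0 W'0] [EV' EW'] HV']]] := @logdet_along (fun k => n - k)%N.
- by move=> k k' kn k'n; clear -kn k'n; lia.
- by move=> k kn; clear -kn; lia.
have [mS S0 ES] := norm_spread_mean indep M1 x1 x2 x8 p1 n0 A.
have [mN N0 EN] := mean_norm2_mean indep M1 x1 x2 x8 n0.
set V1 := norm_spread n x A in mS S0 ES; set N := mean_norm2 n x in mN N0 EN.
have q1 : (K * p%:R)^-1 * (quad_const M * frobenius2 A) <= quad_const M * u ^+ 2 / K.
  have fA := frobenius2_cov_le l0 hA hl hu.
  apply: (@le_trans _ _ ((K * p%:R)^-1 * (quad_const M * (u ^+ 2 * p%:R)))).
    apply: ler_wpM2l; first by rewrite invr_ge0 mulr_ge0// ltW.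
    by apply: ler_wpM2l => //; exact: quad_const_ge0.
  rewrite le_eqVlt; apply/orP; left; apply/eqP; field.
  by rewrite !gt_eqF.
have q2 : K^-1 * (p%:R / n%:R) <= K^-1.
  apply: ler_piMr; first by rewrite invr_ge0 ltW.
  by rewrite ler_pdivrMr// mul1r ler_nat.
have w256 : 0 < 256^-1 :> R by rewrite invr_gt0 ltr0n.
have [mB PB] := likelyI (likelyI (likelyI (likelyI (likelyI
  (likely_lt a0 mV V0 EV) (likely_lt a0 mV' V'0 EV'))
  (likely_lt w256 mW W0 EW)) (likely_lt w256 mW' W'0 EW'))
  (likely_lt (mulr_gt0 K0 pr0) mS S0 ES)) (likely_lt K0 mN N0 EN).
have {}PB := likely_ge (conj mB PB).
eexists; split; [exact: mB| |].
  apply: le_trans PB; rewrite lee_fin lerD2l lerN2 /process_error invrK.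
  rewrite (mulrC _ a^-1).
  exact: error_sum.
move=> w [[[[[/= l1 l2] l3] l4] l5] l6].
(* Taking C = 1 + a avoids a fourth root of a. *)
have a14 : a <= (1 + a) ^+ 4.
  have a1 : 1 <= 1 + a by rewrite lerDl ltW.
  by apply: (@le_trans _ _ (1 + a)); [rewrite lerDr|rewrite -[leLHS]expr1 ler_weXn2l].
have C0 : 0 <= 1 + a by rewrite addr_ge0// ltW.
have Vw : V w <= (1 + a) ^+ 4.
  exact: le_trans (ltW _) a14.
have V'w : V' w <= (1 + a) ^+ 4.
  exact: le_trans (ltW _) a14.
have [hb hd] := HV w _ l3 C0 Vw; have [hb' hd'] := HV' w _ l4 C0 V'w.
have uK0 : 0 <= u * K by rewrite mulr_ge0// ltW.
have kb : `|kappa_hat n (y w) - 3| <= kurtosis_bound (u * K) l u K.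
  apply: (@kappa_hat_bound R p n (y w) p1 pn n2 (\tr A) (u * K) l u K l0 u0 (ltW K0)
    uK0 (trace_cov_ge hA hl hu) (trace_cov_le hA hl hu)) => //.
    have -> : n%:R^-1 * \sum_(1 <= i < n.+1) (sqnorm2 (y w i) - \tr A) ^+ 2 = V1 w.
      rewrite /V1 /norm_spread; congr (_ * _); apply: eq_big_nat => i hi.
      by rewrite yE// sqnorm2E.
    exact: ltW.
  pose v := n%:R^-1 *: \sum_(1 <= k < n.+1) sample x w k.
  have -> : smean n (y w) = S *m v.
    rewrite /v -scalemxAr mulmx_sumr /smean; congr (_ *: _).
    by apply: eq_big_nat => i hi; rewrite yE.
  rewrite sqnorm2E; apply: le_trans (qform_cov_le hA hl hu _) _.
  apply: ler_wpM2l => //; rewrite qform1E.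
  have -> : sqnorm2 v = N w.
    apply: eq_bigr => j _; rewrite /v mxE summxE; congr ((_ * _) ^+ 2).
    by apply: eq_bigr => k _; rewrite mxE.
  exact: ltW.
set Cb := 1 + a + 4 / c + kurtosis_bound (u * K) l u K.
have kb0 : 0 <= kurtosis_bound (u * K) l u K by apply: le_trans kb.
have CCb : 1 + a + 4 / c <= Cb by rewrite /Cb lerDl.
have Cb0 : 0 <= Cb.
  by apply: le_trans CCb; apply: addr_ge0 => //; rewrite divr_ge0// ltW.
have kC : `|(kappa_hat n (y w) - 3) * (p%:R / n%:R) / 2| <= Cb.
  rewrite !normrM -mulrA; apply: (@le_trans _ _ (kurtosis_bound (u * K) l u K)); last first.
    by rewrite /Cb lerDr addr_ge0// divr_ge0// ltW.
  rewrite -[leRHS]mulr1; apply: ler_pM => //.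
  rewrite -normrM ger0_norm ?divr_ge0//.
  have : p%:R / n%:R <= 1 :> R by rewrite ler_pdivrMr// mul1r ler_nat.
  have -> : `|2^-1| = 2^-1 :> R by rewrite ger0_norm// invr_ge0.
  by move: (p%:R / n%:R) => r; lra.
have root0 (r : R) : 0 <= root8 r by exact: root8_ge0.
have [m1 m2] := @weighted_modulus R n m0 (hdet succn w) (hdet (fun k => n - k)%N w) Cb
  n0 m0n Cb0
  (fun m hm => le_trans (proj2 (hb m hm)) CCb)
  (fun m hm => le_trans (proj2 (hb' m hm)) CCb)
  (fun m m' hm hm' => le_trans (hd m m' hm hm') (ler_wpM2r (root0 _) CCb))
  (fun m m' hm hm' => le_trans (hd' m m' hm hm') (ler_wpM2r (root0 _) CCb))
  (fun t => let m := floor_nt n t in m%:R / n%:R * hdet succn w m +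
     (n - m)%:R / n%:R * hdet (fun k => n - k)%N w (n - m) - hdet succn w n +
     (kappa_hat n (y w) - 3) * (p%:R / n%:R) / 2) _ t0 kC t00 m0t (fun t _ => erefl).
have inI (t : `[t0, 1 - t0]%classic) : t0 <= \val t <= 1 - t0.
  by have := set_valP t; rewrite /= in_itv.
have repr (t : `[t0, 1 - t0]%classic) : LR_process_fun n (y w) t = (fun t => let m := floor_nt n t in
     m%:R / n%:R * hdet succn w m +
     (n - m)%:R / n%:R * hdet (fun k => n - k)%N w (n - m) - hdet succn w n +
     (kappa_hat n (y w) - 3) * (p%:R / n%:R) / 2) (\val t).
  have m00 : (0 < m0)%N.
    rewrite -(ltr0n R); apply: lt_le_trans pm0; by rewrite ltr_wpDr// mulr_ge0// ltW.
  have /andP[i1 i2] := inI t; have t0' : 0 <= \val t by exact: le_trans i1.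
  have nt0 : 0 <= n%:R * \val t by rewrite mulr_ge0.
  pose m := floor_nt n (\val t).
  have f1 : (m0 <= m)%N.
    rewrite /m /floor_nt truncn_ge_nat//; apply: le_trans m0t _.
    by apply: ler_wpM2l => //; exact: ltW.
  have f3 : m%:R <= n%:R - m0%:R :> R.
    have f2 : m%:R <= n%:R * \val t by rewrite truncn_le.
    apply: le_trans f2 _; apply: le_trans (ler_wpM2l (ltW nr0) i2) _.
    by rewrite mulrBr mulr1 lerD2l lerN2.
  have f4 : (m + m0 <= n)%N by rewrite -(ler_nat R) natrD -lerBrDr.
  have g1 k : gram_along succn w k = \sum_(1 <= i < k.+1) sample x w i *m (sample x w i)^T.
    by rewrite /gram_along big_add1.
  (* For k below n - m, the index n - k runs through m+1, ..., n in decreasing order. *)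
  have g2 : gram_along (fun k => n - k)%N w (n - m) =
      \sum_(m.+1 <= i < n.+1) sample x w i *m (sample x w i)^T.
    rewrite /gram_along big_nat_rev /= -[m.+1]add0n big_addn subSS.
    apply: eq_big_nat => k /andP[_ kn].
    have -> // : (n - (0 + (n - m) - k.+1) = k + m.+1)%N.
    by move: kn f4; clear; lia.
  have m1n : (m0 <= m <= n)%N by rewrite f1 (leq_trans (leq_addr _ _) f4).
  have m2n : (m0 <= n - m <= n)%N by rewrite leq_subr andbT leq_subRL ?(leq_trans (leq_addr _ _) f4).
  have nn : (m0 <= n <= n)%N by rewrite m0n leqnn.
  have [d1 _] := hb m m1n; have [d2 _] := hb' _ m2n; have [d3 _] := hb n nn.
  rewrite /hdet /= -/m; rewrite !g1 in d1 d3 *; rewrite g2 in d2 *.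
  apply: (@LR_process_repr _ p n S (sample x w) (y w)) => //.
  - by rewrite -/m (leq_trans m00 f1) -(addn0 m) (leq_trans _ f4)// ltn_add2l.
  - exact: (sqrt_det_neq0 l0 hS hl hu).
  - by move=> k; exact: yE.
by split=> [t|s t]; rewrite !repr; [exact: (m1 _ (inI t))|exact: (m2 _ _ (inI s) (inI t))].
Qed.

End process_bound.

Lemma cvg_root8_inv (R : realType) : root8 (n%:R^-1 : R) @[n --> \oo] --> (0 : R).
Proof.
apply/cvgrPdist_lt => e e0; have e8 : 0 < e ^+ 8 by exact: exprn_gt0.
have := nbhs_infty_gtr (e ^+ 8)^-1; apply: filterS => n ne.
have n0 : 0 < n%:R :> R by apply: lt_trans ne; rewrite invr_gt0.
rewrite sub0r normrN ger0_norm ?root8_ge0// -[ltRHS](root8_pow8 (ltW e0)) /root8.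
have h : n%:R^-1 < e ^+ 8 by rewrite invf_plt ?posrE.
have ni : 0 < n%:R^-1 :> R by rewrite invr_gt0.
by rewrite !ltr_sqrt// ?sqrtr_gt0.
Qed.

Theorem theorem3 (R : realType)
  (* dimension and triangular array *)
  (p : nat -> nat)
  (d : nat -> measure_display) (T : forall n, measurableType (d n))
  (P : forall n, probability (T n) R)
  (x : forall n, 'I_(p n) -> nat -> {RV (P n) >-> R})
  (Sigma Sigma_sqrt : forall n, nat -> 'M[R]_(p n))
  (law : probability (measurableTypeR R) R)
  (y t0 delta : R)
  (* y_i = Sigma_i^(1/2) x_i with Sigma_i a covariance matrix *)
  (Sigma_psd : forall n i, (1 <= i <= n)%N -> psd (Sigma n i))
  (Sigma_sqrtP : forall n i, (1 <= i <= n)%N ->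
     psd_sqrt (Sigma_sqrt n i) (Sigma n i))
  (t0_itv : t0 <= 1 - t0)
  (* (A-1) *)
  (y01 : 0 < y < 1)
  (pn_cvg : (p n)%:R / n%:R @[n --> \oo] --> y)
  (t001 : 0 < t0 < 1)
  (y_lt : y < Num.min t0 (1 - t0))
  (* (A-2) *)
  (x_indep : forall n,
     mutually_independent
       [set ji : 'I_(p n) * nat | (1 <= ji.2 <= n)%N]
       (fun ji => x n ji.1 ji.2))
  (x_law : forall n j i, (1 <= i <= n)%N ->
     forall A : set R, measurable A ->
       distribution (P n) (x n j i) A = law A)
  (law_continuous : continuous (fun r : R => law `]-oo, r]%classic))
  (law_var : 'V_law[fun r : R => r] = 1%E)
  (law_4 : (1 < 'E_law[(fun r : R => r ^+ 4)%R])%E)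
  (delta4 : 4 < delta)
  (law_delta : ('E_law[(fun r : R => `|r| `^ (4 + delta))%R] < +oo)%E)
  (* (A-3) *)
  (lmin : (0 < ereal_inf
     [set lambda_min (Sigma n 1%N) | n in [set n | (0 < n)%N]])%E)
  (lmax : (ereal_sup
     [set lambda_max (Sigma n 1%N) | n in [set n | (0 < n)%N]] < +oo)%E)
  (law_mean : ('E_law[fun r : R => r] = 0)%E)
  (* H0 *)
  (H0 : forall n i j, (1 <= i <= n)%N -> (1 <= j <= n)%N ->
     Sigma n i = Sigma n j) :
  asymptotically_tight P
    (fun n (w : T n) =>
       LR_process n
         (fun i => Sigma_sqrt n i *m \col_(j < p n) x n j i w) t0).
Proof.
have /andP[y0 _] := y01; have /andP[t00 t01] := t001.
move: y_lt; rewrite lt_min => /andP[yt _].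
(* The gap 4 c between y and t0 is spent on |p/n - y| < c, on the margin c n kept between p and the
   smallest block, and on the floor of n t0, with c n >= 1. *)
pose c := (t0 - y) / 4; have c0 : 0 < c by rewrite divr_gt0// subr_gt0.
have [l l0 hl] : exists2 l : R, 0 < l & (l%:E <= ereal_inf
    [set lambda_min (Sigma n 1%N) | n in [set n | (0 < n)%N]])%E.
  move: lmin; case: (ereal_inf _) => [r| |] r0 //; first by exists r.
  by exists 1 => //; exact: leey.
have [u u0 hu] : exists2 u : R, 0 <= u & (ereal_sup
    [set lambda_max (Sigma n 1%N) | n in [set n | (0 < n)%N]] <= u%:E)%E.
  move: lmax; case: (ereal_sup _) => [r| |] r0 //; last by exists 0 => //; exact: leNye.
  by exists `|r| => //; rewrite lee_fin ler_norm.
have [M M1 HM] := law_moments law_var delta4 law_delta law_mean.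
apply: (tight_of_modulus (r := fun n => root8 n%:R^-1)).
- by move=> n; exact: root8_ge0.
- exact: cvg_root8_inv.
move=> eps eps0.
pose AC := array_const M c; pose q := quad_const M * u ^+ 2 + 1.
have q0 : 0 < q by rewrite /q ltr_wpDl// mulr_ge0 ?sqr_ge0 ?quad_const_ge0.
(* The error splits as 2 (eps/8) from a, 512 (eps/2048) from n >= b4, and eps/2 from K: eps in all.
   The absolute value spares a proof that [AC] is nonnegative. *)
pose a := 8 * `|AC| / eps + 1.
have a0 : 0 < a by rewrite /a ltr_wpDl// divr_ge0 ?(ltW eps0)// mulr_ge0.
pose K := 2 * q / eps; have K0 : 0 < K by rewrite /K divr_gt0// mulr_gt0.
exists `|process_const c l u a K|; first exact: normr_ge0.
(* Thresholds on n: b1 for c n >= 1, b2 and b3 for the two size conditions on p of the kurtosis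
   bound, b4 for the error term in 1/n. *)
pose b1 := c^-1; pose b2 := 32 * K / (l ^+ 2 * y); pose b3 := 8 * (u * K) / (l * y).
pose b4 := 2048 * `|AC| / eps.
have b10 : 0 <= b1 by rewrite invr_ge0 ltW.
have b20 : 0 <= b2.
  by apply: divr_ge0; apply: mulr_ge0; rewrite ?ler0n ?exprn_ge0// ltW.
have b30 : 0 <= b3.
  apply: divr_ge0; apply: mulr_ge0; rewrite ?ler0n ?(ltW l0) ?(ltW y0)//.
  by rewrite mulr_ge0// ltW.
have b40 : 0 <= b4.
  by apply: divr_ge0; [apply: mulr_ge0; [exact: ler0n|exact: normr_ge0]|exact: ltW].
have near1 : \forall n \near \oo, `|y - (p n)%:R / n%:R| < Num.min c (y / 2).
  by move/cvgrPdist_lt : pn_cvg; apply; rewrite lt_min c0 divr_gt0.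
have near2 := nbhs_infty_ger (2 + b1 + b2 + b3 + b4 : R).
apply: filterS2 near1 near2 => n; rewrite lt_min => /andP[yc yy] nb.
have nb0 : 2 <= n%:R :> R by lra.
have n2 : (1 < n)%N by rewrite -(ler_nat R).
have n0 : (0 < n)%N by exact: ltn_trans n2.
have nr0 : 0 < n%:R :> R by rewrite ltr0n.
move: yc yy; rewrite !ltr_norml => /andP[yc1 _] /andP[_ yy2].
have pc : (p n)%:R <= (y + c) * n%:R.
  by rewrite -ler_pdivrMr//; lra.
have py : y / 2 * n%:R <= (p n)%:R.
  by rewrite -ler_pdivlMr//; lra.
have cn1 : 1 <= c * n%:R.
  by rewrite -ler_pdivrMl// mulr1 -/b1; lra.
have nt0 : 0 <= n%:R * t0 by rewrite mulr_ge0// ltW.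
have /andP[f1 f2] := truncn_itv nt0.
rewrite -/(floor_nt n t0) -natr1 in f1 f2.
have ct : t0 = y + 4 * c by rewrite /c; field.
have pm0 : (p n)%:R + c * n%:R <= (floor_nt n t0)%:R.
  have : n%:R * t0 = (y + 4 * c) * n%:R by rewrite ct mulrC.
  by move: f2 pc cn1 => *; lra.
have m0n : (floor_nt n t0 <= n)%N.
  rewrite -(ler_nat R); apply: le_trans f1 _.
  by rewrite ler_piMr// ltW.
have p1 : (0 < p n)%N.
  by rewrite -(ltr0n R); apply: lt_le_trans py; rewrite mulr_gt0// divr_gt0.
have pn : (p n <= n)%N.
  rewrite -(ler_nat R); apply: (@le_trans _ _ (floor_nt n t0)%:R); last by rewrite ler_nat.
  by apply: le_trans pm0; rewrite lerDl mulr_ge0// ltW.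
have Kp : 16 * K <= l ^+ 2 * (p n)%:R.
  have ly0 : 0 < l ^+ 2 * y by rewrite mulr_gt0// exprn_gt0.
  have : b2 <= n%:R by lra.
  rewrite /b2 ler_pdivrMr// => h.
  have := ler_wpM2l (exprn_ge0 2 (ltW l0)) py.
  have -> : l ^+ 2 * (y / 2 * n%:R) = n%:R * (l ^+ 2 * y) / 2 by field.
  by lra.
have bp : 4 * (u * K) <= l * (p n)%:R.
  have ly0 : 0 < l * y by rewrite mulr_gt0.
  have : b3 <= n%:R by lra.
  rewrite /b3 ler_pdivrMr// => h.
  have := ler_wpM2l (ltW l0) py.
  have -> : l * (y / 2 * n%:R) = n%:R * (l * y) / 2 by field.
  by lra.
have i1 : (1 <= 1 <= n)%N by rewrite n0.
have hA := Sigma_psd n _ i1; have hS := Sigma_sqrtP n _ i1.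
have hln : (l%:E <= lambda_min (Sigma n 1%N))%E.
  by apply: le_trans hl _; apply: ereal_inf_lbound; exists n.
have hun : (lambda_max (Sigma n 1%N) <= u%:E)%E.
  by apply: le_trans hu; apply: ereal_sup_ubound; exists n.
have x1 j k (hk : (1 <= k <= n)%N) := HM _ _ _ (x n j k) (x_law n j k hk).
(* Under H0 all the square roots are roots of the same matrix; by [psd_sqrt_unique] they equal the
   first one, so that a single S transforms all the samples. *)
have [B [mB PB HB]] := @process_bound _ _ _ (P n) (p n) n (x n) (x_indep n) M M1
  (fun j k hk => let: And3 h _ _ := x1 j k hk in h)
  (fun j k hk => let: And3 _ h _ := x1 j k hk in h)
  (fun j k hk => let: And3 _ _ h := x1 j k hk in h)
  p1 pn n2 c (floor_nt n t0) c0 m0n pm0 (Sigma_sqrt n 1%N) (Sigma n 1%N) l u l0 u0 hA hS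
  hln hun a K t0 a0 K0 (ltW t00) f1 Kp bp
  (fun w i => Sigma_sqrt n i *m \col_(j < p n) x n j i w)
  (fun w k hk => congr1 (mulmx^~ _) (psd_sqrt_unique
     (eq_ind _ (psd_sqrt (Sigma_sqrt n k)) (Sigma_sqrtP n k hk) _ (H0 n k 1%N hk i1)) hS)).
exists B; split => //.
  apply: le_trans PB; rewrite lee_fin lerD2l lerN2 /process_error -/AC.
  have e1 : AC / a <= eps / 8.
    rewrite ler_pdivrMr// /a mulrDr mulr1.
    have -> : eps / 8 * (8 * `|AC| / eps) = `|AC| by field; rewrite gt_eqF.
    have := ler_norm AC; lra.
  have e2 : AC / n%:R <= eps / 2048.
    rewrite ler_pdivrMr//; have : b4 <= n%:R by lra.
    rewrite /b4 ler_pdivrMr// => h; have := ler_norm AC; lra.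
  have e3 : quad_const M * u ^+ 2 / K + K^-1 = eps / 2.
    rewrite -[X in _ + X]mul1r -mulrDl -/q /K; field.
    by rewrite !gt_eqF.
  by rewrite -addrA e3; lra.
move=> w /HB[H1 H2]; split=> [t|s t].
  by apply: le_trans (H1 t) _; exact: ler_norm.
apply: le_trans (H2 s t) _; apply: ler_wpM2r; last exact: ler_norm.
by rewrite addr_ge0// root8_ge0.
Qed.
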